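(* Let $R$ be an $\mathbb N$-graded Noetherian domain. (1) Let $I$ be a homogeneous ideal of $R$ generated by homogeneous elements $a_1,\ldots,a_l$ with $\deg a_i=d_i$ for all $1\le i\le l$. Consider the filtration $\mathcal I=\{I_n=\overline{I^n}\}$, where $\overline{I^n}$ is the integral closure of $I^n$. Suppose the $R$-algebra $\bigoplus_{n\in\mathbb N}\overline{I^n}$ is a finitely generated $R[I]$-module, where $R[I]=\bigoplus_{n\ge 0}I^n$. Let $\mathfrak p\in\overline A(\mathcal I)$. Then $v_{\mathfrak p}(\overline{I^n})$ and $v(\overline{I^n})$ are eventually linear functions in $n$ with leading coefficient from the set $\{d_1,\ldots,d_l\}$ (that is, each is of the form $an+b$ for all $n\gg 0$, with $a\in\{d_1,\ldots,d_l\}$). (2) Let $I$ and $L$ be two homogeneous ideals of $R$ and consider the generalized symbolic power filtration $\mathcal I=\{I_n=(I^n:L^\infty)\}$. Suppose $\mathcal I$ is a Noetherian filtration. Then the following hold. (a) $v_{\mathfrak p}(I_n)$ (for every $\mathfrak p\in\overline A(\mathcal I)$) and $v(I_n)$ are of quasi-linear type as functions of $n$. (b) If one of the following holds: (i) $R=K[x_1,\ldots,x_m]$ is a polynomial ring over a field $K$ and $I$ is an equigenerated monomial ideal, (ii) $I$ is an equigenerated homogeneous ideal and $R_0$ is a local ring with infinite residue field, then $\lim_{n\to\infty}\frac{v_{\mathfrak p}(I_n)}{n}$ exists for all $\mathfrak p\in\overline A(\mathcal I)$ and $$\lim_{n\to\infty}\frac{v(I_n)}{n}=\frac{\alpha(I_{\operatorname{svd}(\mathcal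 I)})}{\operatorname{svd}(\mathcal I)}.$$ (c) Let $R=K[x_1,\ldots,x_m]$ be a polynomial ring over a field $K$, let $J$ be the cover ideal of a finite simple graph $G$ with $m$ vertices and let $\mathcal I=\{I_n=J^{(n)}\}$. Then $\lim_{n\to\infty}\frac{v(I_n)}{n}$ and $\lim_{n\to\infty}\frac{v_{\mathfrak p}(I_n)}{n}$ exist for all $\mathfrak p\in\overline A(\mathcal I)$, and $\lim_{n\to\infty}\frac{v(I_n)}{n}=\frac{\alpha(J^{(2)})}{2}$.
   Context: Here $\mathbb N$ includes $0$ and $R=\bigoplus_{n\in\mathbb N}R_n$; polynomial rings over a field carry the standard grading. For a homogeneous ideal $I$ of an $\mathbb N$-graded Noetherian ring $R$ and $\mathfrak p\in\operatorname{Ass}(R/I)$, the local $v$-number is $v_{\mathfrak p}(I)=\min\{u:\text{there exists } f\in R_u \text{ with } \mathfrak p=(I:f)\}$, and the $v$-number is $v(I)=\min\{v_{\mathfrak p}(I):\mathfrak p\in\operatorname{Ass}(R/I)\}$. A filtration $\mathcal I=\{I_n\}_{n\in\mathbb N}$ of ideals of $R$ is a family with $I_0=R$, $I_rI_s\subset I_{r+s}$ for all $r,s$, and $I_s\subset I_r$ whenever $r\le s$. It is Noetherian if $\bigoplus_{n\ge0}I_n$ is a finitely generated $R$-algebra. If $\operatorname{Ass}(R/I_n)=\operatorname{Ass}(R/I_{n+1})$ for all $n\gg0$ (which is known for all filtrations in the statement), $\overline A(\mathcal I)$ denotes this stable set $\operatorname{Ass}(R/I_n)$, $n\gg0$. $(I^n:L^\infty)=\bigcup_{t\ge1}(I^n:L^t)$.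 A function $f:\mathbb N\to\mathbb N$ is of quasi-linear type of period $t$ ($t\ge1$ an integer) if there exist linear polynomials $P_0(X),\ldots,P_{t-1}(X)\in\mathbb Q[X]$ such that for all $n\gg0$, $f(n)=P_i(n)$ where $n=mt+i$ with $0\le i\le t-1$; it is of quasi-linear type if this holds for some $t$. (For $v_{\mathfrak p}(I_n)$ only large $n$ matter.) For a homogeneous ideal $I$, $\alpha(I)=\min\{d:I_d\ne0\}$, where $I_d$ is the degree-$d$ component of $I$. $I$ is equigenerated if it is generated by homogeneous elements of the same degree. For a Noetherian filtration $\mathcal I$, the standard Veronese degree is $\operatorname{svd}(\mathcal I)=\min\{e\ge1: I_{en}=I_e^n\text{ for all }n\ge1\}$ (such $e$ exists). For a finite simple graph $G$ with vertex set $\{1,\ldots,m\}$ and edge set $E(G)$, the cover ideal is $J(G)=\bigcap_{(i,j)\in E(G)}\langle x_i,x_j\rangle\subset K[x_1,\ldots,x_m]$. The $n$-th symbolic power is $J^{(n)}=\bigcap_{Q\in\operatorname{Ass}(R/J)}(J^nR_Q\cap R)$. *)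

(* Defs.v *)
From HB Require Import structures.
From mathcomp Require Import all_boot all_order all_algebra.
From mathcomp Require Import boolp classical_sets functions cardinality reals.
From mathcomp Require Import topology normedtype sequences.
(* The notations of mpoly clash with those of MathComp-Analysis. *)
From mathcomp Require Import -(notations) mpoly.

Set Implicit Arguments.
Unset Strict Implicit.
Unset Printing Implicit Defensive.

Import Order.TTheory GRing.Theory Num.Theory.

Local Open Scope classical_set_scope.
Local Open Scope ring_scope.

(* The convention min(set0) = 0 matters in two degenerate cases: the unit ideal
   has no associated prime, so its v-number is 0, and the zero ideal has no
   nonzero component, so its initial degree alpha is 0. *)
Definition natmin (S : set nat) : nat :=
  xget 0%N [set n | S n /\ forall k, S k -> (n <= k)%N].

Section Ideals.
Variable R : comNzRingType.
Implicit Types (S I J p : set R) (x : R) (n : nat) (F : nat -> set R).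

(* J is an ideal of the subring S *)
Definition ideal_of S J : Prop :=
  [/\ J `<=` S, J 0, forall x y, J x -> J y -> J (x + y)
    & forall a x, S a -> J x -> J (a * x)].

Definition ideal J : Prop := ideal_of setT J.

Definition ideal_gen S : set R := smallest ideal S.

Definition noetherian_ring : Prop :=
  forall J, ideal J -> exists s : seq R, J = ideal_gen [set` s].

Definition ideal_mul I J : set R := ideal_gen [set x * y | x in I & y in J].

Definition ideal_pow I n : set R := iter n (ideal_mul I) setT.

Definition prime_ideal p : Prop :=
  [/\ ideal p, ~ p 1 & forall x y, p (x * y) -> p x \/ p y].

Definition colon_elt I x : set R := [set r | I (r * x)].

Definition colon I J : set R := [set r | forall x, J x -> I (r * x)].

(* (I : L^oo) *)
Definition saturation I L : set R :=
  \bigcup_(t in [set t | (1 <= t)%N]) colon I (ideal_pow L t).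

(* Ass(R/I) *)
Definition Ass I : set (set R) :=
  [set p | prime_ideal p /\ exists x, p = colon_elt I x].

Definition integral_closure I : set R :=
  [set x | exists n (a : nat -> R), [/\ (0 < n)%N,
     forall i, (1 <= i <= n)%N -> ideal_pow I i (a i)
     & x ^+ n + \sum_(1 <= i < n.+1) a i * x ^+ (n - i) = 0]].

Definition filtration F : Prop :=
  [/\ forall n, ideal (F n), F 0%N = setT,
      forall r s, ideal_mul (F r) (F s) `<=` F (r + s)%N
    & forall r s, (r <= s)%N -> F s `<=` F r].

(* The graded algebra of a filtration, realized in R[t]: the polynomials whose
   coefficient of t^n lies in the n-th ideal. *)
Definition rees F : set {poly R} := [set q | forall n, F n q`_n].

Definition subalgebra (A : set {poly R}) : Prop :=
  [/\ forall c : R, A c%:P, forall q r, A q -> A r -> A (q + r)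
    & forall q r, A q -> A r -> A (q * r)].

Definition fg_algebra (A : set {poly R}) : Prop :=
  exists s : seq {poly R}, A = smallest subalgebra [set` s].

Definition submodule_over (A M : set {poly R}) : Prop :=
  [/\ M 0, forall q r, M q -> M r -> M (q + r)
    & forall c q, A c -> M q -> M (c * q)].

Definition fg_module_over (A M : set {poly R}) : Prop :=
  exists s : seq {poly R}, M = smallest (submodule_over A) [set` s].

Definition noetherian_filtration F : Prop :=
  filtration F /\ fg_algebra (rees F).

(* The stable value of Ass(R/F_n) for large n; when these sets stabilize, it is
   the set of the p that lie in all but finitely many of them. *)
Definition stable_Ass F : set (set R) :=
  [set p | \forall n \near \oo, Ass (F n) p].

(* standard Veronese degree *)
Definition svd F : nat :=
  natmin [set e | (1 <= e)%N /\
    forall n, (1 <= n)%N -> F (e * n)%N = ideal_pow (F e) n].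

Definition maximal_ideal_of S J : Prop :=
  [/\ ideal_of S J, J <> S
    & forall J', ideal_of S J' -> J `<=` J' -> J' = J \/ J' = S].

(* The subring S is local, with maximal ideal J, and the set of cosets S/J is
   infinite. *)
Definition local_infinite_residue S : Prop :=
  exists J, [/\ maximal_ideal_of S J,
    forall J', maximal_ideal_of S J' -> J' = J
    & infinite_set [set [set y | S y /\ J (y - x)] | x in S]].

(* J R_Q `&` R when R is a domain and Q a prime: r lies in it iff r = a / s
   in Frac(R) for some a in J and s outside Q. *)
Definition local_contraction J Q : set R :=
  [set r | exists a s, [/\ J a, ~ Q s & s * r = a]].

Definition symbolic_power J n : set R :=
  \bigcap_(Q in Ass J) local_contraction (ideal_pow J n) Q.

End Ideals.

Section Graded.
Variable R : comNzRingType.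
Implicit Types (gr : nat -> set R) (I p : set R).

(* gr d is the degree-d component of an N-grading of R *)
Definition grading gr : Prop :=
  [/\ [/\ gr 0%N 1, forall d, gr d 0,
          forall d x y, gr d x -> gr d y -> gr d (x - y)
        & forall d e x y, gr d x -> gr e y -> gr (d + e)%N (x * y)],
      forall x, exists N (c : nat -> R),
        (forall d, gr d (c d)) /\ x = \sum_(d < N) c d
    & forall N (c : nat -> R), (forall d, gr d (c d)) ->
        \sum_(d < N) c d = 0 -> forall d, (d < N)%N -> c d = 0].

Definition homogeneous_ideal gr I : Prop :=
  ideal I /\ I = ideal_gen (I `&` \bigcup_d gr d).

Definition equigenerated gr I : Prop :=
  exists d (S : set R), S `<=` gr d /\ I = ideal_gen S.

(* initial degree *)
Definition alpha gr I : nat :=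
  natmin [set d | exists x, [/\ x <> 0, I x & gr d x]].

Definition local_v gr p I : nat :=
  natmin [set u | exists2 f, gr u f & p = colon_elt I f].

Definition v_number gr I : nat :=
  natmin [set local_v gr p I | p in Ass I].

End Graded.

Section Polynomials.
Variables (K : fieldType) (m : nat).

Definition std_grading (d : nat) : set (mpoly m K) :=
  [set q | q \is ishomog1 d mdeg].

Definition monomial_ideal (I : set (mpoly m K)) : Prop :=
  exists E : set (multinom m), I = ideal_gen [set mpolyX K u | u in E].

Definition cover_ideal (e : rel 'I_m) : set (mpoly m K) :=
  \bigcap_(ij in [set ij : 'I_m * 'I_m | e ij.1 ij.2])
    ideal_gen [set mpolyX K (mnm1 ij.1); mpolyX K (mnm1 ij.2)].

End Polynomials.

Definition eventually_linear (f : nat -> nat) (a : nat) : Prop :=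
  exists b : int, \forall n \near \oo, (f n)%:Z = (a * n)%N%:Z + b.

Definition quasi_linear (f : nat -> nat) : Prop :=
  exists t (P : nat -> {poly rat}), [/\ (1 <= t)%N,
    forall i, (i < t)%N -> (size (P i) <= 2)%N
    & \forall n \near \oo, (f n)%:R = (P (n %% t)%N).[n%:R]].

(* Main.v *)
From HB Require Import structures.
Require Import Defs.
From mathcomp Require Import all_boot all_order all_algebra.
From mathcomp Require Import boolp classical_sets functions cardinality reals.
From mathcomp Require Import topology normedtype sequences.
From mathcomp Require Import -(notations) mpoly.
From mathcomp Require Import zify ring.

(* The families (F_n) of the theorem become, along arithmetic progressions,
   graded modules finitely generated over the Rees algebra of a homogeneous ideal
   J, and Hilbert's basis theorem gives the ascending chain condition for graded
   submodules. An element f with (F_n : f) = p lies in (F_n : z) for every z in p,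
   and multiplication by z embeds the family (F_n : z) into F; so v_p(F_n) is the
   initial degree of the n-th component of a noetherian bigraded module, namely of
   (F_n : p) modulo its elements annihilated outside p. A filtration of that module
   whose quotients are Rees algebras modulo homogeneous primes reduces the initial
   degree to a minimum of finitely many functions that are linear with slopes among
   the degrees of the generators of J, and also shows that only finitely many
   primes occur.

   Suppose (F_(n+1) : (y_1, ..., y_r)) = F_n for large n. A prime (F_n : f) is then
   the intersection of the ideals (F_(n+1) : y_i f), hence equal to one of them, so
   v-numbers have bounded increments and the slopes along different progressions
   agree. If F_(en) = J^n with J = F_e, let B be generated by the elements of J of
   degree alpha(J). The ideals (J^(n+1) : B^n) increase to a proper ideal, and an
   associated prime (D : g) of that ideal D is some (J^(n+1) : w g) with w of degree
   n alpha(J) in B^n; this bounds v(J^(n+1)) by n alpha(J) plus a constant. *)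

Set Implicit Arguments.
Unset Strict Implicit.
Unset Printing Implicit Defensive.

Import Order.TTheory GRing.Theory Num.Theory.
Import numFieldNormedType.Exports.

Local Open Scope classical_set_scope.
Local Open Scope ring_scope.

(** * Hilbert's basis theorem for modules *)

(** The obstacle is that the witnesses f of (F_n : f) = p range over all of R, and the constant
    family n -> R is in general not finitely generated over the Rees algebra of J. One fixed nonzero
    z cures this: a homogeneous z in F_1 has z^n in F_n, hence lies in every associated prime of
    every F_n, so the witnesses for all n and all p sit in the single family (F_n : z). Dividing by
    z afterwards uses that R is a domain. Modules and quotients are never built as types. A graded
    module over the Rees algebra is a family of ideals of R, a quotient is a pair N, W of such
    families, and its degrees are those of the homogeneous elements of W outside N. The relation
    (F_(n+1) : (y_1, ..., y_r)) = F_n comes from Ratliff's theorem for saturations, and for cover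
    ideals from the products of all variables but one. *)

Lemma acc_max (T : Type) (le : T -> T -> Prop) (Q : T -> Prop) :
  (forall u : nat -> T, (forall n, Q (u n)) -> (forall n, le (u n) (u n.+1)) ->
     exists n, le (u n.+1) (u n)) ->
  forall x, Q x -> exists y, Q y /\ forall z, Q z -> le y z -> le z y.
Proof.
move=> acc x Qx; apply: contrapT => nmax.
have next (y : {y | Q y}) : exists z : {z | Q z},
    le (sval y) (sval z) /\ ~ le (sval z) (sval y).
  apply: contrapT => h; apply: nmax; exists (sval y); split; first exact: svalP.
  move=> z Qz leyz; apply: contrapT => h'; apply: h.
  by exists (exist _ z Qz).
have [f hf] := choice next.
pose u n := sval (iter n f (exist _ x Qx)).
have [n|n|n] := acc u; first exact: svalP; first exact: (hf _).1.
exact: (hf _).2.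
Qed.

Section Modules.
Variable B : comNzRingType.
Implicit Types (A M U : set B) (s : seq B) (b x y : B).

Definition sring A : Prop :=
  [/\ A 1, forall x y, A x -> A y -> A (x - y)
    & forall x y, A x -> A y -> A (x * y)].

Definition modl A M : Prop :=
  [/\ M 0, forall x y, M x -> M y -> M (x + y)
    & forall a x, A a -> M x -> M (a * x)].

Fixpoint lspan A s : set B :=
  if s is g :: s' then
    [set x | exists a y, [/\ A a, lspan A s' y & x = a * g + y]]
  else [set 0].

Definition noeth A M : Prop :=
  forall U, modl A U -> U `<=` M ->
    exists s, (forall g, g \in s -> U g) /\ U `<=` lspan A s.

Section Subring.
Variable A : set B.
Hypothesis hA : sring A.

Lemma sring0 : A 0. Proof. by have [h1 hB _] := hA; rewrite -(subrr 1); exact: hB. Qed.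

Lemma sringN x : A x -> A (- x).
Proof. by have [h1 hB _] := hA; rewrite -sub0r; apply: hB; exact: sring0. Qed.

Lemma sringD x y : A x -> A y -> A (x + y).
Proof.
by have [h1 hB _] := hA => Ax Ay; rewrite -[y]opprK; apply: hB => //; exact: sringN.
Qed.

Lemma sringM x y : A x -> A y -> A (x * y). Proof. by case: hA => _ _; apply. Qed.

Lemma sring1 : A 1. Proof. by case: hA. Qed.

Lemma sring_modl : modl A A.
Proof. split; [exact: sring0 | exact: sringD | exact: sringM]. Qed.

Lemma modlN M x : modl A M -> M x -> M (- x).
Proof.
by move=> [_ _ hM] Mx; rewrite -mulN1r; apply: hM => //; apply: sringN; exact: sring1.
Qed.

Lemma modlB M x y : modl A M -> M x -> M y -> M (x - y).
Proof. by move=> hM Mx My; have [_ hD _] := hM; apply: hD => //; exact: modlN. Qed.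

Lemma span_modl s : modl A (lspan A s).
Proof.
elim: s => [|g s [h0 hD hM]] /=.
  by split=> // [x y -> ->|a x _ ->]; rewrite ?addr0 ?mulr0.
split.
- by exists 0, 0; split => //; [exact: sring0 | rewrite mul0r addr0].
- move=> _ _ [a [x [Aa sx ->]]] [c [y [Ac sy ->]]].
  exists (a + c), (x + y); split; [exact: sringD | exact: hD |].
  by rewrite mulrDl addrACA.
- move=> c _ Ac [a [x [Aa sx ->]]]; exists (c * a), (c * x).
  by split; [exact: sringM | exact: hM | rewrite mulrDr mulrA].
Qed.

Lemma mem_span s g : g \in s -> lspan A s g.
Proof.
elim: s => //= h s IH; have [s0 _ _] := span_modl s.
rewrite inE => /orP[/eqP ->|/IH sg].
  by exists 1, 0; split; [exact: sring1 | | rewrite mul1r addr0].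
by exists 0, g; split; [exact: sring0 | | rewrite mul0r add0r].
Qed.

Lemma span_min s M : modl A M -> (forall g, g \in s -> M g) -> lspan A s `<=` M.
Proof.
move=> [M0 MD MM]; elim: s => [|g s IH] hs /= x; first by move->.
move=> [a [y [Aa sy ->]]]; apply: MD.
  by apply: MM => //; apply: hs; rewrite inE eqxx.
by apply: IH => // h hin; apply: hs; rewrite inE hin orbT.
Qed.

(** Meant for [P c u] saying that [u] has leading coefficient [c]: lifts of generators of the module
    of leading coefficients are enough to realize every leading coefficient. *)
Lemma span_lift (P : B -> B -> Prop) s :
  P 0 0 -> (forall c u c' u', P c u -> P c' u' -> P (c + c') (u + u')) ->
  (forall a c u, A a -> P c u -> P (a * c) (a * u)) ->
  (forall c, c \in s -> exists u, P c u) ->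
  exists us, (forall u, u \in us -> exists c, P c u) /\
    forall c, lspan A s c -> exists2 u, lspan A us u & P c u.
Proof.
move=> P0 PD PM; elim: s => [|g s IH] hs.
  by exists [::]; split=> // c /= ->; exists 0.
have [us [usP sus]] : exists us, (forall u, u \in us -> exists c, P c u) /\
    forall c, lspan A s c -> exists2 u, lspan A us u & P c u.
  by apply: IH => c cs; apply: hs; rewrite inE cs orbT.
have [u Pgu] := hs g (mem_head _ _).
exists (u :: us); split.
  by move=> v; rewrite inE => /orP[/eqP ->|/usP //]; exists g.
move=> _ /= [a [y [Aa sy ->]]]; have [v sv Pyv] := sus _ sy.
by exists (a * u + v); [exists a, v | apply: PD => //; exact: PM].
Qed.

(* Induction on the number of generators: the coefficients along g of the elements
   of U form an ideal of A. *)
Lemma noeth_span s : noeth A A -> noeth A (lspan A s).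
Proof.
move=> nA; elim: s => [|g s IH] U hU Us.
  by exists [::]; split => //.
have [U0 UD UM] := hU; have [s0 sD sM] := span_modl s.
pose P c u := [/\ A c, U u & lspan A s (u - c * g)].
have P0 : P 0 0 by split; [exact: sring0| | rewrite mul0r subr0].
have PD c u c' u' : P c u -> P c' u' -> P (c + c') (u + u').
  move=> [Ac Uu su] [Ac' Uu' su']; split; [exact: sringD | exact: UD |].
  by rewrite mulrDl opprD addrACA; exact: sD.
have PM a c u : A a -> P c u -> P (a * c) (a * u).
  move=> Aa [Ac Uu su]; split; [exact: sringM | exact: UM |].
  by rewrite -mulrA -mulrBr; exact: sM.
have hC : modl A [set c | exists u, P c u].
  split; first by exists 0.
    by move=> x y [u Pu] [v Pv]; exists (u + v); exact: PD.
  by move=> a x Aa [u Pu]; exists (a * u); exact: PM.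
have [|cs [csC Ccs]] := nA _ hC; first by move=> x [u []].
have [us [usP sus]] := span_lift P0 PD PM csC.
have hV : modl A (U `&` lspan A s).
  split => // [x y [Ux sx] [Uy sy]|a x Aa [Ux sx]].
  + by split; [exact: UD | exact: sD].
  + by split; [exact: UM | exact: sM].
have [|s' [s'U Us']] := IH _ hV; first by move=> y [].
exists (us ++ s'); split.
  by move=> u; rewrite mem_cat => /orP[/usP[c []]//|/s'U[]].
move=> x Ux; have [a [y [Aa sy xE]]] := Us _ Ux.
have Pax : P a x by split => //; rewrite xE addrC addKr.
have [u su [_ Uu sua]] := sus a (Ccs _ (ex_intro _ x Pax)).
have [t0 tD tM] := span_modl (us ++ s').
(* The lift [u] has the same coefficient along [g] as [x], so [x - u] falls into the span of [s]. *)
rewrite -(subrK u x) addrC; apply: tD.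
  apply: span_min su; first exact: span_modl.
  by move=> g' g'us; apply: mem_span; rewrite mem_cat g'us.
have /Us' : (U `&` lspan A s) (x - u).
  split; first by apply: modlB.
  rewrite (_ : x - u = y - (u - a * g)); last by rewrite xE; ring.
  by apply: modlB => //; exact: span_modl.
apply: span_min; first exact: span_modl.
by move=> g' g's'; apply: mem_span; rewrite mem_cat g's' orbT.
Qed.

Lemma noeth_acc M (U : nat -> set B) : noeth A M ->
  (forall n, modl A (U n) /\ U n `<=` M) -> (forall n, U n `<=` U n.+1) ->
  exists N, forall n, U n `<=` U N.
Proof.
move=> nM hU Umon.
have mono m n : (m <= n)%N -> U m `<=` U n.
  move=> /subnK <-; elim: (n - m)%N => // k IH x /IH; rewrite addSn; exact: Umon.
have hV : modl A (\bigcup_n U n).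
  split; first by exists 0%N => //; have [[]] := hU 0%N.
    move=> x y [i _ Ux] [j _ Uy]; exists (maxn i j) => //.
    have [[_ UD _] _] := hU (maxn i j).
    by apply: UD; [exact: mono (leq_maxl i j) _ Ux | exact: mono (leq_maxr i j) _ Uy].
  by move=> a x Aa [i _ Ux]; exists i => //; have [[_ _ UM] _] := hU i; exact: UM.
have [|s [sV Vs]] := nM _ hV; first by move=> x [n _]; exact: (hU n).2.
suff [N hN] : exists N, forall g, g \in s -> U N g.
  exists N => n x Ux; apply: (span_min (hU N).1 hN); apply: Vs.
  by exists n.
elim: s sV {Vs} => [|g s IH] sV; first by exists 0%N.
have [g' gs|N hN] := IH; first by apply: sV; rewrite inE gs orbT.
have [i _ Ug] := sV g (mem_head _ _).
exists (maxn i N) => h; rewrite inE => /orP[/eqP ->|/hN].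
  exact: mono (leq_maxl i N) _ Ug.
exact: mono (leq_maxr i N) _.
Qed.

End Subring.

(** Values at [b] of polynomials of degree below [k] with coefficients in [M]. As [b] may be
    algebraic over the coefficients, such an expression is not unique and a leading coefficient is
    only a relation. *)
Fixpoint low b M k : set B :=
  if k is k'.+1 then [set x | exists y c, [/\ low b M k' y, M c & x = y + c * b ^+ k']]
  else [set 0].

Definition adj b M : set B := \bigcup_k low b M k.

Section Adjunction.
Variables (A M : set B) (b : B).
Hypothesis hM : modl A M.

Lemma low_modl k : modl A (low b M k).
Proof.
have [M0 MD MM] := hM.
elim: k => [|k [h0 hD hm]] /=.
  by split=> // [x y -> ->|a x _ ->]; rewrite ?addr0 ?mulr0.
split.
- by exists 0, 0; split => //; rewrite mul0r addr0.
- move=> _ _ [x [c [lx Mc ->]]] [y [d [ly Md ->]]].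
  exists (x + y), (c + d); split; [exact: hD | exact: MD |].
  by rewrite mulrDl addrACA.
- move=> a _ Aa [x [c [lx Mc ->]]]; exists (a * x), (a * c).
  by split; [exact: hm | exact: MM | rewrite mulrDr mulrA].
Qed.

Lemma low_S k : low b M k `<=` low b M k.+1.
Proof.
by move=> x lx; exists x, 0; split => //; [case: hM | rewrite mul0r addr0].
Qed.

Lemma low_mono j k : (j <= k)%N -> low b M j `<=` low b M k.
Proof.
by move=> /subnK <-; elim: (k - j)%N => // i IH x /IH; rewrite addSn; exact: low_S.
Qed.

Lemma lowMb k x : low b M k x -> low b M k.+1 (b * x).
Proof.
elim: k x => [|k IH] x; first by move=> x0; apply: low_S; rewrite (_ : x = 0) // mulr0.
move=> [y [c [ly Mc ->]]]; exists (b * y), c; split => //; first exact: IH.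
by rewrite exprS; ring.
Qed.

Lemma lowMbn i k x : low b M k x -> low b M (i + k) (b ^+ i * x).
Proof.
elim: i => [|i IH] lx; first by rewrite mul1r.
by rewrite exprS -mulrA addSn; apply: lowMb; exact: IH.
Qed.

Lemma adj_sub : M `<=` adj b M.
Proof. by move=> x Mx; exists 1%N => //=; exists 0, x; split => //; rewrite add0r mulr1. Qed.

Lemma adjD x y : adj b M x -> adj b M y -> adj b M (x + y).
Proof.
move=> [i _ lx] [j _ ly]; exists (maxn i j) => //.
have [_ hD _] := low_modl (maxn i j).
by apply: hD; [exact: low_mono (leq_maxl i j) _ lx | exact: low_mono (leq_maxr i j) _ ly].
Qed.

Lemma adjMb x : adj b M x -> adj b M (b * x).
Proof. by move=> [k _ lx]; exists k.+1 => //; exact: lowMb. Qed.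

Lemma adjM a x : adj b A a -> adj b M x -> adj b M (a * x).
Proof.
move=> [k _ la] hx; elim: k a la => [|k IH] a.
  by move=> /= ->; rewrite mul0r; apply: adj_sub; case: hM.
move=> [y [c [ly Ac ->]]]; rewrite mulrDl; apply: adjD; first exact: IH.
rewrite -mulrA; have {hx} : adj b M (b ^+ k * x).
  elim: k {IH ly} => [|k IHk]; first by rewrite mul1r.
  by rewrite exprS -mulrA; exact: adjMb IHk.
move=> [j _ lj]; exists j => //; have [_ _ hm] := low_modl j; exact: hm.
Qed.

End Adjunction.

Lemma adj_gen A b : sring A -> adj b A b.
Proof.
move=> hA; have h1 : adj b A 1 by apply: adj_sub; case: hA.
by have := adjMb (sring_modl hA) h1; rewrite mulr1.
Qed.

Lemma adj_sring A b : sring A -> sring (adj b A).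
Proof.
move=> hA; have hm := sring_modl hA.
have h1 : adj b A 1 by apply: adj_sub; exact: sring1.
split => // [x y hx hy|]; last exact: (adjM hm).
apply: (adjD hm) => //; rewrite -mulN1r; apply: (adjM hm) => //.
by apply: adj_sub; apply: sringN => //; exact: sring1.
Qed.

(** The modules of leading coefficients in degree k increase with k, because multiplication by [b]
    raises the degree, and become stationary at some [K]. Lifts of generators of those up to [K]
    then suffice: in higher degree the leading term is cancelled by a power of [b] times an element
    of degree [K]. *)
Lemma noeth_adj A M b : sring A -> modl A M -> noeth A M ->
  noeth (adj b A) (adj b M).
Proof.
move=> hA hM nM U hU Us; have hA' := adj_sring b hA.
have AA' : A `<=` adj b A by exact: adj_sub.
have [U0 UD UM] := hU; have [M0 MD MM] := hM.
pose P k c u := [/\ M c, U u & low b M k (u - c * b ^+ k)].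
pose L k := [set c | exists u, P k c u].
have P0 k : P k 0 0.
  by split => //; rewrite mul0r subr0; have [] := low_modl b hM k.
have PD k c u c' u' : P k c u -> P k c' u' -> P k (c + c') (u + u').
  move=> [Mc Uu lu] [Mc' Uu' lu']; split; [exact: MD | exact: UD |].
  by rewrite mulrDl opprD addrACA; have [_ hD _] := low_modl b hM k; exact: hD.
have PM k a c u : A a -> P k c u -> P k (a * c) (a * u).
  move=> Aa [Mc Uu lu]; split; [exact: MM | apply: UM => //; exact: AA' |].
  by rewrite -mulrA -mulrBr; have [_ _ hm] := low_modl b hM k; exact: hm.
have PS i k c u : P k c u -> P (i + k)%N c (b ^+ i * u).
  move=> [Mc Uu lu]; split => //.
    elim: i => [|i IH]; first by rewrite mul1r.
    rewrite exprS -mulrA; apply: UM => //; exact: adj_gen.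
  rewrite exprD (_ : _ - _ = b ^+ i * (u - c * b ^+ k)); last by ring.
  exact: (lowMbn hM).
have LM k : modl A (L k) /\ L k `<=` M.
  split; last by move=> c [u []].
  split; first by exists 0.
    by move=> x y [u Pu] [v Pv]; exists (u + v); exact: PD.
  by move=> a x Aa [u Pu]; exists (a * u); exact: PM.
have LS k : L k `<=` L k.+1.
  by move=> c [u Pu]; exists (b ^+ 1 * u); exact: (PS 1%N).
have [K hK] := noeth_acc nM LM LS.
have gen k : exists s, (forall g, g \in s -> U g) /\
    forall j u, (j <= k)%N -> U u -> low b M j u -> lspan (adj b A) s u.
  elim: k => [|k [s [sU hs]]].
    exists [::]; split => // j u; rewrite leqn0 => /eqP -> _; exact.
  have [cs [csL Lcs]] := nM _ (LM k).1 (LM k).2.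
  have [us [usP sus]] := span_lift (P0 k) (@PD k) (@PM k) csL.
  exists (us ++ s); split.
    by move=> u; rewrite mem_cat => /orP[/usP[c []]//|/sU].
  have [t0 tD tM] := span_modl hA' (us ++ s).
  have sss : lspan (adj b A) s `<=` lspan (adj b A) (us ++ s).
    apply: span_min; first exact: span_modl.
    by move=> g gs; apply: mem_span => //; rewrite mem_cat gs orbT.
  move=> j u; rewrite leq_eqVlt => /orP[/eqP ->|]; last first.
    by rewrite ltnS => jk Uu lu; apply: sss; exact: hs lu.
  move=> Uu [y [c [ly Mc uE]]].
  have Pcu : P k c u by split => //; rewrite uE addrK.
  have [v sv [_ Uv lv]] := sus c (Lcs _ (ex_intro _ u Pcu)).
  rewrite -(subrK v u) addrC; apply: (tD).
    suff /(_ _ sv) : lspan A us `<=` lspan (adj b A) (us ++ s) by [].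
    apply: span_min; first by split => [//|//|a x Aa sx]; apply: tM => //; exact: AA'.
    by move=> g gs; apply: mem_span => //; rewrite mem_cat gs.
  apply: sss; apply: (hs k) => //; first exact: (modlB hA').
  rewrite (_ : u - v = y - (v - c * b ^+ k)); last by rewrite uE; ring.
  apply: (modlB hA) => //; exact: low_modl.
have [s [sU hs]] := gen K.+1.
exists s; split => // u Uu; have [k _ lu] := Us _ Uu.
have [t0 tD tM] := span_modl hA' s.
elim: k u Uu lu => [|k IH] u Uu lu; first exact: hs lu.
have [kK|Kk] := leqP k.+1 K.+1; first exact: hs lu.
have [y [c [ly Mc uE]]] := lu.
have Pcu : P k c u by split => //; rewrite uE addrK.
have [v Pv] := hK k c (ex_intro _ u Pcu).
have [_ Uv lv] := Pv.
have /(PS (k - K)%N) [_ Uw lw] := Pv.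
rewrite subnK in lw; last by rewrite -ltnS ltnW.
have sv : lspan (adj b A) s v.
  apply: (hs K.+1) => //; exists (v - c * b ^+ K), c; split => //.
  by rewrite subrK.
rewrite -(subrK (b ^+ (k - K) * v) u); apply: tD.
  apply: IH; first exact: (modlB hA').
  rewrite (_ : u - _ = y - (b ^+ (k - K) * v - c * b ^+ k)); last by rewrite uE; ring.
  by apply: (modlB hA) => //; exact: low_modl.
apply: tM => //; elim: (k - K)%N => [|i IHi]; first exact: sring1.
by rewrite exprS; apply: sringM => //; exact: adj_gen.
Qed.

Definition adjs A s : set B := foldr adj A s.

Lemma adjs_sring A s : sring A -> sring (adjs A s).
Proof. by move=> hA; elim: s => //= b s IH; exact: adj_sring. Qed.

Lemma adjs_sub A s : A `<=` adjs A s.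
Proof. by elim: s => //= b s IH; apply: subset_trans IH _; exact: adj_sub. Qed.

Lemma adjs_gen A s b : sring A -> b \in s -> adjs A s b.
Proof.
move=> hA; elim: s => //= c s IH; rewrite inE => /orP[/eqP ->|/IH].
  by apply: adj_gen; exact: adjs_sring.
exact: adj_sub.
Qed.

Lemma adj_min A C b : sring C -> C b -> A `<=` C -> adj b A `<=` C.
Proof.
move=> hC Cb AC x [k _]; elim: k x => [|k IH] x /=.
  by move=> ->; exact: sring0.
move=> [y [c [/IH Cy /AC Cc ->]]]; apply: sringD => //; apply: sringM => //.
elim: k {IH} => [|k IH]; first exact: sring1.
by rewrite exprS; exact: sringM.
Qed.

Lemma adjs_min A C s : sring C -> (forall b, b \in s -> C b) -> A `<=` C ->
  adjs A s `<=` C.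
Proof.
move=> hC hs AC; elim: s hs => //= b s IH hs; apply: adj_min => //.
  by apply: hs; rewrite inE eqxx.
by apply: IH => c cs; apply: hs; rewrite inE cs orbT.
Qed.

Lemma noeth_adjs A s : sring A -> noeth A A -> noeth (adjs A s) (adjs A s).
Proof.
move=> hA nA; elim: s => //= b s IH; have hA' := adjs_sring s hA.
by apply: noeth_adj => //; exact: sring_modl.
Qed.

End Modules.

(** * Ideals and J-stable families *)

Section IdealTheory.
Variable R : comNzRingType.
Implicit Types (S I J : set R) (x y : R) (n : nat) (U V F : nat -> set R).

Lemma idealW I : I 0 -> (forall x y, I x -> I y -> I (x + y)) ->
  (forall a x, I x -> I (a * x)) -> ideal I.
Proof. by move=> h0 hD hM; split => // a x _; exact: hM. Qed.

Lemma ideal0 I : ideal I -> I 0. Proof. by case. Qed.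

Lemma idealD I x y : ideal I -> I x -> I y -> I (x + y).
Proof. by move=> [_ _ hD _]; exact: hD. Qed.

Lemma idealMl I a x : ideal I -> I x -> I (a * x).
Proof. by move=> [_ _ _ hM]; exact: hM. Qed.

Lemma idealMr I a x : ideal I -> I x -> I (x * a).
Proof. by rewrite mulrC; exact: idealMl. Qed.

Lemma idealN I x : ideal I -> I x -> I (- x).
Proof. by move=> hI Ix; rewrite -mulN1r; exact: idealMl. Qed.

Lemma idealB I x y : ideal I -> I x -> I y -> I (x - y).
Proof. by move=> hI Ix Iy; apply: idealD => //; exact: idealN. Qed.

Lemma ideal_sum I (T : Type) (r : seq T) (P : pred T) (f : T -> R) : ideal I ->
  (forall i, P i -> I (f i)) -> I (\sum_(i <- r | P i) f i).
Proof.
move=> hI hf; elim/big_ind : _ => //; first exact: ideal0.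
by move=> x y; exact: idealD.
Qed.

Lemma ideal_eqT I : ideal I -> I 1 -> I = setT.
Proof.
by move=> hI I1; apply/seteqP; split => // x _; rewrite -[x]mulr1; exact: idealMl.
Qed.

Lemma ideal_eq0 I : ideal I -> I <> [set 0] -> exists2 x, I x & x <> 0.
Proof.
move=> hI; apply: contra_notP => h; apply/seteqP; split => x /=.
  by move=> Ix; apply: contrapT => x0; apply: h; exists x.
by move=> ->; exact: ideal0.
Qed.

Lemma ideal_zero : ideal [set (0 : R)].
Proof. by apply: idealW => // [x y -> ->|a x ->]; rewrite ?addr0 ?mulr0. Qed.

Lemma idealI I J : ideal I -> ideal J -> ideal (I `&` J).
Proof.
move=> hI hJ; apply: idealW => [|x y [? ?] [? ?]|a x [? ?]].
- by split; exact: ideal0.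
- by split; exact: idealD.
- by split; exact: idealMl.
Qed.

Lemma ideal_modl I : ideal I -> modl setT I.
Proof. by move=> [_ h0 hD hM]. Qed.

Lemma modl_ideal I : modl setT I -> ideal I.
Proof. by move=> [h0 hD hM]. Qed.

Lemma ideal_genP S : ideal (ideal_gen S).
Proof.
apply: idealW => [A [hA _]|x y hx hy A hA|a x hx A hA].
- exact: ideal0.
- by apply: idealD; [exact: hA.1 | exact: hx | exact: hy].
- by apply: idealMl; [exact: hA.1 | exact: hx].
Qed.

Lemma gen_sub S : S `<=` ideal_gen S.
Proof. by move=> x Sx A [_ SA]; exact: SA. Qed.

Lemma gen_min S I : ideal I -> S `<=` I -> ideal_gen S `<=` I.
Proof. by move=> hI SI x hx; exact: hx. Qed.

Lemma gen_mono S S' : S `<=` S' -> ideal_gen S `<=` ideal_gen S'.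
Proof.
by move=> SS; apply: gen_min; [exact: ideal_genP | apply: subset_trans SS _; exact: gen_sub].
Qed.

Lemma sringT : sring [set: R]. Proof. by []. Qed.

Lemma gen_span (s : seq R) : ideal_gen [set` s] = lspan setT s.
Proof.
apply/seteqP; split.
  apply: gen_min; first by apply: modl_ideal; exact: span_modl sringT s.
  by move=> x; exact: (mem_span sringT).
apply: span_min; first by apply: ideal_modl; exact: ideal_genP.
by move=> g gs; exact: gen_sub.
Qed.

Lemma colon_ideal I S : ideal I -> ideal (colon I S).
Proof.
move=> hI; apply: idealW => [x _|x y hx hy z Sz|a x hx z Sz].
- by rewrite mul0r; exact: ideal0.
- by rewrite mulrDl; apply: idealD => //; [exact: hx | exact: hy].
- by rewrite -mulrA; apply: idealMl => //; exact: hx.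
Qed.

Lemma colon_elt_ideal I x : ideal I -> ideal (colon_elt I x).
Proof.
move=> hI; apply: idealW; rewrite /colon_elt /=.
- by rewrite mul0r; exact: ideal0.
- by move=> y z hy hz; rewrite mulrDl; exact: idealD.
- by move=> a y hy; rewrite -mulrA; exact: idealMl.
Qed.

Lemma mul_ideal I J : ideal (ideal_mul I J). Proof. exact: ideal_genP. Qed.

Lemma mem_mul I J x y : I x -> J y -> ideal_mul I J (x * y).
Proof. by move=> Ix Jy; apply: gen_sub; exists x => //; exists y. Qed.

Lemma mul_min I J (K : set R) : ideal K -> (forall x y, I x -> J y -> K (x * y)) ->
  ideal_mul I J `<=` K.
Proof. by move=> hK h; apply: gen_min => // _ [x Ix [y Jy <-]]; exact: h. Qed.

Lemma mul_mono I I' J J' : I `<=` I' -> J `<=` J' -> ideal_mul I J `<=` ideal_mul I' J'.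
Proof.
move=> II JJ; apply: mul_min; first exact: mul_ideal.
by move=> x y /II Ix /JJ Jy; exact: mem_mul.
Qed.

Lemma mul_gen_min S I J : ideal J -> (forall x y, S x -> I y -> J (x * y)) ->
  ideal_mul (ideal_gen S) I `<=` J.
Proof.
move=> hJ h; apply: mul_min => // x y Sx Iy.
have hC : ideal (colon J [set y]) by exact: colon_ideal.
suff : colon J [set y] x by apply.
move: x Sx; apply: gen_min => // x Sx _ ->; exact: h.
Qed.

Lemma mul_subr I J : ideal J -> ideal_mul I J `<=` J.
Proof. by move=> hJ; apply: mul_min => // x y _; exact: idealMl. Qed.

Lemma pow_ideal I n : ideal (ideal_pow I n).
Proof. by case: n => //= n; exact: mul_ideal. Qed.

Lemma powS_sub I n : ideal_pow I n.+1 `<=` ideal_pow I n.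
Proof. by apply: mul_subr; exact: pow_ideal. Qed.

Lemma pow_anti I m n : (m <= n)%N -> ideal_pow I n `<=` ideal_pow I m.
Proof.
by move=> /subnK <-; elim: (n - m)%N => // k IH x; rewrite addSn => /powS_sub; exact: IH.
Qed.

Lemma mem_powD I m n x y : ideal_pow I m x -> ideal_pow I n y ->
  ideal_pow I (m + n) (x * y).
Proof.
move=> hx hy; elim: m x hx => [|m IH] x.
  by move=> _; apply: idealMl => //; exact: pow_ideal.
move=> hx; have hK : ideal (colon (ideal_pow I (m.+1 + n)) [set y]).
  by apply: colon_ideal; exact: pow_ideal.
suff : colon (ideal_pow I (m.+1 + n)) [set y] x by apply.
move: x hx; apply: mul_min => // x z Ix hz _ ->; rewrite -mulrA.
by apply: mem_mul => //; exact: IH.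
Qed.

Lemma pow1 I : ideal I -> ideal_pow I 1 = I.
Proof.
move=> hI; apply/seteqP; split => x.
  by move: x; apply: mul_min => // x y Ix _; exact: idealMr.
by move=> Ix; rewrite -[x]mulr1; apply: mem_mul.
Qed.

Lemma mem_pow1 I x : I x -> ideal_pow I 1 x.
Proof. by move=> Ix; rewrite -[x]mulr1; apply: mem_mul. Qed.

Lemma mem_pow_exp I n x : I x -> ideal_pow I n (x ^+ n).
Proof. by move=> Ix; elim: n => // n IH; rewrite exprS; exact: mem_mul. Qed.

Lemma pow_mul I m n : ideal_mul (ideal_pow I m) (ideal_pow I n) = ideal_pow I (m + n).
Proof.
apply/seteqP; split.
  by apply: mul_min; [exact: pow_ideal | exact: mem_powD].
elim: m => [|m IH] x.
  by move=> hx; rewrite -[x]mul1r; exact: mem_mul.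
move: x; apply: mul_min; first exact: mul_ideal.
move=> x y Ix /IH hy.
have hC : ideal (colon (ideal_mul (ideal_pow I m.+1) (ideal_pow I n)) [set x]).
  by apply: colon_ideal; exact: mul_ideal.
rewrite mulrC; suff : colon (ideal_mul (ideal_pow I m.+1) (ideal_pow I n)) [set x] y by apply.
move: y hy; apply: mul_min => // y z hy hz _ ->.
by rewrite mulrC mulrA; apply: mem_mul => //; exact: mem_mul.
Qed.

Lemma pow_pow I m n : ideal_pow (ideal_pow I m) n = ideal_pow I (m * n).
Proof.
elim: n => [|n IH]; first by rewrite muln0.
rewrite mulnS -pow_mul -IH; reflexivity.
Qed.

(** For ideals [U n], this makes the sum of the [U n] t^n a module over the Rees algebra of [J]. *)
Definition compat J U : Prop := forall n x y, J x -> U n y -> U n.+1 (x * y).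

Lemma compat_pow J U i n x y : (forall n, ideal (U n)) -> compat J U ->
  ideal_pow J i x -> U n y -> U (i + n)%N (x * y).
Proof.
move=> hU hJ hx Uy; elim: i x hx => [|i IH] x; first by move=> _; exact: idealMl.
move=> hx; have hK : ideal (colon (U (i.+1 + n)%N) [set y]) by exact: colon_ideal.
suff : colon (U (i.+1 + n)%N) [set y] x by apply.
move: x hx; apply: mul_min => // x z Jx hz _ ->; rewrite -mulrA addSn.
by apply: hJ => //; exact: IH.
Qed.

Lemma compat_powS J U i n x y : (forall n, ideal (U n)) -> compat J U ->
  ideal_pow J i.+1 x -> U n y -> ideal_mul J (U (i + n)%N) (x * y).
Proof.
move=> hU hJ hx Uy.
have hC : ideal (colon (ideal_mul J (U (i + n)%N)) [set y]).
  by apply: colon_ideal; exact: mul_ideal.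
suff : colon (ideal_mul J (U (i + n)%N)) [set y] x by apply.
move: x hx; apply: mul_min => // x z Jx hz _ ->; rewrite -mulrA.
by apply: mem_mul => //; exact: (compat_pow hU hJ hz).
Qed.

(** Over a noetherian ring this is finite generation over the Rees algebra of [J], in the form used
    later: from index [K] on, no new generators appear. *)
Definition stable J U : Prop :=
  compat J U /\ exists K, forall n, (K <= n)%N -> U n.+1 `<=` ideal_mul J (U n).

Lemma pow_stable J : stable J (ideal_pow J).
Proof.
split; last by exists 0%N => n _.
by move=> n x y Jx hy; exact: mem_mul.
Qed.

Lemma modl_rees J U : (forall n, ideal (U n)) -> compat J U ->
  modl (rees (ideal_pow J)) (rees U).
Proof.
move=> hU hJ; split.
- by move=> n; rewrite coef0; exact: ideal0.
- by move=> q r hq hr n; rewrite coefD; exact: idealD.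
- move=> c q hc hq n; rewrite coefM; apply: ideal_sum => // i _.
  have /subnKC {1}<- : (i <= n)%N by rewrite -ltnS.
  exact: (compat_pow hU hJ (hc i) (hq _)).
Qed.

Lemma sring_rees J : sring (rees (ideal_pow J)).
Proof.
have [h0 hD hM] := modl_rees (pow_ideal J) (pow_stable J).1.
split => // [n|x y hx hy].
  by rewrite coefC; case: eqP => [->|_] //; exact: (ideal0 (pow_ideal _ _)).
by move=> n; rewrite coefB; apply: idealB; [exact: pow_ideal | exact: hx | exact: hy].
Qed.

(* The degree bound on the generators of the Rees module bounds the indices at
   which new generators are needed. *)
Lemma rees_fg_stable J U (s : seq {poly R}) : (forall n, ideal (U n)) -> compat J U ->
  (forall g, g \in s -> rees U g) ->
  (forall M, modl (rees (ideal_pow J)) M -> (forall g, g \in s -> M g) -> rees U `<=` M) ->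
  exists K, forall n, (K <= n)%N -> U n.+1 `<=` ideal_mul J (U n).
Proof.
move=> hU hJ sU hs; have [h0 hD hM] := modl_rees hU hJ.
have [K hK] : exists K, forall g, g \in s -> (size g <= K)%N.
  exists (\max_(g <- s) size g) => g gs.
  by rewrite (big_rem g) //= leq_maxl.
pose M := [set q | rees U q /\ forall n, (K <= n)%N -> ideal_mul J (U n) q`_n.+1].
have UM : rees U `<=` M.
  apply: hs; first split.
  - by split => // k _; rewrite coef0; exact: (ideal0 (mul_ideal _ _)).
  - move=> p q [Up hp] [Uq hq]; split; first exact: hD.
    by move=> k Kk; rewrite coefD; apply: (idealD (mul_ideal _ _)); [exact: hp | exact: hq].
  - move=> c q hc [Uq hq]; split; first exact: hM.
    move=> k Kk; rewrite coefM; apply: (ideal_sum _ (mul_ideal _ _)).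
    case; case=> [|i] /= ik _.
      by rewrite subn0; apply: (idealMl _ (mul_ideal _ _)); exact: hq.
    rewrite subSS; have {1}-> : k = (i + (k - i))%N by rewrite subnKC.
    exact: (compat_powS hU hJ (hc _) (Uq _)).
  - move=> g gs; split; first exact: sU.
    move=> k Kk; rewrite nth_default; first exact: (ideal0 (mul_ideal _ _)).
    by apply: leq_trans (hK g gs) _; exact: leqW.
exists K => n Kn x Ux; have /UM[_ /(_ n Kn)] : rees U (x%:P * 'X^(n.+1)).
  move=> k; rewrite coefMXn; case: ltnP => kn; first exact: ideal0.
  rewrite coefC subn_eq0; case: leqP => kn'; last exact: ideal0.
  by have -> : k = n.+1 by apply/eqP; rewrite eqn_leq kn kn'.
by rewrite coefMXn ltnn subnn coefC.
Qed.

Lemma rees_mon U n x : (forall n, ideal (U n)) -> U n x -> rees U (x%:P * 'X^n).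
Proof.
move=> hU Ux k; rewrite coefMXn; case: ltnP => kn; first exact: ideal0.
rewrite coefC subn_eq0; case: leqP => kn'; last exact: ideal0.
by have -> : k = n by apply/eqP; rewrite eqn_leq kn kn'.
Qed.

(** Noetherianity gives generators anywhere in the ideal; each of them involves finitely many
    elements of [S], and these replace it. This is how homogeneous generators, or generators of one
    prescribed degree, are chosen. *)
Lemma fin_gen S : noetherian_ring R ->
  exists s : seq R, (forall g, g \in s -> S g) /\ ideal_gen S = ideal_gen [set` s].
Proof.
move=> hR; have [s sE] := hR _ (ideal_genP S).
have cov x : ideal_gen S x ->
    exists s : seq R, (forall g, g \in s -> S g) /\ ideal_gen [set` s] x.
  move: x; apply: (@gen_min _ [set x | exists s : seq R,
    (forall g, g \in s -> S g) /\ ideal_gen [set` s] x]).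
    apply: idealW => /=.
    - by exists [::]; split=> //; apply: ideal0; exact: ideal_genP.
    - move=> x y [s1 [h1 x1]] [s2 [h2 y2]]; exists (s1 ++ s2); split.
        by move=> g; rewrite mem_cat => /orP[/h1|/h2].
      apply: (idealD (ideal_genP _)).
        by apply: gen_mono x1 => g /= gs; rewrite mem_cat gs.
      by apply: gen_mono y2 => g /= gs; rewrite mem_cat gs orbT.
    - move=> a x [s1 [h1 x1]]; exists s1; split => //.
      exact: (idealMl _ (ideal_genP _)).
  move=> x Sx; exists [:: x]; split; first by move=> g; rewrite inE => /eqP ->.
  by apply: gen_sub => /=; rewrite inE.
have : forall g, g \in s -> ideal_gen S g by move=> g gs; rewrite sE; exact: gen_sub.
suff [s' [h' hs']] : exists s' : seq R, (forall g, g \in s' -> S g) /\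
    forall g, g \in s -> ideal_gen S g -> ideal_gen [set` s'] g.
  move=> sS; exists s'; split => //; apply/seteqP; split; last first.
    by apply: gen_min; [exact: ideal_genP | move=> g /h'; exact: gen_sub].
  rewrite {1}sE; apply: gen_min; first exact: ideal_genP.
  by move=> g gs; apply: hs' => //; exact: sS.
elim: s {sE} => [|g s [s' [h' hs']]]; first by exists [::].
have [gS|gS] := pselect (ideal_gen S g); last first.
  exists s'; split => // h; rewrite inE => /orP[/eqP ->|] //; exact: hs'.
have [s1 [h1 g1]] := cov g gS; exists (s1 ++ s'); split.
  by move=> h; rewrite mem_cat => /orP[/h1|/h'].
move=> h; rewrite inE => /orP[/eqP -> _|hs /(hs' _ hs)].
  by apply: gen_mono g1 => x /= xs; rewrite mem_cat xs.
by apply: gen_mono => x /= xs; rewrite mem_cat xs orbT.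
Qed.

Lemma ideal_noeth : noetherian_ring R -> noeth [set: R] [set: R].
Proof.
move=> hR U hU _; have [s sE] := hR U (modl_ideal hU).
exists s; split; last by rewrite -gen_span -sE.
by move=> g gs; rewrite sE; exact: gen_sub.
Qed.

Lemma noeth_noetherian : noeth [set: R] [set: R] -> noetherian_ring R.
Proof.
move=> nR I hI; have [//|s [sI Is]] := nR I (ideal_modl hI).
exists s; apply/seteqP; split; first by rewrite gen_span.
by apply: gen_min => // g /= /sI.
Qed.

(** * Chain conditions for families over a Rees algebra *)

Section Noetherian.
Hypothesis hR : noetherian_ring R.

Lemma ideal_acc (I : nat -> set R) : (forall n, ideal (I n)) ->
  (forall n, I n `<=` I n.+1) -> exists N, forall n, I n `<=` I N.
Proof.
move=> hI; apply: noeth_acc (ideal_noeth hR) _ => n.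
by split; [exact: ideal_modl | ].
Qed.

Lemma noeth_const : noeth (range (@polyC R)) (range (@polyC R)).
Proof.
move=> U hU Us; have [U0 UD UM] := hU.
have hI : ideal [set c | U c%:P].
  apply: idealW => /= [//|x y|a x].
    by rewrite polyCD; exact: UD.
  by rewrite polyCM; apply: UM; exists a.
have [s sE] := hR hI; exists (map polyC s); split.
  by move=> _ /mapP[g gs ->]; have : [set c | U c%:P] g by rewrite sE; exact: gen_sub.
move=> x Ux; have [c _ cx] := Us x Ux; subst x.
have : ideal_gen [set` s] c by rewrite -sE.
rewrite gen_span; elim: s {sE} c {Ux} => [|g s IH] c /=; first by move->.
move=> [a [y [_ /IH sy ->]]]; exists a%:P, y%:P.
by split => //; [exists a | rewrite polyCD polyCM].
Qed.

Lemma const_sring : sring (range (@polyC R)).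
Proof.
split; first by exists 1.
  by move=> _ _ [a _ <-] [b _ <-]; exists (a - b) => //; rewrite polyCB.
by move=> _ _ [a _ <-] [b _ <-]; exists (a * b) => //; rewrite polyCM.
Qed.

(** This is the Artin-Rees property: the components of [F] lie in one finitely generated module over
    a noetherian algebra, so the submodule given by [U] is finitely generated, and the degrees in t
    of its generators bound the index from which [U] is stable. *)
Lemma stable_sub J F U : (forall n, ideal (F n)) -> stable J F ->
  (forall n, ideal (U n)) -> compat J U -> (forall n, U n `<=` F n) -> ideal J ->
  stable J U.
Proof.
move=> hF [cF [K hK]] hU cU UF hJ; split => //.
have [bs bsE] := hR hJ.
have bsJ b : b \in bs -> J b by move=> bs_b; rewrite bsE; exact: gen_sub.
(* The algebra generated over the constants by the b t, with b running through generators of [J]. It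
   is noetherian by Hilbert's theorem and contained in the Rees algebra, so a module over the latter
   is one over [A]. *)
pose A := adjs (range (@polyC R)) [seq b%:P * 'X | b <- bs].
have hA : sring A by apply: adjs_sring; exact: const_sring.
have nA : noeth A A by apply: noeth_adjs; [exact: const_sring | exact: noeth_const].
have AJ : A `<=` rees (ideal_pow J).
  apply: adjs_min; first exact: sring_rees.
    move=> _ /mapP[b /bsJ Jb ->]; rewrite -['X]expr1.
    by apply: rees_mon; [exact: pow_ideal | exact: mem_pow1].
  move=> _ [c _ <-]; rewrite -[c%:P]mulr1 -(expr0 'X).
  by apply: rees_mon; [exact: pow_ideal |].
have Ac c : A c%:P by apply: adjs_sub; exists c.
have Ab b : b \in bs -> A (b%:P * 'X).
  move=> bs_b; apply: adjs_gen; first exact: const_sring.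
  by apply/mapP; exists b.
have [s sF] : exists s, forall n x, F n x -> lspan A s (x%:P * 'X^n).
  have spanX t n (gs : seq R) : (forall g, g \in gs -> lspan A t (g%:P * 'X^n)) ->
      forall x, ideal_gen [set` gs] x -> lspan A t (x%:P * 'X^n).
    move=> hgs x; have [h0 hD hM] := span_modl hA t.
    move: x; apply: (@gen_min _ [set x | lspan A t (x%:P * 'X^n)]) => //.
    apply: idealW => /= [|x y hx hy|a x hx]; first by rewrite mul0r.
      by rewrite polyCD mulrDl; exact: hD.
    by rewrite polyCM -mulrA; exact: hM.
  (* Up to index [K] each component brings its own generators; beyond [K] the elements b t produce
     everything from the previous component. *)
  have [s hs] : exists s, forall n x, (n <= K)%N -> F n x -> lspan A s (x%:P * 'X^n).
    elim: K {hK} => [|k [s IH]].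
      have [gs gsE] := hR (hF 0%N).
      exists [seq g%:P * 'X^0 | g <- gs] => n x; rewrite leqn0 => /eqP ->.
      rewrite gsE; apply: spanX => g hg; apply: mem_span => //.
      exact: (map_f (fun g : R => g%:P * 'X^0)).
    have [gs gsE] := hR (hF k.+1).
    exists (s ++ [seq g%:P * 'X^(k.+1) | g <- gs]) => n x.
    rewrite leq_eqVlt => /orP[/eqP ->|]; last first.
      rewrite ltnS => nk /(IH _ _ nk); apply: span_min; first exact: span_modl.
      by move=> g hg; apply: mem_span => //; rewrite mem_cat hg.
    rewrite gsE; apply: spanX => g hg; apply: mem_span => //.
    by rewrite mem_cat (map_f (fun g : R => g%:P * 'X^(k.+1))) ?orbT.
  exists s; elim=> [|n IH] x; first exact: hs.
  have [nK|Kn] := leqP n.+1 K; first exact: hs.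
  move=> /(hK n Kn); have [h0 hD hM] := span_modl hA s.
  rewrite bsE; move: x; apply: (@mul_gen_min _ _ [set x | lspan A s (x%:P * 'X^(n.+1))]).
    apply: idealW => /= [|x y hx hy|a x hx]; first by rewrite mul0r.
      by rewrite polyCD mulrDl; exact: hD.
    by rewrite polyCM -mulrA; exact: hM.
  move=> x y /= xs /IH hy.
  rewrite polyCM exprS (_ : _ * _ = x%:P * 'X * (y%:P * 'X^n)); last by ring.
  by apply: hM => //; exact: Ab.
have [||gs [gsU Ugs]] := noeth_span hA (s := s) nA (U := rees U).
- have [h0 hD hM] := modl_rees hU cU.
  by split => // a x Aa; apply: hM; exact: AJ.
- move=> q hq; rewrite -[q]coefK poly_def.
  have [h0 hD hM] := span_modl hA s.
  apply: big_ind => //= i _; rewrite -mul_polyC; apply: sF; apply: UF; exact: hq.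
apply: (rees_fg_stable hU cU gsU) => M [M0 MD MM] gsM q /Ugs.
by apply: span_min => //; split => // a x /AJ; exact: MM.
Qed.

(** The union of the chain is again a stable family, with some bound [K]. Once the chain is
    stationary in the finitely many indices up to [K], stability of the union propagates this to all
    indices. *)
Lemma stable_acc J F (U : nat -> nat -> set R) : (forall n, ideal (F n)) ->
  stable J F -> ideal J ->
  (forall i, [/\ forall n, ideal (U i n), compat J (U i) & forall n, U i n `<=` F n]) ->
  (forall i n, U i n `<=` U i.+1 n) ->
  exists N, forall i n, U i n `<=` U N n.
Proof.
move=> hF sF hJ hU Umon.
have mono n i j : (i <= j)%N -> U i n `<=` U j n.
  by move=> /subnK <-; elim: (j - i)%N => // k IH x /IH; rewrite addSn; exact: Umon.
pose V n := \bigcup_i U i n.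
have hV n : ideal (V n).
  apply: idealW.
  - by exists 0%N => //; have [hI _ _] := hU 0%N; exact: ideal0.
  - move=> x y [i _ hx] [j _ hy]; exists (maxn i j) => //.
    have [hI _ _] := hU (maxn i j); apply: idealD => //.
      exact: mono (leq_maxl i j) _ hx.
    exact: mono (leq_maxr i j) _ hy.
  - by move=> a x [i _ hx]; exists i => //; have [hI _ _] := hU i; exact: idealMl.
have cV : compat J V.
  by move=> n x y Jx [i _ hy]; exists i => //; have [_ c _] := hU i; exact: c.
have VF n : V n `<=` F n by move=> x [i _]; have [_ _ h] := hU i; exact: h.
have [_ [K hK]] := stable_sub hF sF hV cV VF hJ.
have acc n : exists N, forall i, U i n `<=` U N n.
  by apply: ideal_acc => // i; have [hI _ _] := hU i.
have [N hN] : exists N, forall n, (n <= K)%N -> forall i, U i n `<=` U N n.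
  elim: K {hK} => [|k [N hN]].
    by have [N hN] := acc 0%N; exists N => n; rewrite leqn0 => /eqP ->.
  have [N' hN'] := acc k.+1; exists (maxn N N') => n nk i x hx.
  have [nk'|kn] := leqP n k.
    by apply: mono (leq_maxl N N') _ (hN _ nk' _ _ hx).
  have nE : n = k.+1 by apply/eqP; rewrite eqn_leq nk kn.
  by subst n; apply: mono (leq_maxr N N') _ (hN' _ _ hx).
exists N => i n; move: i; elim: n => [|n IH] i; first exact: hN.
have [nK|Kn] := leqP n.+1 K; first exact: hN.
move=> x hx; have /(hK n Kn) : V n.+1 x by exists i.
have [hI cN _] := hU N.
move: x {hx}; apply: mul_min => // x y Jx [j _ hy].
by apply: cN => //; exact: IH hy.
Qed.

Lemma fam_max J F (Q : (nat -> set R) -> Prop) : (forall n, ideal (F n)) ->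
  stable J F -> ideal J ->
  (forall U, Q U -> [/\ forall n, ideal (U n), compat J U & forall n, U n `<=` F n]) ->
  forall U, Q U -> exists V, Q V /\
    forall V', Q V' -> (forall n, V n `<=` V' n) -> forall n, V' n `<=` V n.
Proof.
move=> hF sF hJ hQ.
apply: (acc_max (le := fun U V : nat -> set R => forall n, U n `<=` V n)) => U QU Umon.
have [||N hN] := stable_acc hF sF hJ (U := U).
- by move=> i; exact: hQ.
- exact: Umon.
by exists N => n; exact: hN.
Qed.

Lemma ideal_max (Q : set R -> Prop) : (forall I, Q I -> ideal I) ->
  forall I, Q I -> exists M, Q M /\ forall M', Q M' -> M `<=` M' -> M' `<=` M.
Proof.
move=> hQ; apply: (acc_max (le := fun U V : set R => U `<=` V)) => U QU Umon.
have [|N hN] := ideal_acc _ Umon; first by move=> n; exact: hQ.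
by exists N; exact: hN.
Qed.

End Noetherian.
End IdealTheory.

(** * Graded rings *)

Section GradedTheory.
Variables (R : comNzRingType) (gr : nat -> set R).
Hypothesis hgr : grading gr.
Implicit Types (S I J p : set R) (x y : R) (d e : nat).

Lemma gr0 d : gr d 0. Proof. by case: hgr => -[]. Qed.

Lemma grB d x y : gr d x -> gr d y -> gr d (x - y).
Proof. by case: hgr => -[_ _ h _] _ _; exact: h. Qed.

Lemma grN d x : gr d x -> gr d (- x).
Proof. by rewrite -sub0r; apply: grB; exact: gr0. Qed.

Lemma grD d x y : gr d x -> gr d y -> gr d (x + y).
Proof. by move=> hx hy; rewrite -[y]opprK; apply: grB => //; exact: grN. Qed.

Lemma grM d e x y : gr d x -> gr e y -> gr (d + e) (x * y).
Proof. by case: hgr => -[_ _ _ h] _ _; exact: h. Qed.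

Lemma gr1 : gr 0%N 1. Proof. by case: hgr => -[]. Qed.

Lemma grX d n x : gr d x -> gr (d * n) (x ^+ n).
Proof.
move=> hx; elim: n => [|n IH]; first by rewrite muln0; exact: gr1.
by rewrite exprS mulnS; exact: grM.
Qed.

Lemma gr_sum d (T : Type) (r : seq T) (P : pred T) (f : T -> R) :
  (forall i, P i -> gr d (f i)) -> gr d (\sum_(i <- r | P i) f i).
Proof.
by move=> hf; elim/big_ind : _ => //; [exact: gr0 | move=> x y; exact: grD].
Qed.

(* The homogeneous components of x are the coefficients of hp x; this makes
   the decomposition a ring morphism into polynomials. *)
Definition hp x : {poly R} :=
  xget 0 (fun q : {poly R} => (forall d, gr d q`_d) /\ q.[1] = x).

Lemma horner1 (q : {poly R}) : q.[1] = \sum_(i < size q) q`_i.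
Proof. by rewrite horner_coef; apply: eq_bigr => i _; rewrite expr1n mulr1. Qed.

Lemma hp_uniq0 (q : {poly R}) : (forall d, gr d q`_d) -> q.[1] = 0 -> q = 0.
Proof.
move=> hq; rewrite horner1 => q0; apply/polyP => i; rewrite coef0.
have [iq|iq] := ltnP i (size q); last by rewrite nth_default.
by have [_ _ h] := hgr; exact: (h (size q) (fun d => q`_d) hq q0 i iq).
Qed.

Lemma hpP x : (forall d, gr d (hp x)`_d) /\ (hp x).[1] = x.
Proof.
have [_ dec _] := hgr; have [N [c [hc xE]]] := dec x.
apply: (@xgetPex _ 0 (fun q : {poly R} => (forall d, gr d q`_d) /\ q.[1] = x)).
exists (\poly_(d < N) c d); split => [d|].
  by rewrite coef_poly; case: ifP => // _; exact: gr0.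
by rewrite horner_poly xE; apply: eq_bigr => i _; rewrite expr1n mulr1.
Qed.

Lemma hp_gr x d : gr d (hp x)`_d. Proof. exact: (hpP x).1. Qed.

Lemma hp_horner x : (hp x).[1] = x. Proof. exact: (hpP x).2. Qed.

Lemma hp_sum x : x = \sum_(i < size (hp x)) (hp x)`_i.
Proof. by rewrite -{1}[x]hp_horner horner1. Qed.

Lemma hp_uniq x (q : {poly R}) : (forall d, gr d q`_d) -> q.[1] = x -> hp x = q.
Proof.
move=> hq qx; apply/eqP; rewrite -subr_eq0; apply/eqP/hp_uniq0.
  by move=> d; rewrite coefB; apply: grB => //; exact: hp_gr.
by rewrite hornerD hornerN hp_horner qx subrr.
Qed.

Lemma hpD x y : hp (x + y) = hp x + hp y.
Proof.
apply: hp_uniq; last by rewrite hornerD !hp_horner.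
by move=> d; rewrite coefD; apply: grD; exact: hp_gr.
Qed.

Lemma hpM x y : hp (x * y) = hp x * hp y.
Proof.
apply: hp_uniq; last by rewrite hornerM !hp_horner.
move=> d; rewrite coefM; apply: gr_sum => i _.
have /subnKC {1}<- : (i <= d)%N by rewrite -ltnS.
by apply: grM; exact: hp_gr.
Qed.

Lemma hp_hom d x : gr d x -> hp x = x%:P * 'X^d.
Proof.
move=> hx; apply: hp_uniq => [e|]; last by rewrite !hornerE expr1n mulr1.
rewrite coefMXn; case: ltnP => de; first exact: gr0.
rewrite coefC subn_eq0; case: leqP => ed; last exact: gr0.
by have -> : e = d by apply/eqP; rewrite eqn_leq ed de.
Qed.

Lemma hp_homE d e x : gr d x -> (hp x)`_e = if e == d then x else 0.
Proof.
move=> /hp_hom ->; rewrite coefMXn coefC; case: ltngtP => [//|h|->].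
  by rewrite subn_eq0 leqNgt h.
by rewrite subnn.
Qed.

Lemma hp0 : hp 0 = 0. Proof. by rewrite (hp_hom (gr0 0)) mul0r. Qed.

Lemma hp1 : hp 1 = 1. Proof. by rewrite (hp_hom gr1) mulr1. Qed.

Lemma hpN x : hp (- x) = - hp x.
Proof. by apply: (addrI (hp x)); rewrite -hpD !subrr hp0. Qed.

Lemma hpB x y : hp (x - y) = hp x - hp y. Proof. by rewrite hpD hpN. Qed.

Lemma hpX x n : hp (x ^+ n) = hp x ^+ n.
Proof. by elim: n => [|n IH]; rewrite ?hp1 // !exprS hpM IH. Qed.

Lemma hp_sum_morph (T : Type) (r : seq T) (P : pred T) (f : T -> R) :
  hp (\sum_(i <- r | P i) f i) = \sum_(i <- r | P i) hp (f i).
Proof. by apply: (big_morph hp hpD hp0). Qed.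

Lemma hp_inj x : hp x = 0 -> x = 0.
Proof. by move=> h; rewrite -[x]hp_horner h horner0. Qed.

Lemma hpMl d e x y : gr d x -> (hp (x * y))`_(d + e) = x * (hp y)`_e.
Proof.
by move=> hx; rewrite hpM (hp_hom hx) -mulrA coefCM coefXnM ltnNge leq_addr addKn.
Qed.

Lemma hpMl_lt d e x y : gr d x -> (e < d)%N -> (hp (x * y))`_e = 0.
Proof.
by move=> hx ed; rewrite hpM (hp_hom hx) -mulrA coefCM coefXnM ed mulr0.
Qed.

(** Closure under components, equivalent to homogeneous generation by [hom_homogeneous], is easier
    to carry through colons and extensions. *)
Definition hom I : Prop := ideal I /\ forall x d, I x -> I (hp x)`_d.

Lemma hom_gen S : (forall x, S x -> exists d, gr d x) -> hom (ideal_gen S).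
Proof.
move=> hS; have gS := ideal_genP S; split => // x d hx.
pose K := [set x | forall d, ideal_gen S (hp x)`_d].
suff : ideal_gen S `<=` K by move=> /(_ x hx).
apply: gen_min; first apply: idealW.
- by move=> e; rewrite hp0 coef0; exact: ideal0.
- by move=> y z hy hz e; rewrite hpD coefD; apply: (idealD gS).
- move=> a y hy e; rewrite hpM coefM; apply: (ideal_sum _ gS) => i _.
  exact: (idealMl _ gS).
- move=> y Sy e; have [f hf] := hS y Sy; rewrite (hp_homE _ hf).
  by case: eqP => _; [exact: gen_sub | exact: (ideal0 gS)].
Qed.

Lemma hom_le I J : hom I -> ideal J -> (forall d x, gr d x -> I x -> J x) -> I `<=` J.
Proof.
move=> [_ hI] hJ h x Ix; rewrite [x]hp_sum; apply: ideal_sum => // i _.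
by apply: h (hp_gr _ _) _; exact: hI.
Qed.

Lemma hom_homogeneous I : homogeneous_ideal gr I <-> hom I.
Proof.
split; first by move=> [_ ->]; apply: hom_gen => x [_ [d _ hd]]; exists d.
move=> [iI hI]; split => //; apply/seteqP; split; last by apply: gen_min => // x [].
apply: hom_le; first by [].
  exact: ideal_genP.
by move=> d x hx Ix; apply: gen_sub; split => //; exists d.
Qed.

Lemma hom_mul I J : hom I -> hom J -> hom (ideal_mul I J).
Proof.
move=> hI hJ; have [iI cI] := hI; have [iJ cJ] := hJ.
suff -> : ideal_mul I J = ideal_gen [set x * y | x in I `&` \bigcup_d gr d &
    y in J `&` \bigcup_d gr d].
  apply: hom_gen => _ [x [_ [d _ hx]] [y [_ [e _ hy]] <-]].
  by exists (d + e)%N; exact: grM.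
apply/seteqP; split; last first.
  by apply: gen_mono => _ [x [Ix _] [y [Jy _] <-]]; exists x => //; exists y.
apply: mul_min; first exact: ideal_genP.
move=> x y Ix Jy; rewrite [x]hp_sum [y]hp_sum mulr_suml.
apply: (ideal_sum _ (ideal_genP _)) => i _; rewrite mulr_sumr.
apply: (ideal_sum _ (ideal_genP _)) => j _; apply: gen_sub.
exists (hp x)`_i; first by split; [exact: cI | exists i => //; exact: hp_gr].
by exists (hp y)`_j => //; split; [exact: cJ | exists j => //; exact: hp_gr].
Qed.

Lemma hom_pow I n : hom I -> hom (ideal_pow I n).
Proof. by move=> hI; elim: n => //= n IH; exact: hom_mul. Qed.

Lemma hom_colon I J : hom I -> hom J -> hom (colon I J).
Proof.
move=> [iI hI] hJ; have iC := colon_ideal J iI; split => // r d hr x Jx.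
have iK : ideal (colon_elt I (hp r)`_d) by exact: colon_elt_ideal.
suff : J `<=` colon_elt I (hp r)`_d by move=> /(_ x Jx); rewrite /colon_elt /= mulrC.
apply: hom_le => // e y hy Jy; rewrite /colon_elt /=.
by rewrite -(hpMl _ _ hy); apply: hI; rewrite mulrC; exact: hr.
Qed.

Lemma hom_colon_elt I d x : hom I -> gr d x -> hom (colon_elt I x).
Proof.
move=> [iI hI] hx; split; first exact: colon_elt_ideal.
move=> r e hr; rewrite /colon_elt /= mulrC -(hpMl _ _ hx); apply: hI.
by rewrite mulrC.
Qed.

Lemma hom_saturation I L : hom I -> hom L -> ideal (saturation I L) ->
  hom (saturation I L).
Proof.
move=> hI hL iS; split => // x d [t t1 hx]; exists t => //.
by have [_ h] := hom_colon hI (hom_pow t hL); exact: h.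
Qed.

Lemma hom_fin_gen I : noetherian_ring R -> hom I ->
  exists s : seq (R * nat), (forall b, b \in s -> gr b.2 b.1 /\ I b.1) /\
    I = ideal_gen [set` unzip1 s].
Proof.
move=> hR hI; have [_ IE] := (hom_homogeneous I).2 hI.
have [s [hs sE]] := fin_gen (I `&` \bigcup_d gr d) hR.
have {}sE : I = ideal_gen [set` s] by rewrite IE.
suff [t [ht tE]] : exists t : seq (R * nat),
    (forall b, b \in t -> gr b.2 b.1 /\ I b.1) /\ unzip1 t = s by exists t; rewrite tE.
elim: s hs {IE sE} => [|g s IH] hs; first by exists [::].
have [|t [ht <-]] := IH; first by move=> h hin; apply: hs; rewrite inE hin orbT.
have [Ig [d _ hd]] := hs g (mem_head _ _).
by exists ((g, d) :: t); split => // b; rewrite inE => /orP[/eqP ->|/ht].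
Qed.

(** Otherwise a product of elements, one from each [A i] and outside [p], lies in the intersection
    but not in [p]. Writing a prime as an intersection of annihilators thus yields a new witness for
    it: a homogeneous one, or one for another ideal. *)
Lemma prime_inter (T : eqType) (r : seq T) (A : T -> set R) p : prime_ideal p ->
  (forall i, i \in r -> ideal (A i)) ->
  (forall i, i \in r -> p `<=` A i) ->
  (forall x, (forall i, i \in r -> A i x) -> p x) ->
  exists2 i, i \in r & p = A i.
Proof.
move=> [ip p1 pM] iA pA Ap; apply: contrapT => h.
have {}h i : i \in r -> exists2 x, A i x & ~ p x.
  move=> ir; apply: contrapT => h'; apply: h; exists i => //.
  apply/seteqP; split; first exact: pA.
  by move=> x Ax; apply: contrapT => px; apply: h'; exists x.
suff [x hx px] : exists2 x, (forall i, i \in r -> A i x) & ~ p x by exact/px/Ap.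
elim: r iA h {pA Ap} => [|i r IH] iA h; first by exists 1.
have [j jr|j jr|x hx px] := IH.
- by apply: iA; rewrite inE jr orbT.
- by apply: h; rewrite inE jr orbT.
have [y Ay py] := h i (mem_head _ _).
exists (y * x); last by move=> /pM[].
move=> j; rewrite inE => /orP[/eqP ->|jr].
  by apply: idealMr => //; apply: iA; rewrite inE eqxx.
by apply: idealMl; [apply: iA; rewrite inE jr orbT | exact: hx].
Qed.

Lemma prime_exp p x n : prime_ideal p -> p (x ^+ n) -> p x.
Proof.
move=> [ip p1 pM]; elim: n => [|n IH]; first by move=> /p1.
by rewrite exprS => /pM[].
Qed.

(* If r is the lowest component of an element of (I : x), then multiplying by a
   high enough power of r kills the components of x one by one. *)
Lemma low_comp_kills I x y d : hom I -> I (y * x) -> (forall e, (e < d)%N -> (hp y)`_e = 0) ->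
  exists n, I ((hp y)`_d ^+ n * x).
Proof.
move=> [iI hI] hyx low; set r := (hp y)`_d.
have up n m z : (n <= m)%N -> I (r ^+ n * z) -> I (r ^+ m * z).
  by move=> /subnK <- h; rewrite exprD -mulrA; exact: idealMl.
have kill N : exists n, forall i, (i < N)%N -> I (r ^+ n * (hp x)`_i).
  elim: N => [|N [n IH]]; first by exists 0%N.
  exists n.+1 => i; rewrite ltnS leq_eqVlt => /orP[/eqP ->|iN]; last first.
    by apply: (up n) => //; exact: IH.
  (* The component of degree [d + N] of [y * x] is [r] times that of [x] in degree [N], plus terms
     with lower components of [x], which r^n kills by induction, and terms with components of [y]
     below [d], which vanish. *)
  have := idealMl (r ^+ n) iI (hI _ (d + N)%N hyx); rewrite hpM coefM.
  have dN : (d < (d + N).+1)%N by rewrite ltnS leq_addr.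
  rewrite (bigD1 (Ordinal dN)) //= addKn mulrDr -/r mulrA -exprSr.
  set s := (X in r ^+ n * X).
  move=> h; rewrite -[_ * _](addrK (r ^+ n * s)); apply: idealB => //.
  rewrite mulr_sumr; apply: ideal_sum => // -[j jlt] /= jd.
  have [jd'|dj] := ltnP j d; first by rewrite low // mul0r mulr0; exact: ideal0.
  rewrite mulrCA; apply: idealMl => //; apply: IH.
  move: jd; rewrite -val_eqE /= => jd; have {dj} : (d < j)%N by rewrite ltn_neqAle eq_sym jd.
  by move: jlt; lia.
have [n hn] := kill (size (hp x)); exists n.
rewrite [x]hp_sum mulr_sumr; apply: ideal_sum => // i _; exact: hn.
Qed.

(** Components are treated from the bottom: removing those of degree below [d], known to be in [p],
    makes the one of degree [d] lowest; a power of it kills [x] modulo [I], hence lies in [p]. *)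
Lemma hom_assoc I p x : hom I -> prime_ideal p -> p = colon_elt I x -> hom p.
Proof.
move=> hI hpp pE; have [ip p1 pM] := hpp; split => //.
suff h y d : p y -> p (hp y)`_d by [].
move=> py; elim/ltn_ind: d => d IH.
pose z := y - \sum_(i < d) (hp y)`_i.
have pz : p z.
  by apply: idealB => //; apply: ideal_sum => // i _; apply: IH.
have zE e : (hp z)`_e = if (e < d)%N then 0 else (hp y)`_e.
  rewrite hpB coefB hp_sum_morph coef_sum.
  have -> : \sum_(i < d) (hp (hp y)`_i)`_e = \sum_(i < d | i == e :> nat) (hp y)`_e.
    rewrite [RHS]big_mkcond; apply: eq_bigr => i _; rewrite (hp_homE _ (hp_gr _ _)) eq_sym.
    by case: eqP => [->|].
  case: ltnP => ed.
    rewrite (big_pred1 (Ordinal ed)) ?subrr // => i; exact: eq_sym.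
  rewrite big_pred0 ?subr0 // => i; apply/negbTE.
  by rewrite neq_ltn (leq_trans (ltn_ord i) ed).
have hzx : I (z * x) by move: pz; rewrite pE.
have [e ed|n hn] := low_comp_kills hI hzx (d := d); first by rewrite zE ed.
move: hn; rewrite zE ltnn => hn; apply: (prime_exp (n := n)) => //.
by rewrite pE.
Qed.

(** Since [p] is homogeneous, it is the intersection of the annihilators modulo [I] of the
    components of [x], so it equals one of them. *)
Lemma assoc_hom_elt I p : hom I -> Ass I p ->
  hom p /\ exists d f, gr d f /\ p = colon_elt I f.
Proof.
move=> hI [pp [x pE]]; have hp' := hom_assoc hI pp pE; split => //.
have [iI cI] := hI.
have [i|i _|y hy|i _ piE] := prime_inter (r := iota 0 (size (hp x)))
  (A := fun i => colon_elt I (hp x)`_i) pp.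
- by move=> _; exact: colon_elt_ideal.
- apply: hom_le => //; first exact: colon_elt_ideal.
  move=> d r hr; rewrite pE /colon_elt /= => hrx.
  by rewrite -(hpMl _ _ hr); exact: cI.
- rewrite pE /colon_elt /= [x]hp_sum mulr_sumr; apply: ideal_sum => // i _.
  by apply: hy; rewrite mem_iota /= ltn_ord.
- by exists i, (hp x)`_i; split => //; exact: hp_gr.
Qed.

(** An annihilator that is maximal among those of elements outside [I] is prime. *)
Lemma prime_ass_exists I : noetherian_ring R -> ideal I -> ~ I 1 -> exists p, Ass I p.
Proof.
move=> hR iI I1.
have [||J [[x [Ix JE]] Jmax]] := ideal_max hR
    (Q := fun J => exists x, ~ I x /\ J = colon_elt I x) _ (I := colon_elt I 1).
- by move=> J [x [_ ->]]; exact: colon_elt_ideal.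
- by exists 1.
exists J; split; last by exists x.
split; first by rewrite JE; exact: colon_elt_ideal.
  by rewrite JE /colon_elt /= mul1r.
move=> y z Jyz; have [Jz|Jz] := pselect (J z); [by right | left].
have h : J `<=` colon_elt I (z * x).
  move=> w; rewrite JE /colon_elt /= => hw; rewrite mulrCA; exact: idealMl.
apply: (Jmax _ _ h); first by exists (z * x); split => // Izx; apply: Jz; rewrite JE.
by move: Jyz; rewrite JE /colon_elt /= mulrA.
Qed.

End GradedTheory.

(** * Eventually linear minima *)

Definition minis (D : set nat) (u : nat) : Prop :=
  D u /\ forall v, D v -> (u <= v)%N.

Lemma minis_ex (D : set nat) u : D u -> exists v, minis D v.
Proof.
move=> Du; have ex : exists n, `[< D n >] by exists u; exact/asboolP.
have [v /asboolP Dv vmin] := ex_minnP ex.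
by exists v; split => // w Dw; apply: vmin; exact/asboolP.
Qed.

Lemma natminP (D : set nat) u : D u -> minis D (natmin D).
Proof. by move=> /minis_ex h; apply: (xgetPex 0%N h). Qed.

Lemma natmin_eq (D : set nat) u : minis D u -> natmin D = u.
Proof.
move=> [Du umin]; have [Dm mmin] := natminP Du.
by apply/eqP; rewrite eqn_leq mmin // umin.
Qed.

Lemma natmin_none (D : set nat) : (forall u, ~ D u) -> natmin D = 0%N.
Proof. by move=> D0; rewrite /natmin xgetPN // => u [/D0]. Qed.

(** Eventual emptiness is a separate alternative: it is neutral for unions, whereas the default
    value 0 of [natmin] would spoil a minimum. *)
Definition lin (S : set nat) (G : nat -> set nat) : Prop :=
  (exists K, forall k, (K <= k)%N -> forall u, ~ G k u) \/
  exists K b c, S c /\ forall k, minis (G (K + k)%N) (b + c * k)%N.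

Lemma lin_ext S (G G' : nat -> set nat) K :
  (forall k, (K <= k)%N -> G k = G' k) -> lin S G -> lin S G'.
Proof.
move=> GG [[K' h]|[K' [b [c [Sc h]]]]].
  left; exists (maxn K K') => k; rewrite geq_max => /andP[k1 k2] u.
  by rewrite -GG //; exact: h.
right; exists (K + K')%N, (b + c * K)%N, c; split => // k.
rewrite -GG; last by rewrite -addnA leq_addr.
by have := h (K + k)%N; congr (minis (G _) _); lia.
Qed.

Lemma lin_none S (G : nat -> set nat) : (forall k u, ~ G k u) -> lin S G.
Proof. by move=> h; left; exists 0%N => k _; exact: h. Qed.

(** With [c] the least element of [cs], the minimum grows by exactly [c] at each step: adding [c] is
    allowed, and every element at [k.+1] arises from one at [k] by adding at least [c]. *)
Lemma lin_rec (cs : seq nat) (G : nat -> set nat) K :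
  (forall k c u, (K <= k)%N -> c \in cs -> G k u -> G k.+1 (u + c)%N) ->
  (forall k u, (K <= k)%N -> G k.+1 u ->
     exists c, [/\ c \in cs, (c <= u)%N & G k (u - c)%N]) ->
  lin [set` cs] G.
Proof.
move=> up down; have [[u Gu]|G0] := pselect (exists u, G K u); last first.
  left; exists K; elim=> [|k IH].
    by rewrite leqn0 => /eqP K0; subst K => u Gu; apply: G0; exists u.
  rewrite leq_eqVlt => /orP[/eqP KE|Kk] u Gu.
    by apply: G0; exists u; rewrite KE.
  by have [c [_ _ /IH]] := down _ _ Kk Gu; exact.
have [cs0|cs0] := eqVneq cs [::].
  by left; exists K.+1 => -[//|k] Kk v /(down _ _ Kk)[c []]; rewrite cs0.
have [c [cc cmin]] : exists c, minis [set` cs] c.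
  by case: cs cs0 {up down} => // c cs _; apply: (@minis_ex _ c) => /=; rewrite inE eqxx.
have [b [Gb bmin]] := minis_ex Gu.
right; exists K, b, c; split => //; elim=> [|k [IH1 IH2]].
  by rewrite addn0 muln0 addn0.
rewrite addnS mulnSr addnA; split; first by apply: up; rewrite ?leq_addr.
move=> v /down[|c' [c's c'v /IH2]]; first exact: leq_addr.
by have := cmin _ c's; lia.
Qed.

Lemma lin_union S (G G' : nat -> set nat) : lin S G -> lin S G' ->
  lin S (fun k => G k `|` G' k).
Proof.
wlog : G G' / (exists K, forall k, (K <= k)%N -> forall u, ~ G k u) \/
    exists K b c b' c', [/\ S c, S c', (c <= c')%N,
     forall k, minis (G (K + k)%N) (b + c * k)%N &
     forall k, minis (G' (K + k)%N) (b' + c' * k)%N].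
  move=> W hG hG'; have [G0|[K [b [c [Sc h]]]]] := hG; first by apply: W => //; left.
  have [G0|[K' [b' [c' [Sc' h']]]]] := hG'.
    apply: (@lin_ext _ (fun k => G' k `|` G k) _ 0%N) => [k _|]; first exact: setUC.
    by apply: W => //; left.
  have h1 k : minis (G (K + K' + k)%N) ((b + c * K') + c * k)%N.
    by have := h (K' + k)%N; congr (minis (G _) _); lia.
  have h1' k : minis (G' (K + K' + k)%N) ((b' + c' * K) + c' * k)%N.
    by have := h' (K + k)%N; congr (minis (G' _) _); lia.
  have [cc'|cc'] := leqP c c'.
    by apply: W => //; right; exists (K + K')%N, (b + c * K')%N, c, (b' + c' * K)%N, c'.
  apply: (@lin_ext _ (fun k => G' k `|` G k) _ 0%N) => [k _|]; first exact: setUC.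
  apply: W => //; right; exists (K + K')%N, (b' + c' * K)%N, c', (b + c * K')%N, c.
  by split => //; exact: ltnW.
move=> [[K G0] _ hG'|].
  apply: lin_ext hG' => k /G0 {}G0; apply/seteqP; split => u; first by right.
  by case=> // /G0.
move=> [K [b [c [b' [c' [Sc Sc' cc' h h']]]]]] _ _; right.
have [/eqP cE|ltcc'] : c == c' \/ (c < c')%N.
  by move: cc'; rewrite leq_eqVlt => /orP[]; [left|right].
- subst c'; exists K, (minn b b'), c; split => // k.
  have [h1 h2] := h k; have [h1' h2'] := h' k; split.
    have [bb'|b'b] := leqP b b'; [left|right] => //.
  by move=> v [/h2|/h2']; lia.
(* As c < c', the inequality b + c k <= b' + c' k holds as soon as k >= b, whence the shift by
   [b]. *)
- exists (K + b)%N, (b + c * b)%N, c; split => // k.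
  have [h1 h2] := h (b + k)%N; have [h1' h2'] := h' (b + k)%N.
  rewrite (_ : b + c * b + c * k = b + c * (b + k))%N; last by lia.
  rewrite -addnA; split; first by left.
  by move=> v [/h2 //|/h2']; nia.
Qed.

Lemma lin_bigcup S n (G : nat -> nat -> set nat) : (forall i, (i < n)%N -> lin S (G i)) ->
  lin S (fun k => [set u | exists2 i, (i < n)%N & G i k u]).
Proof.
elim: n => [|n IH] hG; first by apply: lin_none => k u [].
have h := lin_union (IH _) (hG n (ltnSn n)).
apply: (lin_ext (K := 0%N) _ (h _)) => [k _|i ni]; last by apply: hG; exact: ltnW.
apply/seteqP; split => u /=.
  by move=> [[i ni Gu]|Gu]; [exists i => //; exact: ltnW | exists n].
move=> [i]; rewrite ltnS leq_eqVlt => /orP[/eqP ->|ni Gu]; first by right.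
by left; exists i.
Qed.

(** * Prime filtrations of graded modules *)

(** An explicit form of the product of the ideal generated by [s] with [I], from which homogeneous
    components can be extracted one generator at a time. *)
Fixpoint lcomb (R : comNzRingType) (s : seq R) (I : set R) : set R :=
  if s is b :: s' then
    [set x | exists c y, [/\ I c, lcomb s' I y & x = b * c + y]]
  else [set 0].

Lemma lcomb_ideal (R : comNzRingType) (s : seq R) (I : set R) : ideal I -> ideal (lcomb s I).
Proof.
move=> iI; elim: s => [|b s IH]; first exact: ideal_zero.
apply: idealW => /=.
- by exists 0, 0; split; [exact: ideal0 | exact: ideal0 | rewrite mulr0 addr0].
- move=> _ _ [c [y [Ic sy ->]]] [d [z [Id sz ->]]].
  exists (c + d), (y + z); split; [exact: idealD | exact: idealD |].
  by rewrite mulrDr addrACA.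
- move=> a _ [c [y [Ic sy ->]]]; exists (a * c), (a * y).
  by split; [exact: idealMl | exact: idealMl | rewrite mulrDr mulrCA].
Qed.

Lemma lcomb_mul (R : comNzRingType) (s : seq R) (I : set R) : ideal I ->
  ideal_mul (ideal_gen [set` s]) I `<=` lcomb s I.
Proof.
move=> iI; apply: mul_gen_min; first exact: lcomb_ideal.
move=> b c /= + Ic; elim: s => //= b' s IH; rewrite inE => /orP[/eqP ->|/IH h].
  by exists c, 0; split; [|exact: ideal0 (lcomb_ideal _ _) | rewrite addr0].
by exists 0, (b * c); split; [exact: ideal0| | rewrite mulr0 add0r].
Qed.

Section PrimeFiltration.
Variables (R : comNzRingType) (gr : nat -> set R).
Hypotheses (hgr : grading gr) (hR : noetherian_ring R).
Variable bs : seq (R * nat).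
Hypothesis hbs : forall b, b \in bs -> gr b.2 b.1.
Let J : set R := ideal_gen [set` unzip1 bs].
Variable W : nat -> set R.
Hypotheses (hW : forall n, hom gr (W n)) (sW : stable J W).
Implicit Types (N : nat -> set R) (x y : R).

Let hJ : hom gr J.
Proof.
by apply: hom_gen => // x /mapP[b /hbs hb ->]; exists b.2.
Qed.

Let Jb b : b \in bs -> J b.1.
Proof. by move=> bsb; apply: gen_sub; apply/mapP; exists b. Qed.

Definition gfam N : Prop := (forall n, hom gr (N n)) /\ compat J N.

(** For a module [N], this is the submodule generated by [N] and x t^m. *)
Definition ext N m x : nat -> set R := fun n =>
  if (m <= n)%N then [set y | exists a j, [/\ N n a, ideal_pow J (n - m) j & y = a + j * x]]
  else N n.

(* The annihilator of x modulo N is a homogeneous prime of the Rees algebra. *)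
Definition prime_ann N m x : Prop :=
  forall i j d e y z, ideal_pow J i y -> ideal_pow J j z -> gr d y -> gr e z ->
    N (m + (i + j))%N (y * z * x) -> N (m + i)%N (y * x) \/ N (m + j)%N (z * x).

Lemma ext_sub N m x n : (forall n, ideal (N n)) -> N n `<=` ext N m x n.
Proof.
move=> hN a Na; rewrite /ext; case: ifP => // _; exists a, 0.
by split => //; [exact: ideal0 (pow_ideal _ _) | rewrite mul0r addr0].
Qed.

Lemma ext_mem N m x : (forall n, ideal (N n)) -> ext N m x m x.
Proof.
move=> hN; rewrite /ext leqnn subnn; exists 0, 1.
by split => //; [exact: ideal0 | rewrite mul1r add0r].
Qed.

Lemma ext_gfam N m x e : gfam N -> gr e x -> gfam (ext N m x).
Proof.
move=> [hN cN] hx; split.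
  move=> n; rewrite /ext; case: ifP => // mn; have [iN cmp] := hN n.
  have [iP cP] := hom_pow hgr (n - m) hJ.
  split; first apply: idealW => /=.
  - by exists 0, 0; split; [exact: ideal0 | exact: ideal0 | rewrite mul0r addr0].
  - move=> _ _ [a [j [Na hj ->]]] [b [k [Nb hk ->]]].
    exists (a + b), (j + k); split; [exact: idealD | exact: idealD |].
    by rewrite mulrDl addrACA.
  - move=> c _ [a [j [Na hj ->]]]; exists (c * a), (c * j).
    by split; [exact: idealMl | exact: idealMl | rewrite mulrDr mulrA].
  - move=> _ d [a [j [Na hj ->]]].
    exists (hp gr a)`_d, (if (d < e)%N then 0 else (hp gr j)`_(d - e)); split.
    + exact: cmp.
    + by case: ifP => _; [exact: ideal0 | exact: cP].
    + rewrite (hpD hgr) coefD [j * x]mulrC; congr (_ + _); case: ltnP => de.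
        by rewrite (hpMl_lt hgr _ hx) // mul0r.
      by rewrite -{1}(subnKC de) (hpMl hgr _ _ hx) mulrC.
move=> n y z Jy; rewrite /ext; have [nm|mn] := ltnP n m.
  move=> Nz; have Nyz : N n.+1 (y * z) by exact: cN.
  case: ifP => // mn; exists (y * z), 0.
  by split => //; [exact: ideal0 (pow_ideal _ _) | rewrite mul0r addr0].
move=> [a [j [Na hj ->]]]; rewrite leqW //; exists (y * a), (y * j).
split; [exact: cN | | by rewrite mulrDr mulrA].
by rewrite subSn //; exact: mem_mul.
Qed.

(** The filtration appears as an induction principle, descending from [W]. In a maximal
    counterexample [V], a homogeneous element of [W] outside [V] with maximal annihilator has a
    prime annihilator, and [P] holds for the strictly larger family generated by [V] and this
    element. *)
Lemma prime_filtration (P : (nat -> set R) -> Prop) :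
  (forall N, gfam N -> (forall n, N n `<=` W n) -> (forall n, W n `<=` N n) -> P N) ->
  (forall N m e x, gfam N -> (forall n, N n `<=` W n) -> W m x -> gr e x -> ~ N m x ->
     prime_ann N m x -> P (ext N m x) -> P N) ->
  forall N, gfam N -> (forall n, N n `<=` W n) -> P N.
Proof.
move=> P0 PS N fN NW; apply: contrapT => PN.
have iJ : ideal J by exact: ideal_genP.
have iW n : ideal (W n) by have [] := hW n.
have [||V [[[hV cV] VW PV] Vmax]] := fam_max hR iW sW iJ
    (Q := fun N => [/\ gfam N, forall n, N n `<=` W n & ~ P N]) _ (U := N).
- by move=> U [[hU cU] UW _]; split => // n; have [] := hU n.
- by [].
have iV n : ideal (V n) by have [] := hV n.
have [WV|] := pselect (forall n, W n `<=` V n); first by apply: PV; exact: P0.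
move=> /existsNP[n nWV].
have [d [w [hd Ww Vw]]] : exists d w, [/\ gr d w, W n w & ~ V n w].
  apply: contrapT => h; apply: nWV; apply: (hom_le hgr (hW n)) => // d w hd Ww.
  by apply: contrapT => Vw; apply: h; exists d, w.
(* The annihilator of x t^m modulo [V], as a graded ideal of the Rees algebra. The index is shifted
   by [m], so that annihilators of elements living in different indices can be compared. *)
pose ann m x := fun k => ideal_pow J k `&` colon_elt (V (m + k)%N) x.
have annP m x : [/\ forall k, ideal (ann m x k), compat J (ann m x)
    & forall k, ann m x k `<=` ideal_pow J k].
  split; last by move=> k y [].
    by move=> k; apply: idealI; [exact: pow_ideal | exact: colon_elt_ideal].
  move=> k y z Jy [hz hzx]; split; first exact: mem_mul.
  by rewrite /colon_elt /= -mulrA addnS; exact: cV.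
have [||A [[m [e [x [Wx hx Vx ->]]]] Amax]] := fam_max hR (pow_ideal J) (pow_stable J) iJ
    (Q := fun A => exists m e x, [/\ W m x, gr e x, ~ V m x & A = ann m x]) _ (U := ann n w).
- by move=> _ [m [e [x [_ _ _ ->]]]]; exact: annP.
- by exists n, d, w.
apply: PV; apply: (PS V m e x) => //.
  move=> i j di dj y z hy hz hdy hdz; have [Vz _|Vz Vyzx] := pselect (V (m + j)%N (z * x)).
    by right.
  (* As z x is outside [V], its annihilator, which contains that of x, equals it by maximality; and
     [y] belongs to the annihilator of z x. *)
  left; suff [] : ann m x i y by [].
  apply: (Amax (ann (m + j)%N (z * x))) => [|k t [ht Vt]|]; last 1 first.
  - split => //; rewrite /colon_elt /= mulrA.
    by move: Vyzx; rewrite -addnA [(i + j)%N]addnC.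
  - exists (m + j)%N, (dj + e)%N, (z * x); split => //; last exact: grM.
    rewrite addnC; apply: (compat_pow iW sW.1 hz Wx).
  - split => //; rewrite /colon_elt /= mulrCA -addnA [(j + k)%N]addnC addnA [(_ + j)%N]addnC.
    exact: (compat_pow iV cV hz).
apply: contrapT => Pext; apply: Vx.
apply: (Vmax (ext V m x)); last exact: ext_mem.
  split => //; first exact: ext_gfam hx.
  move=> k y; rewrite /ext; case: leqP => [mk|_]; last exact: VW.
  move=> [a [j [/VW Wa hj ->]]]; apply: idealD => //.
  by rewrite -(subnK mk); exact: (compat_pow iW sW.1 hj).
by move=> k; exact: ext_sub.
Qed.

(** Comparing components of degree [u] makes the coefficient of [x] homogeneous of degree [u - e];
    if [u < e], only the component of an element of [N] would remain. *)
Lemma ext_homog N m e x k u y : gfam N -> gr e x -> ext N m x k y -> gr u y -> ~ N k y ->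
  (m <= k)%N /\ exists j v a, [/\ u = (v + e)%N, gr v j, ideal_pow J (k - m) j, N k a
    & y = a + j * x].
Proof.
move=> [hN cN] hx; rewrite /ext; case: leqP => // mk [a [j [Na hj yE]]] hy Ny.
split => //; have [iN cmp] := hN k.
have yuE : y = (hp gr a)`_u + (hp gr (x * j))`_u.
  by rewrite -coefD -(hpD hgr) mulrC -yE (hp_homE hgr _ hy) eqxx.
have [ue|eu] := ltnP u e.
  by case: Ny; rewrite yuE (hpMl_lt hgr _ hx) // addr0; exact: cmp.
exists (hp gr j)`_(u - e), (u - e)%N, (hp gr a)`_u; split.
- by rewrite subnK.
- exact: hp_gr.
- by have [_ h] := hom_pow hgr (k - m) hJ; exact: h.
- exact: cmp.
- by rewrite {1}yuE -{2}(subnKC eu) (hpMl hgr _ _ hx) mulrC.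
Qed.

(* In a quotient of the Rees algebra by a prime, a monomial survives iff each of
   its variables does. *)
Lemma init_degree_lin N : gfam N -> (forall n, N n `<=` W n) ->
  lin [set` unzip2 bs] (fun k => [set u | exists x, [/\ W k x, gr u x & ~ N k x]]).
Proof.
move: N; apply: prime_filtration => [N _ _ WN|N m e x fN NW Wx hx Nx prim IH].
  by apply: lin_none => k u [x [/WN]].
have [hN cN] := fN; have iN n : ideal (N n) by have [] := hN n.
have iW n : ideal (W n) by have [] := hW n.
(* Degrees in the quotient of [ext N m x] by [N], a shifted copy of the Rees algebra modulo a
   prime. *)
pose G2 k := [set u | exists y, [/\ ext N m x k y, gr u y & ~ N k y]].
(* The generators of [J] that do not annihilate [x] modulo [N]: by primality, multiplication by them
   preserves nonzero classes, and the other generators produce only zero. *)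
pose cs := [seq b <- bs | `[< ~ N m.+1 (b.1 * x) >]].
have G2P k u : (m <= k)%N -> G2 k u <->
    exists j v, [/\ u = (v + e)%N, gr v j, ideal_pow J (k - m) j & ~ N k (j * x)].
  move=> mk; split.
    move=> [y [hy hu Ny]]; have [_ [j [v [a [uE hv hj Na yE]]]]] := ext_homog fN hx hy hu Ny.
    by exists j, v; split => // Njx; apply: Ny; rewrite yE; exact: idealD.
  move=> [j [v [-> hv hj Njx]]]; exists (j * x); split => //; last exact: grM.
  rewrite /ext mk; exists 0, j; split => //; [exact: ideal0 | by rewrite add0r].
have lin2 : lin [set` unzip2 cs] G2.
  apply: (@lin_rec _ _ m) => [k c u mk|k u mk].
    move=> /mapP[b]; rewrite mem_filter => /andP[/asboolP Nb bsb] ->.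
    move=> /(G2P _ _ mk)[j [v [-> hv hj Njx]]].
    apply/(G2P _ _ (leqW mk)); exists (b.1 * j), (b.2 + v)%N; split.
    - by rewrite addnC addnA.
    - by apply: grM => //; exact: hbs.
    - by rewrite subSn //; apply: mem_mul => //; exact: Jb.
    - move=> h; have := prim 1%N (k - m)%N b.2 v b.1 j (mem_pow1 (Jb bsb)) hj (hbs bsb) hv.
      rewrite addnA addn1 addSn subnKC // => /(_ h)[//|].
      exact: Njx.
  move=> /(G2P _ _ (leqW mk))[j [v [-> hv]]]; rewrite subSn // => hj Njx.
  have hj' : lcomb (unzip1 bs) (ideal_pow J (k - m)) j.
    by move: j hj {hv Njx}; apply: lcomb_mul; exact: pow_ideal.
  (* Were all products b c x in [N], with c homogeneous of the complementary degree, then the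
     component of degree [v] of [j], which is [j] itself, would send [x] into [N]. *)
  apply: contrapT => h; apply: Njx.
  have {h} h b c w : b \in bs -> gr w c -> ideal_pow J (k - m) c -> (b.2 + w)%N = v ->
      N k.+1 (b.1 * c * x).
    move=> bsb hw hc wv; apply: contrapT => Nbc; apply: h; exists b.2.
    have Nb : ~ N m.+1 (b.1 * x).
      move=> Nb; apply: Nbc; rewrite mulrAC mulrC.
      by have := compat_pow iN cN hc Nb; rewrite addnS subnK.
    split; first by apply: map_f; rewrite mem_filter bsb andbT; exact/asboolP.
      by rewrite -wv -addnA leq_addr.
    apply/(G2P _ _ mk); exists c, w; split => //; first by rewrite -wv -addnA addKn.
    by move=> Nc; apply: Nbc; rewrite -mulrA; apply: cN => //; exact: Jb.
  suff : N k.+1 ((hp gr j)`_v * x) by rewrite (hp_homE hgr _ hv) eqxx.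
  have [_ cP] := hom_pow hgr (k - m) hJ.
  have sub b : b \in bs -> b \in bs by [].
  elim: {1 3}bs sub j hj' {hj hv} => [|b s IHs] sub j /=.
    by move=> ->; rewrite hp0 // coef0 mul0r; exact: ideal0.
  move=> [c [y [hc sy ->]]]; rewrite (hpD hgr) coefD mulrDl; apply: idealD => //.
    have bsb : b \in bs by apply: sub; rewrite inE eqxx.
    have [vb|bv] := ltnP v b.2.
      by rewrite (hpMl_lt hgr _ (hbs bsb)) // mul0r; exact: ideal0.
    rewrite -(subnKC bv) (hpMl hgr _ _ (hbs bsb)).
    by apply: (h _ _ (v - b.2)%N) => //; [exact: hp_gr | exact: cP | rewrite subnKC].
  by apply: IHs => // b' b's; apply: sub; rewrite inE b's orbT.
have {}lin2 : lin [set` unzip2 bs] G2.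
  have [h|[K [b [c [hc h]]]]] := lin2; [by left | right].
  exists K, b, c; split => //; move: hc => /= /mapP[b' + ->].
  by rewrite mem_filter => /andP[_ hb]; exact: map_f.
apply: (lin_ext (K := 0%N) _ (lin_union IH lin2)) => k _; apply/seteqP; split => u.
  move=> [[y [Wy hy Ny]]|[y [hy hu Ny]]].
    by exists y; split => // Ny'; apply: Ny; exact: ext_sub.
  exists y; split => //; move: hy; rewrite /ext; case: leqP => [mk|_]; last exact: NW.
  move=> [a [j [/NW Wa hj ->]]]; apply: idealD => //.
  by rewrite -(subnK mk); exact: (compat_pow iW sW.1 hj).
move=> [y [Wy hy Ny]]; have [Ey|Ey] := pselect (ext N m x k y); [right|left].
  by exists y.
by exists y.
Qed.

Lemma colon_elt_hom_sub N k y u d r : hom gr (N k) -> gr u y -> prime_ideal (colon_elt (N k) y) ->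
  gr d r -> ~ N k (r * y) -> colon_elt (N k) y = colon_elt (N k) (r * y).
Proof.
move=> hN hy [_ _ pM] hr Nry; apply/seteqP; split => s; rewrite /colon_elt /= => hs.
  by rewrite mulrCA; apply: idealMl => //; case: hN.
by move: hs; rewrite mulrA => /pM[].
Qed.

(** Each step of the filtration adds at most one prime. If (N_k : y) changes when [N] is extended by
    [x], some multiple r y lies in the extension but not in [N]; by primality it has the same
    annihilator as [y], and that annihilator is (N_m : x). *)
Lemma finite_primes N : gfam N -> (forall n, N n `<=` W n) ->
  exists n (q : nat -> set R), forall k u y, W k y -> gr u y ->
    prime_ideal (colon_elt (N k) y) -> exists2 i, (i < n)%N & colon_elt (N k) y = q i.
Proof.
move: N; apply: prime_filtration => [N fN _ WN|N m e x fN NW Wx hx Nx prim [n [q IH]]].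
  exists 0%N, (fun=> set0) => k u y Wy _ [_ + _]; case.
  by rewrite /colon_elt /= mul1r; exact: WN.
have [hN cN] := fN; have iN k : ideal (N k) by have [] := hN k.
have [hE cE] := ext_gfam m fN hx.
exists n.+1, (fun i => if i == n then colon_elt (N m) x else q i) => k u y Wy hy pp.
have [pE|pE] := pselect (colon_elt (N k) y = colon_elt (ext N m x k) y).
  have [|i ni iE] := IH k u y Wy hy; first by rewrite -pE.
  by exists i; [exact: leqW | rewrite (ltn_eqF ni) pE].
exists n => //; rewrite eqxx.
have [d [r [hr Er Nr]]] : exists d r, [/\ gr d r, ext N m x k (r * y) & ~ N k (r * y)].
  apply: contrapT => h; apply: pE; apply/seteqP; split.
    by move=> r; rewrite /colon_elt /= => /ext_sub; exact.
  apply: (hom_le hgr); first exact: hom_colon_elt hy.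
    exact: colon_elt_ideal.
  by move=> d r hr Er; apply: contrapT => Nr; apply: h; exists d, r.
have [mk [j [v [a [uE hv hj Na yE]]]]] := ext_homog fN hx Er (grM hgr hr hy) Nr.
rewrite (colon_elt_hom_sub (hN k) hy pp hr Nr).
have Njx : ~ N k (j * x) by move=> h; apply: Nr; rewrite yE; exact: idealD.
(* Primality is applied to [s], placed in Rees degree 0, and [j]: since j x is not in [N], s j x
   lies in [N] exactly when s x does. *)
have key d' s : gr d' s -> N k (s * (r * y)) <-> N m (s * x).
  move=> hs; split => [h|h]; rewrite ?yE.
    have s0 : ideal_pow J 0 s by [].
    have := prim 0%N (k - m)%N d' v s j s0 hj hs hv.
    rewrite add0n addn0 subnKC // => h'; case: h' => //.
    rewrite -mulrA -[s * (j * x)](addKr (s * a)) -mulrDr -yE addrC.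
    by apply: idealB => //; exact: idealMl.
  rewrite mulrDr; apply: idealD => //; first exact: idealMl.
  by rewrite mulrCA -(subnK mk); exact: (compat_pow iN cN hj).
apply/seteqP; split; apply: (hom_le hgr).
- by apply: hom_colon_elt (hN k) (grM hgr hr hy).
- exact: colon_elt_ideal.
- by move=> d' s hs; rewrite /colon_elt /= => /(key _ _ hs).
- exact: hom_colon_elt (hN m) hx.
- exact: colon_elt_ideal.
- by move=> d' s hs; rewrite /colon_elt /= => /(key _ _ hs).
Qed.

End PrimeFiltration.

(** * v-numbers *)

Section VNumber.
Variables (R : comNzRingType) (gr : nat -> set R).
Hypothesis hgr : grading gr.
Implicit Types (I p : set R).

Definition local_degrees p I : set nat :=
  [set u | exists2 f, gr u f & p = colon_elt I f].

Definition v_degrees I : set nat :=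
  [set u | exists2 p, Ass I p & local_degrees p I u].

Lemma local_degrees_ex I p : hom gr I -> Ass I p -> exists u, local_degrees p I u.
Proof.
by move=> hI /(assoc_hom_elt hgr hI)[_ [d [f [hf pE]]]]; exists d, f.
Qed.

Lemma local_vP I p : hom gr I -> Ass I p -> minis (local_degrees p I) (local_v gr p I).
Proof. by move=> hI /(local_degrees_ex hI)[u hu]; exact: natminP hu. Qed.

(** A minimum of minima is one minimum over the witnesses of all primes; without associated primes
    both sides take the default value 0. *)
Lemma v_numberE I : hom gr I -> v_number gr I = natmin (v_degrees I).
Proof.
move=> hI; have [[p pI]|noA] := pselect (exists p, Ass I p); last first.
  rewrite /v_number (natmin_none (D := v_degrees I)) ?natmin_none // => u [p pI];
    by case: noA; exists p.
apply: natmin_eq; have [u hu] := local_degrees_ex hI pI.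
have [|[q qI hq] vmin] := @natminP (v_degrees I) u; first by exists p.
have [lq lmin] := local_vP hI qI.
split; last first.
  by move=> _ [q' q'I <-]; apply: vmin; exists q' => //; exact: (local_vP hI q'I).1.
exists q => //; apply/eqP; rewrite eqn_leq lmin //=.
by apply: vmin; exists q.
Qed.

End VNumber.

(** * Linearity of v-numbers for a stable family *)

Section Core.
Variables (R : idomainType) (gr : nat -> set R).
Hypotheses (hgr : grading gr) (hR : noetherian_ring R).
Implicit Types (I J p : set R) (F : nat -> set R).

(* Multiplication by z embeds the family (F_n : z) into F. *)
Lemma colon_elt_stable J F z : ideal J -> (forall n, ideal (F n)) -> stable J F -> z != 0 ->
  stable J (fun n => colon_elt (F n) z).
Proof.
move=> iJ iF sF z0; have [cF _] := sF.
have iW n : ideal (colon_elt (F n) z) by exact: colon_elt_ideal.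
split; first by move=> n x y Jx; rewrite /colon_elt /= -mulrA; exact: cF.
(* This is z (F_n : z), a submodule of [F]; its stability is divided by [z] afterwards. *)
pose U n := [set x | F n x /\ exists y, x = y * z].
have iU n : ideal (U n).
  apply: idealW => [|x y [Fx [a xE]] [Fy [b yE]]|a x [Fx [b xE]]].
  - by split; [exact: ideal0 | exists 0; rewrite mul0r].
  - by split; [exact: idealD | exists (a + b); rewrite mulrDl xE yE].
  - by split; [exact: idealMl | exists (a * b); rewrite xE mulrA].
have [|n x [] //|_ [K hK]] := stable_sub hR iF sF iU _ _ iJ.
  move=> n x y Jx [Fy [b yE]]; split; first exact: cF.
  by exists (x * b); rewrite yE mulrA.
exists K => n Kn x Fx.
have /(hK n Kn) : U n.+1 (x * z) by split => //; exists x.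
suff h : ideal_mul J (U n) `<=`
    [set t | exists2 y, ideal_mul J (colon_elt (F n) z) y & t = y * z].
  by move=> /h[y hy /(mulIf z0) ->].
have iM := mul_ideal J (colon_elt (F n) z).
apply: mul_min.
  apply: idealW => [|_ _ [a ha ->] [b hb ->]|a _ [b hb ->]].
  - by exists 0; [exact: (ideal0 iM) | rewrite mul0r].
  - by exists (a + b); [exact: (idealD iM) | rewrite mulrDl].
  - by exists (a * b); [exact: (idealMl _ iM) | rewrite mulrA].
move=> a t Ja [Ft [b tE]]; exists (a * b); last by rewrite tE mulrA.
by apply: mem_mul => //; rewrite /colon_elt /= -tE.
Qed.

Variable bs : seq (R * nat).
Hypothesis hbs : forall b, b \in bs -> gr b.2 b.1.
Let J : set R := ideal_gen [set` unzip1 bs].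
Variables (F : nat -> set R) (z : R) (dz : nat).
Hypotheses (hF : forall n, hom gr (F n)) (sF : stable J F).
Hypotheses (z0 : z != 0) (hz : gr dz z) (zF : forall n p, Ass (F n) p -> p z).

Let W n := colon_elt (F n) z.

Let hJ : hom gr J. Proof. by apply: hom_gen => // x /mapP[b /hbs hb ->]; exists b.2. Qed.

Let iF n : ideal (F n). Proof. by have [] := hF n. Qed.

Let hW n : hom gr (W n). Proof. exact: hom_colon_elt hz. Qed.

Let sW : stable J W. Proof. by apply: colon_elt_stable => //; exact: ideal_genP. Qed.

(** For a homogeneous f in (F_n : p) the annihilator contains [p], and it is strictly larger exactly
    when f lies here. A homogeneous [s] suffices because annihilators of homogeneous elements are
    homogeneous. *)
Definition torsion p n : set R :=
  [set f | colon (F n) p f /\ exists d s, [/\ gr d s, ~ p s & F n (s * f)]].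

(** If [p] is associated to some [F n], then [z] is in [p], the family (F_n : p) is a stable
    submodule of [W], and the witnesses of [p] are its homogeneous elements outside [torsion].
    Otherwise all the sets are empty. *)
Lemma local_lin p : lin [set` unzip2 bs] (fun n => [set u | Ass (F n) p /\ local_degrees gr p (F n) u]).
Proof.
have [[n0 pA]|noA] := pselect (exists n, Ass (F n) p); last first.
  by apply: lin_none => k u [pA _]; apply: noA; exists k.
have pz := zF pA; have [hp _] := assoc_hom_elt hgr (hF n0) pA.
have [pp _] := pA; have [ip p1 pM] := pp.
pose V n := colon (F n) p.
have hV n : hom gr (V n) by exact: hom_colon.
have iV n : ideal (V n) by have [] := hV n.
have cV : compat J V.
  by move=> n x y Jx hy t pt; rewrite -mulrA; apply: sF.1 => //; exact: hy.
have sV : stable J V.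
  apply: (stable_sub hR _ sW iV cV); [by move=> n; have [] := hW n | | exact: ideal_genP].
  by move=> n y hy; exact: hy.
have fZ : gfam gr bs (torsion p).
  split; last first.
    move=> n x y Jx [hy [d [s [hs ps Fsy]]]]; split; first exact: cV.
    by exists d, s; split => //; rewrite mulrCA; exact: sF.1.
  move=> n; split; first apply: idealW.
  - split; first exact: (ideal0 (iV n)).
    by exists 0%N, 1; split => //; [exact: gr1 | rewrite mulr0; exact: ideal0].
  - move=> x y [hx [d [s [hs ps Fsx]]]] [hy [e [t [ht pt Fty]]]].
    split; first exact: (idealD (iV n)).
    exists (d + e)%N, (s * t); split; [exact: grM | by move=> /pM[] |].
    rewrite mulrDr; apply: idealD => //.
      by rewrite mulrAC; exact: idealMr.
    by rewrite -mulrA; exact: idealMl.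
  - move=> a x [hx [d [s [hs ps Fsx]]]]; split; first exact: (idealMl _ (iV n)).
    by exists d, s; split => //; rewrite mulrCA; exact: idealMl.
  - move=> x e [hx [d [s [hs ps Fsx]]]]; split; first by have [_ h] := hV n; exact: h.
    exists d, s; split => //; rewrite -(hpMl hgr _ _ hs).
    by have [_ h] := hF n; exact: h.
have h := init_degree_lin hgr hR hbs hV sV fZ _.
apply: (lin_ext (K := 0%N) _ (h _)) => [n _|n x []//].
apply/seteqP; split => u /=.
  move=> [f [Vf hf Zf]]; have pE : p = colon_elt (F n) f.
    apply/seteqP; split; first by move=> r pr; rewrite /colon_elt /= mulrC; exact: Vf.
    apply: (hom_le hgr) => //; first exact: hom_colon_elt hf.
    move=> d r hr Frf; apply: contrapT => npr; apply: Zf; split => //.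
    by exists d, r.
  by split; [split => //; exists f | exists f].
move=> [_ [f hf pE]]; exists f; split => //.
  by move=> r pr; rewrite mulrC; move: pr; rewrite {1}pE.
by move=> [_ [d [s [_ ps Fsf]]]]; apply: ps; rewrite pE.
Qed.

(** Only finitely many primes occur over all n together, so these sets are finite unions of the sets
    for single primes. *)
Lemma v_lin : lin [set` unzip2 bs] (fun n => v_degrees gr (F n)).
Proof.
have [||n [q hq]] := finite_primes hgr hR hbs hW sW (N := F).
- by split => //; exact: sF.1.
- by move=> n x Fx; exact: idealMr.
have h := @lin_bigcup [set` unzip2 bs] n
  (fun i k => [set u | Ass (F k) (q i) /\ local_degrees gr (q i) (F k) u])
  (fun i _ => local_lin (q i)).
apply: (lin_ext (K := 0%N) _ h) => k _; apply/seteqP; split => u.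
  by move=> [i _ [qA hu]]; exists (q i).
move=> [p pA [f hf pE]]; have [pp _] := pA.
have [||i ni pi] := hq k u f _ hf; last 1 first.
- exists i => //; rewrite -pi -pE; split => //.
  by exists f.
- by rewrite /W /colon_elt /= mulrC; have := zF pA; rewrite pE.
- by rewrite -pE.
Qed.

End Core.

(** * Integral closures of powers *)

Lemma near_geq (P : nat -> Prop) N : (forall n, (N <= n)%N -> P n) ->
  \forall n \near \oo, P n.
Proof. by move=> h; exists N => // n /= /h. Qed.

Lemma near_ex (P : nat -> Prop) : (\forall n \near \oo, P n) ->
  exists N, forall n, (N <= n)%N -> P n.
Proof. by move=> [N _ hN]; exists N => n /hN. Qed.

Lemma lin_eventually_linear S (G : nat -> set nat) N : lin S G ->
  (forall n, (N <= n)%N -> exists u, G n u) ->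
  exists2 c, S c & eventually_linear (fun n => natmin (G n)) c.
Proof.
move=> [[K h] ne|[K [b [c [Sc h]]]] _].
  by have [u /h] := ne (maxn K N) (leq_maxr _ _); case; exact: leq_maxl.
exists c => //; exists (b%:Z - (c * K)%N%:Z).
apply: (@near_geq _ K) => n Kn; have := h (n - K)%N; rewrite subnKC // => /natmin_eq ->.
by have : (c * K <= c * n)%N by [rewrite leq_mul2l Kn orbT]; rewrite mulnBr; lia.
Qed.

Lemma eventually_linear_ext (f g : nat -> nat) c N : (forall n, (N <= n)%N -> f n = g n) ->
  eventually_linear f c -> eventually_linear g c.
Proof.
move=> fg [b /near_ex[M hM]]; exists b; apply: (@near_geq _ (maxn N M)) => n.
by rewrite geq_max => /andP[/fg <- /hM].
Qed.

Section IntegralClosure.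
Variables (R : idomainType).
Hypothesis hR : noetherian_ring R.
Implicit Types (I J : set R).

(** The equation expresses every x^m through powers of exponent below n, losing at most n - 1
    factors from [J]; the multiplier a0^(n-1) restores them. *)
Lemma integral_closure_asymp J x a0 : J a0 -> a0 != 0 -> integral_closure J x ->
  exists2 c, c != 0 & forall m, ideal_pow J m (c * x ^+ m).
Proof.
move=> Ja a00 [n [a [n0 ha /eqP]]]; rewrite addr_eq0 => /eqP xn.
have key m : ideal_pow J (m - n.-1) (x ^+ m).
  elim/ltn_ind: m => m IH; have [mn|nm] := ltnP m n.
    by have -> : (m - n.-1 = 0)%N by lia.
  rewrite -(subnK nm) exprD xn mulrN -mulNr mulr_sumr big_nat_cond.
  apply: ideal_sum; first exact: pow_ideal.
  move=> i; rewrite andbT ltnS => /andP[i1 i_n]; rewrite mulrCA mulNr -exprD.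
  apply: (@pow_anti _ _ _ (i + ((m - i) - n.-1))%N); first by lia.
  apply: mem_powD; first by apply: ha; rewrite i1.
  apply: idealN; first exact: pow_ideal.
  have -> : (m - n + (n - i) = m - i)%N by lia.
  by apply: IH; lia.
exists (a0 ^+ n.-1) => [|m]; first exact: expf_neq0.
apply: (@pow_anti _ _ _ (n.-1 + (m - n.-1))%N); first by lia.
by apply: mem_powD => //; exact: mem_pow_exp.
Qed.

(* The Rees algebra of J is noetherian, so a fractional ideal of the form
   c J[x t] is finitely generated, which makes x t integral over it. *)
Lemma asymp_integral_closure J x c : ideal J -> c != 0 ->
  (forall m, ideal_pow J m (c * x ^+ m)) -> integral_closure J x.
Proof.
move=> iJ c0 hc.
pose C (m : nat -> nat) N := [set y | exists j : nat -> R,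
  (forall i, (i <= N)%N -> ideal_pow J (m i) (j i)) /\ y = c * \sum_(i < N.+1) j i * x ^+ i].
have iC m N : ideal (C m N).
  apply: idealW => [|_ _ [j [hj ->]] [k [hk ->]]|a _ [j [hj ->]]].
  - exists (fun=> 0); split => [i _|]; first exact: (ideal0 (pow_ideal _ _)).
    by rewrite big1 ?mulr0 // => i _; rewrite mul0r.
  - exists (fun i => j i + k i); split => [i iN|].
      by apply: (idealD (pow_ideal _ _)); [exact: hj | exact: hk].
    by rewrite -mulrDr -big_split; congr (_ * _); apply: eq_bigr => i _; rewrite mulrDl.
  - exists (fun i => a * j i); split => [i iN|]; first exact: (idealMl _ (pow_ideal _ _) (hj i iN)).
    by rewrite mulrCA mulr_sumr; congr (_ * _); apply: eq_bigr => i _; rewrite mulrA.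
(* The component of degree k in t of c R[J t, x t]; the hypothesis on [c] places it inside J^k. *)
pose U k := C (fun i => (k - i)%N) k.
have sub k : U k `<=` ideal_pow J k.
  move=> _ [j [hj ->]]; rewrite mulr_sumr; apply: ideal_sum; first exact: pow_ideal.
  move=> i _; have ik : (i <= k)%N by rewrite -ltnS.
  by rewrite mulrCA -{1}(subnK ik); apply: mem_powD => //; exact: hj.
have step k y z : J y -> U k z -> C (fun i => (k.+1 - i)%N) k (y * z).
  move=> Jy [j [hj ->]]; exists (fun i => y * j i); split => [i ik|].
    by rewrite subSn //; apply: mem_mul => //; exact: hj.
  by rewrite mulrCA mulr_sumr; congr (_ * _); apply: eq_bigr => i _; rewrite mulrA.
have cU : compat J U.
  move=> k y z Jy Uz; have [j [hj ->]] := step k y z Jy Uz.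
  exists (fun i => if (i <= k)%N then j i else 0); split => [i _|].
    by case: leqP => [ik|_]; [exact: hj | exact: (ideal0 (pow_ideal _ _))].
  rewrite [in RHS]big_ord_recr /= ltnn mul0r addr0; congr (_ * _).
  by apply: eq_bigr => i _; rewrite -ltnS ltn_ord.
have [_ [K hK]] := stable_sub hR (pow_ideal J) (pow_stable J) (fun k => iC _ k) cU sub iJ.
have : U K.+1 (c * x ^+ K.+1).
  exists (fun i => if i == K.+1 then 1 else 0); split => [i iK|].
    by case: eqP => [->|_]; [rewrite subnn | exact: (ideal0 (pow_ideal _ _))].
  rewrite (bigD1 ord_max) //= eqxx mul1r big1 ?addr0 // => i /negbTE.
  by rewrite -val_eqE /= => ->; rewrite mul0r.
(* Stability puts c x^(K+1) into J U_K. Cancelling [c] writes x^(K+1) through lower powers x^i with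
   coefficients in J^(K+1-i): an equation of integral dependence. *)
move=> /(hK K (leqnn K)) /(mul_min (iC (fun i => (K.+1 - i)%N) K) (step K)).
move=> [j [hj /(mulfI c0) xE]].
exists K.+1, (fun i => - j (K.+1 - i)%N); split => //.
  move=> i /andP[i1 iK]; apply: (idealN (pow_ideal _ _)).
  have := hj (K.+1 - i)%N; rewrite subKn //; apply; lia.
rewrite xE big_add1 -(big_mkord xpredT (fun i => j i * x ^+ i)) big_nat_rev /=.
rewrite -big_split /= big_nat_cond big1 // => i; rewrite andbT => /andP[_ iK].
by rewrite add0n mulNr subrr.
Qed.

Section Powers.
Variables (gr : nat -> set R) (I : set R) (a0 : R).
Hypotheses (hgr : grading gr) (hI : hom gr I) (Ia : I a0) (a00 : a0 != 0).

Let F n := integral_closure (ideal_pow I n).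

(** Unlike an equation of integral dependence, this asymptotic criterion visibly passes to multiples
    and, with the product of the two multipliers, to sums. *)
Lemma integral_powP n x : F n x <->
  exists2 c, c != 0 & forall k, ideal_pow I (n * k) (c * x ^+ k).
Proof.
split=> [hx|[c c0 hc]].
  have h := integral_closure_asymp (mem_pow_exp n Ia) (expf_neq0 n a00) hx.
  by have [c c0 hc] := h; exists c => // k; rewrite -pow_pow.
apply: (asymp_integral_closure (c := c)) => //; first exact: pow_ideal.
by move=> k; rewrite pow_pow.
Qed.

Lemma integral_pow_ideal n : ideal (F n).
Proof.
apply: idealW.
- apply/integral_powP; exists a0 => // -[|k]; first by rewrite muln0.
  by rewrite expr0n mulr0; apply: ideal0; exact: pow_ideal.
- move=> x y /integral_powP[c c0 hc] /integral_powP[d d0 hd].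
  apply/integral_powP; exists (c * d); first exact: mulf_neq0.
  move=> k; rewrite exprDn mulr_sumr; apply: ideal_sum; first exact: pow_ideal.
  move=> i _; rewrite mulrnAr -mulr_natl; apply: idealMl; first exact: pow_ideal.
  have ik : (i <= k)%N by rewrite -ltnS.
  by rewrite mulrACA -{1}(subnK ik) mulnDr; exact: mem_powD.
- move=> a x /integral_powP[c c0 hc]; apply/integral_powP; exists c => // k.
  by rewrite exprMn mulrCA; apply: idealMl; [exact: pow_ideal | exact: hc].
Qed.

Lemma integral_pow_compat : compat I F.
Proof.
move=> n y x Iy /integral_powP[c c0 hc]; apply/integral_powP; exists c => // k.
by rewrite exprMn mulrCA mulSn; apply: mem_powD => //; exact: mem_pow_exp.
Qed.

Lemma pow_sub_integral n : ideal_pow I n `<=` F n.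
Proof.
move=> x hx; apply/integral_powP; exists 1; first exact: oner_neq0.
by move=> k; rewrite mul1r -pow_pow; exact: mem_pow_exp.
Qed.

(* The leading component of c x^k is the product of those of c and x^k, so the
   asymptotic criterion passes to leading components. *)
Lemma integral_pow_hom n : hom gr (F n).
Proof.
have iF := integral_pow_ideal n; split => // x.
suff h N : forall x, (size (hp gr x) <= N)%N -> F n x -> forall d, F n (hp gr x)`_d.
  by move=> d Fx; exact: h (leqnn _) Fx d.
elim: N => [|N IH] {}x sx Fx d.
  by rewrite nth_default; [exact: ideal0 | exact: leq_trans sx _].
have [sx'|Nx] := leqP (size (hp gr x)) N; first exact: IH.
have sE : size (hp gr x) = N.+1 by apply/eqP; rewrite eqn_leq sx Nx.
pose t := (hp gr x)`_N; have tN : gr N t by exact: hp_gr.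
have Ft : F n t.
  have /integral_powP[c c0 hc] := Fx; apply/integral_powP.
  exists (lead_coef (hp gr c)).
    by rewrite lead_coef_eq0; apply: contra_neq c0; exact: (hp_inj hgr).
  move=> k; have -> : t = lead_coef (hp gr x) by rewrite lead_coefE sE.
  rewrite -lead_coef_exp -lead_coefM -(hpX hgr) -(hpM hgr) lead_coefE.
  by have [_ h] := hom_pow hgr (n * k) hI; exact: h.
have -> : (hp gr x)`_d = (hp gr (x - t))`_d + (hp gr t)`_d.
  by rewrite -coefD -(hpD hgr) subrK.
apply: idealD => //; last first.
  by rewrite (hp_homE hgr _ tN); case: ifP => // _; exact: ideal0.
apply: IH; last exact: idealB.
apply/leq_sizeP => i Ni; rewrite (hpB hgr) coefB (hp_homE hgr _ tN).
case: eqP => [->|/eqP iN]; first by rewrite subrr.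
by rewrite nth_default ?subrr // sE ltn_neqAle eq_sym iN.
Qed.

End Powers.
End IntegralClosure.

(** * Eventual linearity for integral closures of powers *)

Section PartOne.
Variables (R : idomainType) (gr : nat -> set R).
Hypotheses (hgr : grading gr) (hR : noetherian_ring R).

Theorem v_integral_closure (I : set R) (l : nat) (a : 'I_l -> R) (d : 'I_l -> nat) :
  (forall i, gr (d i) (a i)) -> I = ideal_gen (range a) -> I <> [set 0] ->
  let F := fun n => integral_closure (ideal_pow I n) in
  fg_module_over (rees (ideal_pow I)) (rees F) ->
  (forall p, stable_Ass F p ->
     exists i, eventually_linear (fun n => local_v gr p (F n)) (d i)) /\
  (exists i, eventually_linear (fun n => v_number gr (F n)) (d i)).
Proof.
move=> hd IE I0 F [s sE]; pose bs := [seq (a i, d i) | i <- enum 'I_l].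
have hbs b : b \in bs -> gr b.2 b.1 by move=> /mapP[i _ ->]; exact: hd.
have JE : I = ideal_gen [set` unzip1 bs].
  rewrite IE; congr ideal_gen; apply/seteqP; split => x /=.
    move=> [i _ <-]; rewrite /unzip1 -map_comp; apply/mapP; exists i => //.
    exact: mem_enum.
  by rewrite /unzip1 -map_comp => /mapP[i _ ->]; exists i.
have hI : hom gr I by rewrite JE; apply: hom_gen => // x /mapP[b /hbs hb ->]; exists b.2.
have [iI _] := hI.
have [i0 ai0] : exists i, a i != 0.
  apply: contrapT => h; apply: I0; apply/seteqP; split; last first.
    by move=> _ ->; exact: ideal0.
  rewrite IE; apply: gen_min; first exact: ideal_zero.
  move=> _ [i _ <-] /=; apply/eqP; apply: contrapT => /negP ai; apply: h.
  by exists i.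
have Ia : I (a i0) by rewrite IE; apply: gen_sub; exists i0.
have hF n : hom gr (F n) by exact: (integral_pow_hom hR hgr hI Ia ai0).
have iF n : ideal (F n) by have [] := hF n.
have cF : compat I F by exact: (integral_pow_compat hR Ia ai0).
have sF : stable I F.
  split => //; apply: (rees_fg_stable iF cF (s := s)).
    by move=> g gs; rewrite sE => M [_]; exact.
  by move=> M hM sM q; rewrite sE; apply; split.
(* A nonzero generator serves as [z]: its n-th power lies in I^n, hence in F_n and in the prime. *)
have zF n p : Ass (F n) p -> p (a i0).
  move=> [pp [x pE]]; apply: (prime_exp (n := n) pp); rewrite pE.
  apply: idealMr => //; apply: (pow_sub_integral hR Ia ai0); exact: mem_pow_exp.
rewrite JE in sF.
have slope c : [set` unzip2 bs] c -> exists i, c = d i.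
  by rewrite /= /unzip2 -map_comp => /mapP[i _ ->]; exists i.
split=> [p /near_ex[N hN]|].
  have := lin_eventually_linear (local_lin hgr hR hbs hF sF ai0 (hd i0) zF p) (N := N).
  case=> [n Nn|c /slope[i ->]].
    by have [u hu] := local_degrees_ex hgr (hF n) (hN n Nn); exists u; split => //; exact: hN.
  move=> h; exists i; apply: (eventually_linear_ext (N := N)) h => n Nn.
  congr natmin; apply/seteqP; split => u; first by case.
  by move=> hu; split => //; exact: hN.
have hv := v_lin hgr hR hbs hF sF ai0 (hd i0) zF.
(* For the unit ideal the v-number is constantly 0 by convention, so 0 has to occur among the
   degrees: otherwise 1 would have no component of degree 0. *)
have [I1|I1] := pselect (I 1).
  have [i di] : exists i, d i = 0%N.
    apply: contrapT => h; have : [set x | (hp gr x)`_0 = 0] 1.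
      move: I1; rewrite IE; apply: gen_min.
        apply: idealW => /= [|x y hx hy|x y hy]; first by rewrite hp0 // coef0.
          by rewrite (hpD hgr) coefD hx hy addr0.
        by rewrite (hpM hgr) coef0M hy mulr0.
      move=> _ [i _ <-] /=; rewrite (hp_homE hgr _ (hd i)); case: eqP => // di.
      by case: h; exists i.
    by rewrite /= (hp_homE hgr _ (gr1 hgr)) /= => /eqP; rewrite oner_eq0.
  exists i, 0; apply: (@near_geq _ 0%N) => n _; rewrite di mul0n.
  rewrite (v_numberE hgr (hF n)) natmin_none // => u [p [[ip p1 _] [x pE]] _]; apply: p1; rewrite pE.
  apply: idealMr => //; apply: (pow_sub_integral hR Ia ai0).
  by rewrite -(expr1n R n); exact: mem_pow_exp.
(* F_0 is the whole ring, hence the start at 1. For n >= 1 the ideal F_n is proper, since an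
   equation of integral dependence for 1 over I^n puts 1 into [I]. *)
have [n n1|c /slope[i ->] h] := lin_eventually_linear hv (N := 1%N).
  have [F1|F1] := pselect (F n 1).
    case: I1; have [N [b [N0 hb /eqP]]] := F1.
    rewrite expr1n addr_eq0 => /eqP ->; apply: idealN => //.
    rewrite big_nat_cond; apply: ideal_sum => // k; rewrite andbT ltnS => kN.
    apply: idealMr => //; rewrite -[I](pow1 iI).
    apply: (@pow_anti _ _ 1 (n * k)%N); last by rewrite -pow_pow; exact: hb.
    by rewrite muln_gt0 n1; case/andP: kN.
  have [p pA] := prime_ass_exists hR (iF n) F1.
  by have [u hu] := local_degrees_ex hgr (hF n) pA; exists u, p.
exists i; apply: (eventually_linear_ext (N := 0%N)) h => n _.
by rewrite v_numberE.
Qed.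

End PartOne.

(** * Noetherian filtrations *)

Lemma lin_natmin S (G : nat -> set nat) : lin S G ->
  exists K b c, forall k, natmin (G (K + k)%N) = (b + c * k)%N.
Proof.
move=> [[K h]|[K [b [c [_ h]]]]].
  exists K, 0%N, 0%N => k; rewrite mul0n; apply: natmin_none; apply: h.
  exact: leq_addr.
by exists K, b, c => k; exact: natmin_eq.
Qed.

Lemma quasi_linear_classes (f : nat -> nat) e : (0 < e)%N ->
  (forall i, (i < e)%N -> exists K b c, forall k, f (i + e * (K + k))%N = (b + c * k)%N) ->
  quasi_linear f.
Proof.
move=> e0 hf.
have {hf} hf i : exists Kbc : nat * nat * nat, (i < e)%N ->
    forall k, f (i + e * (Kbc.1.1 + k))%N = (Kbc.1.2 + Kbc.2 * k)%N.
  have [/hf[K [b [c h]]]|_] := ltnP i e; last by exists (0%N, 0%N, 0%N).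
  by exists (K, b, c).
have [g hg] := choice hf.
pose K i := (g i).1.1; pose b i := (g i).1.2; pose c i := (g i).2.
(* Solving n = i + e (K + k) for k turns b + c k into a polynomial in n of slope c / e. *)
pose P i : {poly rat} := ((c i)%:R / e%:R)%:P * 'X +
  ((b i)%:R - (c i)%:R * (K i)%:R - (c i)%:R * i%:R / e%:R)%:P.
exists e, P; split => // [i _|].
  rewrite size_MXaddC; case: ifP => // _.
  by rewrite ltnS size_polyC leq_b1.
apply: (@near_geq _ (e * \max_(i < e) K i)%N) => n hn.
have ie : (n %% e < e)%N by rewrite ltn_mod.
have Kn : (K (n %% e) <= n %/ e)%N.
  have := leq_bigmax (F := fun i : 'I_e => K i) (Ordinal ie); rewrite /= => h.
  by rewrite leq_divRL // mulnC; apply: leq_trans hn; rewrite leq_mul2l h orbT.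
have nE : n = (n %% e + e * (K (n %% e) + (n %/ e - K (n %% e))))%N.
  by rewrite subnKC // mulnC addnC -divn_eq.
have e_neq0 : e%:R != 0 :> rat by rewrite pnatr_eq0 -lt0n.
rewrite {1}nE (hg _ ie) -/(K _) -/(b _) -/(c _) /P hornerD hornerM hornerX !hornerC.
rewrite natrD natrM natrB //.
have nE' : n%:R = (n %% e)%:R + e%:R * (n %/ e)%:R :> rat.
  by rewrite -natrM -natrD mulnC addnC -divn_eq.
by rewrite nE'; field.
Qed.

(** * Weighted monomials and the Veronese property *)

Section Filtration.
Variable R : comNzRingType.
Implicit Types (F : nat -> set R).

Lemma filtrationM F m n x y : filtration F -> F m x -> F n y -> F (m + n)%N (x * y).
Proof. by move=> [_ _ hM _] Fx Fy; apply: hM; exact: mem_mul. Qed.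

Lemma filtrationX F m n x : filtration F -> F m x -> F (m * n)%N (x ^+ n).
Proof.
move=> fF Fx; elim: n => [|n IH]; first by rewrite muln0; have [_ -> _ _] := fF.
by rewrite exprS mulnS; exact: filtrationM.
Qed.

Lemma filtration_pow F m n : filtration F -> ideal_pow (F m) n `<=` F (m * n)%N.
Proof.
move=> fF; have [iF F0 _ _] := fF.
elim: n => [|n IH]; first by rewrite muln0 F0.
rewrite mulnS; apply: mul_min => // x y Fx /IH Fy; exact: filtrationM.
Qed.

(** The weight [w.2] is the index of the generator [w.1] in the filtration, not its degree in R. *)
Fixpoint monomials (ws : seq (R * nat)) (n : nat) : set R :=
  if ws is w :: ws' then
    [set x | exists i k y, [/\ monomials ws' k y, n = (w.2 * i + k)%N & x = w.1 ^+ i * y]]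
  else [set x | n = 0%N /\ x = 1].

Lemma monomials1 ws : monomials ws 0 1.
Proof.
elim: ws => //= w ws IH; exists 0%N, 0%N, 1; split => //.
  by rewrite muln0.
by rewrite mulr1.
Qed.

Lemma monomialsM ws m n x y : monomials ws m x -> monomials ws n y ->
  monomials ws (m + n) (x * y).
Proof.
elim: ws m n x y => [|w ws IH] m n x y /=; first by move=> [-> ->] [-> ->]; rewrite mulr1.
move=> [i [k [z [hz -> ->]]]] [j [l [t [ht -> ->]]]].
exists (i + j)%N, (k + l)%N, (z * t); split; [exact: IH | by rewrite mulnDr addnACA |].
by rewrite exprD mulrACA.
Qed.

Lemma monomials_mem ws w : w \in ws -> monomials ws w.2 w.1.
Proof.
elim: ws => //= v ws IH; rewrite inE => /orP[/eqP ->|/IH h].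
  by exists 1%N, 0%N, 1; split; [exact: monomials1 | rewrite muln1 addn0 | rewrite mulr1].
by exists 0%N, w.2, w.1; split => //; [rewrite muln0 | rewrite mul1r].
Qed.

Lemma monomials_sub F ws n : filtration F -> (forall w, w \in ws -> F w.2 w.1) ->
  monomials ws n `<=` F n.
Proof.
move=> fF; have [_ F0 _ _] := fF.
elim: ws n => [|w ws IH] n hws x /=; first by move=> [-> ->]; rewrite F0.
move=> [i [k [y [/IH hy -> ->]]]]; apply: filtrationM => //.
  by apply: filtrationX => //; apply: hws; rewrite inE eqxx.
by apply: hy => v hv; apply: hws; rewrite inE hv orbT.
Qed.

(* A monomial of large weight is divisible by a power w^(e/w.2) of one of the
   generators, which has weight exactly e. *)
Lemma monomials_split F ws e n : filtration F -> (0 < e)%N ->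
  (forall w, w \in ws -> [/\ F w.2 w.1, (0 < w.2)%N & (w.2 %| e)%N]) ->
  (size ws * e <= n)%N -> monomials ws (n + e) `<=` ideal_mul (F e) (F n).
Proof.
move=> fF e0; elim: ws n => [|w ws IH] n hws hn x /=.
  by move=> []; rewrite -(prednK e0) addnS.
have [Fw w0 /dvdnP[q eE]] := hws w (mem_head _ _).
have hws' v : v \in ws -> [/\ F v.2 v.1, (0 < v.2)%N & (v.2 %| e)%N].
  by move=> hv; apply: hws; rewrite inE hv orbT.
have subF := monomials_sub fF (fun v hv => let: And3 h _ _ := hws' v hv in h).
move=> [i [k [y [hy neE ->]]]].
have [qi|iq] := leqP q i.
  rewrite -(subnKC qi) exprD -mulrA; apply: mem_mul.
    by rewrite eE mulnC; exact: filtrationX.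
  have -> : n = (w.2 * (i - q) + k)%N.
    by move: neE; rewrite eE -{1}(subnKC qi) mulnDr [(q * _)%N]mulnC addnC -addnA => /addnI.
  apply: filtrationM => //; first exact: filtrationX.
  exact: subF.
(* With exponent below q the factor w^i weighs at most e; removing it leaves enough weight for the
   remaining generators. *)
have wi : (w.2 * i <= n)%N.
  have : (w.2 * i <= e)%N by rewrite eE [(q * _)%N]mulnC leq_mul2l ltnW ?orbT.
  by move: hn => /=; rewrite mulSn; lia.
have kE : k = ((n - w.2 * i) + e)%N by rewrite addnBAC // neE addKn.
have hn' : (size ws * e <= n - w.2 * i)%N.
  have : (w.2 * i <= e)%N by rewrite eE [(q * _)%N]mulnC leq_mul2l ltnW ?orbT.
  by move: hn => /=; rewrite mulSn; lia.
rewrite kE in hy; have := IH _ hws' hn' _ hy.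
move: {hy neE} y; apply: mul_min.
  have iM := mul_ideal (F e) (F n); apply: idealW.
  - by rewrite mulr0; exact: (ideal0 iM).
  - by move=> a b ha hb; rewrite mulrDr; exact: (idealD iM).
  - by move=> a b hb; rewrite mulrCA; exact: (idealMl _ iM).
move=> a b Fa Fb; rewrite mulrCA; apply: mem_mul => //.
by rewrite -(subnKC wi); apply: filtrationM => //; exact: filtrationX.
Qed.

(** The coefficients of positive index of finitely many algebra generators still generate the Rees
    algebra over R. With [e] the product of their indices, every index divides [e], as the splitting
    of monomials demands. *)
Lemma veronese_stable F : noetherian_filtration F ->
  exists e K, (0 < e)%N /\ forall n, (K <= n)%N -> F (n + e)%N `<=` ideal_mul (F e) (F n).
Proof.
move=> [fF [s sE]]; have [iF F0 _ _] := fF.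
have sF g n : g \in s -> F n g`_n.
  move=> gs; suff : rees F g by apply.
  by rewrite sE => M [_]; exact.
pose ws := flatten [seq [seq (g`_i.+1, i.+1) | i <- iota 0 (size g)] | g : {poly R} <- s].
have wsP w : w \in ws -> exists2 g : {poly R}, g \in s & exists i, w = (g`_i.+1, i.+1).
  by move=> /flattenP[_ /mapP[g gs ->] /mapP[i _ ->]]; exists g => //; exists i.
pose e := (\prod_(w <- ws) w.2)%N.
have hws w : w \in ws -> [/\ F w.2 w.1, (0 < w.2)%N & (w.2 %| e)%N].
  move=> hw; have [g gs [i wE]] := wsP w hw; rewrite /e (big_rem w) //= dvdn_mulr //.
  by rewrite wE; split => //; exact: sF.
have e0 : (0 < e)%N.
  by rewrite /e big_seq; apply: prodn_cond_gt0 => w /hws[].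
exists e, (size ws * e)%N; split => // n hn x Fx.
(* A subalgebra containing the generators, hence the whole Rees algebra. *)
pose S := [set q : {poly R} | forall k, ideal_gen (monomials ws k) q`_k].
have iG k := ideal_genP (monomials ws k).
have gM k l a b : ideal_gen (monomials ws k) a -> ideal_gen (monomials ws l) b ->
    ideal_gen (monomials ws (k + l)) (a * b).
  move=> ha hb; have iC := colon_ideal [set b] (iG (k + l)%N).
  suff : colon (ideal_gen (monomials ws (k + l))) [set b] a by apply.
  move: a ha; apply: gen_min => // a ha _ ->.
  have iC' := colon_ideal [set a] (iG (k + l)%N).
  suff : colon (ideal_gen (monomials ws (k + l))) [set a] b by rewrite mulrC; apply.
  move: b hb {iC}; apply: gen_min => // b hb _ ->; rewrite mulrC.
  by apply: gen_sub; exact: monomialsM.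
have : rees F (x%:P * 'X^(n + e)) by exact: rees_mon.
rewrite sE => hq; suff /hq : subalgebra S /\ [set` s] `<=` S.
  move=> /(_ (n + e)%N); rewrite coefMXn ltnn subnn coefC /=.
  move: {Fx hq} x; apply: gen_min; first exact: mul_ideal.
  exact: monomials_split.
split.
    split => [c k|q r hp hr k|q r hp hr k].
    - rewrite coefC; case: eqP => [->|_]; last exact: (ideal0 (iG _)).
      by rewrite -[c]mulr1; apply: (idealMl _ (iG _)); apply: gen_sub; exact: monomials1.
    - by rewrite coefD; apply: (idealD (iG _)).
    - rewrite coefM; apply: (ideal_sum _ (iG _)) => i _.
      by have ik : (i <= k)%N; [rewrite -ltnS | rewrite -{1}(subnKC ik); exact: gM].
  move=> g /= gs [|k].
    rewrite -[g`_0]mulr1; apply: (idealMl _ (iG _)); apply: gen_sub; exact: monomials1.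
  have [kg|gk] := ltnP k (size g); last first.
    by rewrite nth_default ?leqW //; exact: (ideal0 (iG _)).
  apply: gen_sub; have : (g`_k.+1, k.+1) \in ws; last exact: monomials_mem.
  apply/flattenP; exists [seq (g`_i.+1, i.+1) | i <- iota 0 (size g)]; first exact: map_f.
  by apply/mapP; exists k => //; rewrite mem_iota.
Qed.

End Filtration.

(** * Quasi-linearity along residue classes *)

Section PartTwoA.
Variables (R : idomainType) (gr : nat -> set R).
Hypotheses (hgr : grading gr) (hR : noetherian_ring R).
Variable F : nat -> set R.
Hypotheses (fF : filtration F) (hF : forall n, hom gr (F n)).

(** On the class of [i] modulo [e] the filtration is a stable family over J = F_e, and one
    homogeneous [z] in F_1 serves all its members, since z^n lies in F_n. *)
Lemma veronese_lin e K z dz i : (0 < e)%N ->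
  (forall k, (K <= k)%N -> F (i + e * k.+1)%N `<=` ideal_mul (F e) (F (i + e * k)%N)) ->
  F 1%N z -> z != 0 -> gr dz z ->
  (forall p, exists K b c, forall k,
     natmin [set u | Ass (F (i + e * (K + k))) p /\
                     local_degrees gr p (F (i + e * (K + k))) u] = (b + c * k)%N) /\
  exists K b c, forall k, natmin (v_degrees gr (F (i + e * (K + k)))) = (b + c * k)%N.
Proof.
move=> e0 hK Fz z0 hz; have [iF F0 _ _] := fF.
have [bs [hbs JE]] := hom_fin_gen hgr hR (hF e).
have hbs' b : b \in bs -> gr b.2 b.1 by move=> /hbs[].
pose G k := F (i + e * k)%N.
have hG k : hom gr (G k) by exact: hF.
have sG : stable (ideal_gen [set` unzip1 bs]) G.
  rewrite -JE; split.
    by move=> n x y Fx Fy; rewrite /G mulnS addnCA; exact: filtrationM.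
  by exists K.
have zG k p : Ass (G k) p -> p z.
  move=> [pp [x pE]]; apply: (prime_exp (n := i + e * k) pp); rewrite pE.
  by apply: idealMr; [exact: iF | have := filtrationX (i + e * k) fF Fz; rewrite mul1n].
split => [p|].
  exact: lin_natmin (local_lin hgr hR hbs' hG sG z0 hz zG p).
exact: lin_natmin (v_lin hgr hR hbs' hG sG z0 hz zG).
Qed.

Lemma filtration_zero : F 1%N = [set 0] -> forall n, (1 <= n)%N -> F n = [set 0].
Proof.
move=> F1 n n1; have [iF _ _ hle] := fF; apply/seteqP; split.
  by move=> x /(hle _ _ n1); rewrite F1.
by move=> _ ->; exact: ideal0.
Qed.

Lemma hom_nonzero I : hom gr I -> I <> [set 0] -> exists d x, [/\ gr d x, I x & x != 0].
Proof.
move=> hI I0; apply: contrapT => h; apply: I0; have [iI _] := hI.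
apply/seteqP; split; last by move=> _ ->; exact: ideal0.
apply: (hom_le hgr hI); first exact: ideal_zero.
move=> d x hx Ix /=; apply/eqP; apply: contrapT => /negP x0; apply: h.
by exists d, x.
Qed.

Theorem v_quasi_linear : noetherian_filtration F ->
  (forall p, stable_Ass F p -> quasi_linear (fun n => local_v gr p (F n))) /\
  quasi_linear (fun n => v_number gr (F n)).
Proof.
move=> nF.
have cst (f : nat -> nat) c : (forall n, (1 <= n)%N -> f n = c) -> quasi_linear f.
  move=> fc; apply: (@quasi_linear_classes f 1) => // i _.
  by exists 1%N, c, 0%N => k; rewrite mul0n addn0 fc // mul1n addnCA.
(* If F_1 = 0 there is no [z], but then all positive indices give the zero ideal and the functions
   are constant there. *)
have [F1|F1] := pselect (F 1%N = [set 0]).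
  have FE := filtration_zero F1; split=> [p _|].
    by apply: (cst _ (local_v gr p [set 0])) => n /FE ->.
  by apply: (cst _ (v_number gr [set 0])) => n /FE ->.
have [dz [z [hz Fz z0]]] := hom_nonzero (hF 1%N) F1.
have [e [K [e0 hK]]] := veronese_stable nF.
have {}hK i k : (K <= k)%N -> F (i + e * k.+1)%N `<=` ideal_mul (F e) (F (i + e * k)%N).
  move=> Kk; rewrite mulnSr addnA; apply: hK; apply: leq_trans Kk _.
  by apply: leq_trans (leq_addl _ _); rewrite leq_pmull.
split=> [p /near_ex[N hN]|]; apply: (quasi_linear_classes e0) => i _;
    have [hl hv] := veronese_lin e0 (hK i) Fz z0 hz.
  have [K' [b [c h]]] := hl p; exists (K' + N)%N, (b + c * N)%N, c => k.
  rewrite -[RHS]addnA -mulnDr -h (addnA K' N k).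
  congr natmin; apply/seteqP; split => u; last by case.
  move=> hu; split => //; apply: hN; apply: leq_trans (leq_addl _ _).
  by apply: leq_trans (leq_pmull _ e0); rewrite -addnA addnCA leq_addr.
have [K' [b [c h]]] := hv; exists K', b, c => k.
by rewrite -h v_numberE.
Qed.

End PartTwoA.

(** * Limits of v-numbers *)

(** Increments are bounded only from above, so f(n) is bounded above from the previous multiple of e
    and below from the next one; the error e f(n) - c n stays bounded. *)
Lemma ratio_cvg (Reals : realType) (f : nat -> nat) e c D C K : (0 < e)%N ->
  (forall n, (K <= n)%N -> (f n.+1 <= f n + D)%N) ->
  (forall k, (K <= k)%N -> (c * k <= f (e * k) + C)%N /\ (f (e * k) <= c * k + C)%N) ->
  (fun n => (f n)%:R / n%:R : Reals) @ \oo --> (c%:R / e%:R : Reals).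
Proof.
move=> e0 fS fe.
have fD n i : (K <= n)%N -> (f (n + i) <= f n + i * D)%N.
  move=> Kn; elim: i => [|i IH]; first by rewrite addn0 leq_addr.
  have := fS (n + i)%N (leq_trans Kn (leq_addr _ _)).
  by rewrite addnS mulSn; lia.
pose E := (e * C + e * (e * D) + c * e)%N.
have key n : (e * K <= n)%N -> (e * f n <= c * n + E)%N /\ (c * n <= e * f n + E)%N.
  move=> hn; pose k := (n %/ e)%N; pose r := (n %% e)%N.
  have Kk : (K <= k)%N by rewrite leq_divRL // mulnC.
  have nE : n = (e * k + r)%N by rewrite mulnC -divn_eq.
  have re : (r < e)%N by rewrite ltn_mod.
  have Kek : (K <= e * k)%N by apply: leq_trans Kk _; rewrite leq_pmull.
  have [h1 h2] := fe k Kk; have [h3 h4] := fe k.+1 (leqW Kk).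
  have h5 := fD (e * k)%N r Kek; rewrite -nE in h5.
  have Kn : (K <= n)%N by rewrite (leq_trans Kek) // nE leq_addr.
  have h6 := fD n (e - r)%N Kn.
  have neE : (n + (e - r) = e * k.+1)%N by rewrite mulnS nE; lia.
  rewrite neE in h6.
  have rD : (r * D <= e * D)%N by rewrite leq_mul2r ltnW ?orbT.
  have rD' : ((e - r) * D <= e * D)%N by rewrite leq_mul2r leq_subr orbT.
  have cn : (c * n <= c * (e * k.+1))%N by rewrite leq_mul2l nE mulnS; apply/orP; right; lia.
  have cn' : (c * (e * k) <= c * n)%N by rewrite leq_mul2l nE leq_addr orbT.
  have g1 : (f n <= c * k + C + e * D)%N by lia.
  have g2 : (c * k.+1 <= f n + e * D + C)%N by lia.
  have {}g1 : (e * f n <= e * (c * k + C + e * D))%N by rewrite leq_mul2l g1 orbT.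
  have {}g2 : (e * (c * k.+1) <= e * (f n + e * D + C))%N by rewrite leq_mul2l g2 orbT.
  move: g1 g2 cn cn'; rewrite /E !mulnDr [(c * (e * _))%N]mulnCA [(c * (e * k))%N]mulnCA.
  by lia.
apply/cvgrPdist_le => eps eps0.
have e0' : 0 < e%:R :> Reals by rewrite ltr0n.
near=> n.
have n0 : (0 < n)%N by near: n; exact: nbhs_infty_gt.
have n0' : 0 < n%:R :> Reals by rewrite ltr0n.
have hn : (e * K <= n)%N by near: n; exact: nbhs_infty_ge.
have hE : E%:R / eps <= n%:R :> Reals by near: n; exact: nbhs_infty_ger.
have [k1 k2] := key n hn.
have {}hE : E%:R <= eps * n%:R by rewrite -ler_pdivrMl // mulrC.
have -> : c%:R / e%:R - (f n)%:R / n%:R = (c%:R * n%:R - e%:R * (f n)%:R) / (e%:R * n%:R) :> Reals.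
  by field; rewrite !gt_eqF.
rewrite normrM normfV (ger0_norm (x := e%:R * n%:R)) ?mulr_ge0 // ler_pdivrMr ?mulr_gt0 //.
apply: (@le_trans _ _ E%:R).
  rewrite -!natrM ler_norml; apply/andP; split.
    by rewrite lerBrDr addrC lerBlDr -natrD ler_nat.
  by rewrite lerBlDr -natrD ler_nat addnC.
apply: le_trans hE _; rewrite ler_pM2l // ler_peMl // ler1n //.
Unshelve. all: by end_near. Qed.

(** * Initial degrees and v-numbers of powers *)

Section InitialDegree.
Variables (R : idomainType) (gr : nat -> set R).
Hypotheses (hgr : grading gr) (hR : noetherian_ring R).
Implicit Types (I J : set R).

(** A form of Krull's intersection theorem: the Artin-Rees property for R z puts z into B z, and z
    can be cancelled. *)
Lemma nakayama (B : set R) z : ideal B -> z != 0 -> (forall n, ideal_pow B n z) -> B 1.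
Proof.
move=> iB z0 hz; pose U n := [set x | ideal_pow B n x /\ exists y, x = y * z].
have iU n : ideal (U n).
  have iP := pow_ideal B n; apply: idealW => [|x y [Fx [a xE]] [Fy [b yE]]|a x [Fx [b xE]]].
  - by split; [exact: ideal0 | exists 0; rewrite mul0r].
  - by split; [exact: (idealD iP) | exists (a + b); rewrite mulrDl xE yE].
  - by split; [exact: (idealMl _ iP) | exists (a * b); rewrite xE mulrA].
have [|n x [] //|_ [K hK]] := stable_sub hR (pow_ideal B) (pow_stable B) iU _ _ iB.
  move=> n x y Bx [Fy [b yE]]; split; first exact: mem_mul.
  by exists (x * b); rewrite yE mulrA.
have : U K.+1 z by split => //; exists 1; rewrite mul1r.
move=> /(hK K (leqnn K)).
suff h : ideal_mul B (U K) `<=` [set x | exists2 b, B b & x = b * z].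
  by move=> /h[b Bb] /eqP; rewrite -{1}[z]mul1r => /eqP /(mulIf z0) ->.
apply: mul_min.
  apply: idealW => [|_ _ [a ha ->] [b hb ->]|a _ [b hb ->]].
  - by exists 0; [exact: ideal0 | rewrite mul0r].
  - by exists (a + b); [exact: idealD | rewrite mulrDl].
  - by exists (a * b); [exact: idealMl | rewrite mulrA].
by move=> b _ Bb [_ [a ->]]; exists (b * a); [exact: idealMr | rewrite mulrA].
Qed.

Lemma alphaP I : hom gr I -> I <> [set 0] ->
  exists x, [/\ x != 0, I x, gr (alpha gr I) x &
    forall d y, y != 0 -> I y -> gr d y -> (alpha gr I <= d)%N].
Proof.
move=> hI /(hom_nonzero hgr hI)[d [x [hx Ix x0]]].
have [|[y [y0 Iy hy]] amin] :=
    @natminP [set d | exists x, [/\ x <> 0, I x & gr d x]] d.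
  by exists x; split => //; exact/eqP.
exists y; split => //; first exact/eqP.
by move=> e t t0 It ht; apply: amin; exists t; split => //; exact/eqP.
Qed.

(** Besides bounding degrees in powers, these ideals describe, for the edge gradings of a polynomial
    ring, the localized powers of a cover ideal. *)
Definition order_ge a : set R := [set x | forall d, (d < a)%N -> (hp gr x)`_d = 0].

Lemma order_ge_ideal a : ideal (order_ge a).
Proof.
apply: idealW => [d _|x y hx hy d da|r x hx d da].
- by rewrite hp0 // coef0.
- by rewrite (hpD hgr) coefD hx // hy // addr0.
- rewrite (hpM hgr) coefM big1 // => i _; rewrite hx ?mulr0 //.
  by apply: leq_ltn_trans da; exact: leq_subr.
Qed.

Lemma order_geM a b x y : order_ge a x -> order_ge b y -> order_ge (a + b) (x * y).
Proof.
move=> hx hy d dab; rewrite (hpM hgr) coefM big1 // => -[i /= id] _.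
have [ia|ai] := ltnP i a; first by rewrite hx ?mul0r.
by rewrite hy ?mulr0 //; lia.
Qed.

Lemma alpha_pow J k d x : hom gr J -> J <> [set 0] -> ideal_pow J k x -> gr d x ->
  x != 0 -> (alpha gr J * k <= d)%N.
Proof.
move=> hJ J0 hx hd x0; have [_ [_ _ _ amin]] := alphaP hJ J0.
have JT : J `<=` order_ge (alpha gr J).
  move=> y Jy e ea; apply/eqP; apply: contraTT ea => ye; rewrite -leqNgt.
  apply: amin ye _ (hp_gr hgr _ _); have [_ h] := hJ; exact: h.
suff : order_ge (alpha gr J * k) x.
  move=> hox; rewrite leqNgt; apply/negP => /hox; rewrite (hp_homE hgr _ hd) eqxx => xE.
  by rewrite xE eqxx in x0.
elim: k x hx {hd x0} => [|k IH] x; first by move=> _ e; rewrite muln0.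
move: x; apply: mul_min; first exact: order_ge_ideal.
by move=> x y /JT hx /IH hy; rewrite mulnS; exact: order_geM.
Qed.

Lemma pow_gen_gr S a n : S `<=` gr a ->
  ideal_pow (ideal_gen S) n =
  ideal_gen [set x | ideal_pow (ideal_gen S) n x /\ gr (a * n) x].
Proof.
move=> Sa; apply/seteqP; split; last by apply: gen_min; [exact: pow_ideal | move=> x []].
elim: n => [|n IH] x.
  move=> _; rewrite -[x]mulr1; apply: (idealMl _ (ideal_genP _)); apply: gen_sub.
  by split => //; rewrite muln0; exact: gr1.
have iG := ideal_genP [set x | ideal_pow (ideal_gen S) n.+1 x /\ gr (a * n.+1) x].
move: x; apply: mul_gen_min => // x y Sx /IH hy.
have iC := colon_elt_ideal x iG.
suff : colon_elt (ideal_gen [set x | ideal_pow (ideal_gen S) n.+1 x /\ gr (a * n.+1) x]) x y.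
  by rewrite /colon_elt /= mulrC.
move: y hy; apply: gen_min => // y [hy ga]; rewrite /colon_elt /= mulrC.
apply: gen_sub; split; first by apply: mem_mul => //; exact: gen_sub.
by rewrite mulnS; apply: grM => //; exact: Sa.
Qed.

(* B^n lies in J^(n+1) only if J is the unit ideal: for degree reasons when
   alpha > 0, and by Nakayama's lemma when alpha = 0. *)
Lemma alpha_part_pow J n : hom gr J -> J <> [set 0] -> ~ J 1 ->
  ~ ideal_pow (ideal_gen (J `&` gr (alpha gr J))) n `<=` ideal_pow J n.+1.
Proof.
move=> hJ J0 J1 sub; set B := ideal_gen _ in sub.
have [x [x0 Jx hx amin]] := alphaP hJ J0; have [iJ cJ] := hJ.
have BJ : B `<=` J by apply: gen_min => // y [].
have Bx : B x by apply: gen_sub.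
have xn : ideal_pow B n (x ^+ n) by exact: mem_pow_exp.
(* x^n has degree alpha n but lies in J^(n+1), where degrees are at least alpha (n + 1); so alpha is
   0. *)
have := alpha_pow hJ J0 (sub _ xn) (grX hgr n hx) (expf_neq0 n x0).
rewrite mulnS -{2}[(_ * _)%N]add0n leq_add2r leqn0 => /eqP a0.
have zero k y : ideal_pow J k y -> ideal_pow B k (hp gr y)`_0.
  elim: k y => [//|k IH] y.
  have iP := pow_ideal B k.+1.
  move: y; apply: (@mul_min _ _ _ [set y | ideal_pow B k.+1 (hp gr y)`_0]).
    apply: idealW => /= [|y z hy hz|r y hy].
    - by rewrite hp0 // coef0; exact: ideal0.
    - by rewrite (hpD hgr) coefD; exact: (idealD iP).
    - by rewrite (hpM hgr) coef0M; exact: (idealMl _ iP).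
  move=> y z Jy /IH hz /=; rewrite (hpM hgr) coef0M; apply: mem_mul => //.
  by apply: gen_sub; split; [exact: cJ | rewrite a0; exact: hp_gr].
(* With alpha = 0 the ideal B^n is generated in degree 0, and the part of degree 0 of J^(n+1) lies
   in B^(n+1). Hence x^n lies in all powers of [B]. *)
have BS : ideal_pow B n `<=` ideal_pow B n.+1.
  have Sa : J `&` gr (alpha gr J) `<=` gr 0%N by rewrite a0 => y [].
  rewrite {1}/B (pow_gen_gr n Sa) -/B mul0n; apply: gen_min; first exact: pow_ideal.
  move=> y [hy g0]; have := zero n.+1 y (sub _ hy).
  by rewrite (hp_homE hgr _ g0).
apply: J1; apply: BJ; apply: (nakayama (ideal_genP _) (expf_neq0 n x0)) => k.
have [kn|nk] := leqP k n; first exact: pow_anti kn _ xn.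
rewrite -(subnK (ltnW nk)); elim: (k - n)%N => [//|i IH].
rewrite addSn; have -> : (i + n).+1 = (i + n.+1)%N by rewrite addnS.
rewrite -pow_mul; apply: (mul_mono (@subset_refl _ (ideal_pow B i)) BS).
by rewrite pow_mul.
Qed.

Lemma v_pow_le J : hom gr J -> J <> [set 0] -> ~ J 1 ->
  exists N C, forall k, (N <= k)%N ->
    (natmin (v_degrees gr (ideal_pow J k.+1)) <= alpha gr J * k + C)%N.
Proof.
move=> hJ J0 J1; have [iJ cJ] := hJ.
pose S := J `&` gr (alpha gr J); pose B := ideal_gen S.
have SJ : S `<=` gr (alpha gr J) by move=> x [].
have hB : hom gr B by apply: hom_gen => // x [_ hx]; exists (alpha gr J).
have BJ : B `<=` J by apply: gen_min => // y [].
pose D k := colon (ideal_pow J k.+1) (ideal_pow B k).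
have hD k : hom gr (D k) by apply: hom_colon => //; exact: hom_pow.
have iD k : ideal (D k) by have [] := hD k.
have DS k : D k `<=` D k.+1.
  move=> x Dx y hy; have iC := colon_elt_ideal x (pow_ideal J k.+2).
  rewrite mulrC; suff : colon_elt (ideal_pow J k.+2) x y by [].
  move: y hy; apply: mul_min => // b y Bb hy; rewrite /colon_elt /= -mulrA [y * x]mulrC.
  by apply: mem_mul; [exact: BJ | exact: Dx].
have [N hN] := ideal_acc hR iD DS.
have [p pA] : exists p, Ass (D N) p.
  apply: prime_ass_exists => // D1; apply: (@alpha_part_pow J N) => // x hx.
  by have := D1 x hx; rewrite mul1r.
have [_ [dg [g [hg pE]]]] := assoc_hom_elt hgr (hD N) pA; have [pp _] := pA.
exists N, dg => k Nk.
(* From [N] on the ideal [D k] is constant, so the same [p] and [g], and the same constant [dg],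
   serve for all k. *)
have DE : D k = D N.
  apply/seteqP; split; first exact: hN.
  by move: Nk => /subnK <-; elim: (k - N)%N => // i IH x /IH; rewrite addSn; exact: DS.
have [t [ht tE]] := fin_gen [set x | ideal_pow B k x /\ gr (alpha gr J * k) x] hR.
rewrite -(pow_gen_gr k SJ) -/B in tE.
have iP := pow_ideal J k.+1.
have [w wt|w wt r|r hr|w wt pw] := prime_inter (r := t)
    (A := fun w => colon_elt (ideal_pow J k.+1) (w * g)) pp.
- exact: colon_elt_ideal.
- have [Bw _] := ht w wt; rewrite pE /colon_elt /= -DE => hrg.
  by rewrite mulrCA mulrC; exact: hrg.
- rewrite pE /colon_elt /= -DE => y; rewrite tE => hy.
  have iC := colon_elt_ideal (r * g) iP.
  rewrite mulrC; suff : colon_elt (ideal_pow J k.+1) (r * g) y by [].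
  move: y hy; apply: gen_min => // w /= wt; rewrite /colon_elt /= mulrCA.
  exact: hr.
have [Bw hw] := ht w wt.
have vd : v_degrees gr (ideal_pow J k.+1) (alpha gr J * k + dg)%N.
  exists p; first by split => //; exists (w * g).
  by exists (w * g) => //; exact: grM.
by have [_ h] := natminP vd; exact: h.
Qed.

End InitialDegree.

(** * Limits from bounded increments *)

Section Limits.
Variables (Reals : realType) (R : idomainType) (gr : nat -> set R).
Hypotheses (hgr : grading gr) (hR : noetherian_ring R).
Variable F : nat -> set R.
Hypotheses (fF : filtration F) (hF : forall n, hom gr (F n)).
Variables (ys : seq (R * nat)) (K0 : nat).
Hypotheses (hys : forall y, y \in ys -> gr y.2 y.1 /\ F 1%N y.1).
Hypothesis colF : forall n x, (K0 <= n)%N ->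
  (forall y, y \in ys -> F n.+1 (y.1 * x)) -> F n x.

Let D : nat := \max_(y <- ys) y.2.

(* A prime (F_n : f) is the intersection of the ideals (F_(n+1) : y f), hence
   equal to one of them. *)
Lemma local_degrees_succ n p u : (K0 <= n)%N -> Ass (F n) p ->
  local_degrees gr p (F n) u ->
  exists2 w, (w <= u + D)%N & Ass (F n.+1) p /\ local_degrees gr p (F n.+1) w.
Proof.
move=> Kn [pp _] [f hf pE]; have [iF _ _ _] := fF.
have [y ys_y|y ys_y r|r hr|y ys_y pyE] := prime_inter (r := ys)
    (A := fun y => colon_elt (F n.+1) (y.1 * f)) pp.
- exact: colon_elt_ideal.
- have [_ Fy] := hys ys_y; rewrite pE /colon_elt /= mulrCA => h.
  by rewrite -add1n; exact: filtrationM.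
- rewrite pE /colon_elt /=; apply: colF => // y ys_y; rewrite mulrCA; exact: hr.
have [hy _] := hys ys_y.
exists (y.2 + u)%N; last first.
  by split; [split => //; exists (y.1 * f) | exists (y.1 * f) => //; exact: grM].
by rewrite addnC leq_add2l /D (big_rem y) //= leq_maxl.
Qed.

Variable e : nat.
Hypotheses (e0 : (0 < e)%N) (Fe : forall n, (1 <= n)%N -> F (e * n)%N = ideal_pow (F e) n).

Lemma v_proper_cvg : ~ F 1%N 1 ->
  (forall p, stable_Ass F p ->
     cvgn (fun n => (local_v gr p (F n))%:R / n%:R : Reals)) /\
  (fun n => (v_number gr (F n))%:R / n%:R : Reals) @ \oo -->
    ((alpha gr (F e))%:R / e%:R : Reals).
Proof.
move=> F11; have [iF F0 _ hle] := fF.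
have Fprop n : (1 <= n)%N -> ~ F n 1 by move=> n1 /(hle _ _ n1).
have F1n0 : F 1%N <> [set 0].
  (* If F_1 = 0, all the y vanish and [colF] would put 1 into a proper F_n. *)
  move=> F10; apply: (Fprop (maxn 1 K0)); first exact: leq_maxl.
  apply: colF; first exact: leq_maxr.
  by move=> y /hys[_]; rewrite F10 => /= ->; rewrite mul0r; exact: ideal0.
have [dz [z [hz Fz z0]]] := hom_nonzero hgr (hF 1%N) F1n0.
have Fen0 : F e <> [set 0].
  move=> Fe0; have := filtrationX e fF Fz; rewrite mul1n Fe0 => /= /eqP.
  by rewrite expf_eq0 (negbTE z0) andbF.
split=> [p /near_ex[N hN]|].
  have [hl _] := veronese_lin hgr hR fF hF (e := e) (K := 1%N) (i := 0%N) e0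
    (fun k k1 => ltac:(by rewrite !add0n !Fe)) Fz z0 hz.
  have [K [b [c hk]]] := hl p.
  apply/cvg_ex; exists (c%:R / e%:R).
  apply: (@ratio_cvg _ _ _ _ D (b + c * (K + N)) (K + N + K0)) => // [n Kn|k Kk].
    have pA := hN n ltac:(lia).
    have [|w wle [_ hw]] := local_degrees_succ (n := n) (p := p) _ pA (local_vP hgr (hF n) pA).1.
      by lia.
    have [_ h] := local_vP hgr (hF n.+1) (hN n.+1 ltac:(lia)).
    by apply: leq_trans (h _ hw) wle.
  have := hk (k - K)%N; rewrite add0n subnKC; last by lia.
  have kek : (k <= e * k)%N by rewrite leq_pmull.
  have -> : natmin [set u | Ass (F (e * k)) p /\ local_degrees gr p (F (e * k)) u] =
      local_v gr p (F (e * k)).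
    congr natmin; apply/seteqP; split => u; first by case.
    by move=> hu; split => //; apply: hN; lia.
  move=> ->; rewrite mulnBr.
  have : (c * K <= c * k)%N by rewrite leq_mul2l; apply/orP; right; lia.
  by rewrite mulnDr; lia.
have hJ : hom gr (F e) by exact: hF.
have [N [C hv]] := v_pow_le hgr hR hJ Fen0 (Fprop e e0).
have vP n : (1 <= n)%N -> minis (v_degrees gr (F n)) (v_number gr (F n)).
  move=> n1; rewrite v_numberE //.
  have [p pA] := prime_ass_exists hR (iF n) (Fprop n n1).
  have [u hu] := local_degrees_ex hgr (hF n) pA.
  by apply: (@natminP _ u); exists p.
have vS n : (K0 + 1 <= n)%N -> (v_number gr (F n.+1) <= v_number gr (F n) + D)%N.
  move=> Kn; have [|[p pA hu] _] := vP n; first by lia.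
  have [|w wle [pA' hw]] := local_degrees_succ _ pA hu; first by lia.
  have [|_ h] := vP n.+1; first by [].
  by apply: leq_trans (h w _) wle; exists p.
set al := alpha gr (F e).
apply: (@ratio_cvg _ _ _ _ D (al + C + D) (K0 + 1 + N + 1)) => // k Kk; last first.
  have kek : (k <= e * k)%N by rewrite leq_pmull.
  split; last first.
    have := hv k.-1 ltac:(lia); rewrite prednK; last by lia.
    rewrite -Fe; last by lia.
    rewrite -v_numberE //.
    have : (al * k.-1 <= al * k)%N by rewrite leq_mul2l leq_pred orbT.
    by rewrite /al; lia.
  (* A witness f at index e k + 1 has y f in F_(e k + 1) for every y, since powers of y lie in the
     filtration and so y lies in the prime. Then f is in F_(e k) = J^k, whose nonzero homogeneous
     elements have degree at least alpha k. *)
  suff : (al * k <= v_number gr (F (e * k).+1))%N.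
    by have := vS (e * k)%N ltac:(lia); lia.
  have [//|[p [pp [x pE]] [f hf pfE]] _] := vP (e * k).+1.
  have [ip p1 _] := pp.
  have f0 : f != 0.
    apply/eqP => f0; apply: p1; rewrite pfE f0 /colon_elt /= mulr0; exact: ideal0.
  apply: (alpha_pow hgr hJ Fen0 _ hf f0); rewrite -Fe; last by lia.
  apply: colF; first by lia.
  move=> y ys_y; have [_ Fy] := hys ys_y.
  have : p y.1; last by rewrite {1}pfE.
  apply: (prime_exp (n := (e * k).+1) pp); rewrite pE; apply: idealMr => //.
  by have := filtrationX (e * k).+1 fF Fy; rewrite mul1n.
by apply: vS; lia.
Qed.

Theorem v_cvg :
  (forall p, stable_Ass F p ->
     cvgn (fun n => (local_v gr p (F n))%:R / n%:R : Reals)) /\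
  (fun n => (v_number gr (F n))%:R / n%:R : Reals) @ \oo -->
    ((alpha gr (F e))%:R / e%:R : Reals).
Proof.
(* In the unit case there are no associated primes: v is 0 by convention, and so is the initial
   degree of R. *)
have [F11|] := pselect (F 1%N 1); last exact: v_proper_cvg.
have [iF F0 _ _] := fF.
have FT n : F n = setT.
  apply: ideal_eqT => //; have := filtrationX n fF F11.
  by rewrite mul1n expr1n.
have noA p n : ~ Ass (F n) p.
  by rewrite FT => -[[_ p1 _] [x pE]]; apply: p1; rewrite pE.
split=> [p /near_ex[N hN]|]; first by have := hN N (leqnn N) => /noA.
rewrite FT (_ : alpha gr setT = 0%N) ?mul0r; last first.
  apply: natmin_eq; split => //; exists 1; split => //; last exact: gr1.
  by apply/eqP; exact: oner_neq0.
rewrite (_ : (fun n => _) = (fun=> 0)); first exact: cvg_cst.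
apply/funext => n; rewrite FT v_numberE // natmin_none ?mul0r //.
by move=> u [p pA]; case: (@noA p 0%N); rewrite FT.
Qed.

End Limits.

(** * Saturations *)

Section Saturation.
Variables (R : idomainType) (gr : nat -> set R).
Hypotheses (hgr : grading gr) (hR : noetherian_ring R).
Implicit Types (I J L : set R) (F : nat -> set R).

(** The colons (I^(n+1) : I) form a submodule of the stable family (I^(n+1) : a). Stability puts the
    next one into I times the current one, which lies in I^(n+1) by the definition of a colon. *)
Lemma ratliff I a : ideal I -> I a -> a != 0 ->
  exists K, forall n, (K <= n)%N -> colon (ideal_pow I n.+1) I `<=` ideal_pow I n.
Proof.
move=> iI Ia a0; pose W n := colon_elt (ideal_pow I n.+1) a.
have sS : stable I (fun n => ideal_pow I n.+1).
  by split=> [n x y Ix hy|]; [exact: mem_mul | exists 0%N => n _].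
have sW := colon_elt_stable hR iI (fun n => pow_ideal I n.+1) sS a0.
pose U n := colon (ideal_pow I n.+1) I.
have iU n : ideal (U n) by apply: colon_ideal; exact: pow_ideal.
have iW n : ideal (W n) by apply: colon_elt_ideal; exact: pow_ideal.
have cU : compat I U.
  by move=> n x y Ix Uy t It; rewrite -mulrA; apply: mem_mul => //; exact: Uy.
have UW n : U n `<=` W n by move=> x; exact.
have [_ [K hK]] := stable_sub hR iW sW iU cU UW iI.
exists K.+1 => -[//|n] Kn x /(hK n Kn).
move: x; apply: mul_min; first exact: pow_ideal.
by move=> y x Iy hx; rewrite mulrC; exact: hx.
Qed.

(** The minimum is attained because e (K + 1) qualifies, with [e] and [K] from [veronese_stable]:
    its positive multiples are at least K, so blocks of length e can be split off. *)
Lemma svdP F : noetherian_filtration F ->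
  (0 < svd F)%N /\ forall n, (1 <= n)%N -> F (svd F * n)%N = ideal_pow (F (svd F)) n.
Proof.
move=> nF; have [fF _] := nF; have [e [K [e0 hK]]] := veronese_stable nF.
have hj j m : (K <= m)%N -> F (m + e * j)%N `<=` ideal_mul (F (e * j)%N) (F m).
  move=> Km; elim: j => [|j IH].
    by have [_ F0 _ _] := fF; rewrite muln0 addn0 F0 => x Fx; rewrite -[x]mul1r; exact: mem_mul.
  rewrite mulnSr addnA; apply: (subset_trans (hK _ (leq_trans Km (leq_addr _ _)))).
  apply: mul_min; first exact: mul_ideal.
  move=> x y Fx /IH; have iM := mul_ideal (F (e * j + e)%N) (F m).
  have iC := colon_elt_ideal x iM; rewrite mulrC.
  suff : ideal_mul (F (e * j)%N) (F m) `<=` colon_elt (ideal_mul (F (e * j + e)%N) (F m)) x.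
    by move=> h /h.
  apply: mul_min => // s t Fs Ft; rewrite /colon_elt /= mulrAC; apply: mem_mul => //.
  exact: filtrationM.
have : [set e | (1 <= e)%N /\ forall n, (1 <= n)%N -> F (e * n)%N = ideal_pow (F e) n] (e * K.+1)%N.
  split; first by rewrite muln_gt0 e0.
  have [iF F0 _ _] := fF.
  elim=> // -[_ _|n IH _]; first by rewrite muln1 pow1.
  apply/seteqP; split; last exact: filtration_pow.
  have -> : ideal_pow (F (e * K.+1)%N) n.+2 =
    ideal_mul (F (e * K.+1)%N) (ideal_pow (F (e * K.+1)%N) n.+1) by [].
  rewrite -IH // mulnSr.
  apply: hj; rewrite -mulnA; apply: leq_trans (leq_pmull _ e0).
  by rewrite mulnS; apply: leq_trans (leqnSn K) (leq_addr _ _).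
by move=> /natminP[].
Qed.

Lemma bounded_ratio_cvg (Reals : realType) (f : nat -> nat) c :
  (forall n, (1 <= n)%N -> (f n <= c)%N) ->
  (fun n => (f n)%:R / n%:R : Reals) @ \oo --> (0 : Reals).
Proof.
move=> fc; have -> : (0 : Reals) = 0%:R / 1%:R by rewrite mul0r.
apply: (@ratio_cvg _ _ _ _ c c 1%N) => // [n n1|k k1].
  by apply: leq_trans (fc n.+1 _) (leq_addl _ _).
by rewrite mul0n mul1n; split => //; exact: fc.
Qed.

Lemma alpha_setT : alpha gr setT = 0%N.
Proof.
apply: natmin_eq; split => //; exists 1; split => //; last exact: gr1.
by apply/eqP; exact: oner_neq0.
Qed.

Lemma alpha_zero : alpha gr [set 0] = 0%N.
Proof. by apply: natmin_none => d [x [x0 /x0]]. Qed.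

Lemma pow_zero n : ideal_pow [set 0] n.+1 = [set (0 : R)].
Proof.
apply/seteqP; split; last by move=> _ ->; exact: ideal0 (pow_ideal _ _).
apply: mul_min; first exact: ideal_zero.
by move=> x y -> _ /=; rewrite mul0r.
Qed.

Lemma saturation_zero L : ideal (saturation [set 0] L) ->
  saturation [set 0] L = setT \/ saturation [set 0] L = [set 0].
Proof.
move=> iS; have [[x [t t1 hx] x0]|h] := pselect (exists2 x, saturation [set 0] L x & x <> 0).
  left; apply: ideal_eqT => //; exists t => // y hy; rewrite mul1r.
  have /= := hx y hy; move=> /eqP; rewrite mulf_eq0 => /orP[/eqP //|/eqP //].
right; apply/seteqP; split; last by move=> _ ->; exact: ideal0.
by move=> x hx /=; apply: contrapT => x0; apply: h; exists x.
Qed.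

Theorem v_saturation_cvg (Reals : realType) I L :
  homogeneous_ideal gr I -> homogeneous_ideal gr L ->
  let F := fun n => saturation (ideal_pow I n) L in
  noetherian_filtration F ->
  (forall p, stable_Ass F p ->
     cvgn (fun n => (local_v gr p (F n))%:R / n%:R : Reals)) /\
  (fun n => (v_number gr (F n))%:R / n%:R : Reals) @ \oo -->
    ((alpha gr (F (svd F)))%:R / (svd F)%:R : Reals).
Proof.
move=> /(hom_homogeneous hgr) hI /(hom_homogeneous hgr) hL F nF.
have [fF _] := nF; have [iF F0 _ _] := fF; have [iI _] := hI.
have [s0 hs] := svdP nF.
(* Ratliff's theorem uses a nonzero element of [I]. For I = 0 the filtration is constant from index
   1 on, equal to R or to 0. *)
have [I0|I0] := pselect (I = [set 0]).
  have FE n : (1 <= n)%N -> F n = F 1%N.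
    by case: n => // n _; rewrite /F I0 !pow_zero.
  split=> [p _|].
    apply/cvg_ex; exists 0.
    by apply: (@bounded_ratio_cvg _ _ (local_v gr p (F 1%N))) => n /FE ->.
  rewrite FE // (_ : alpha gr (F 1%N) = 0%N) ?mul0r; last first.
    have := @saturation_zero L; rewrite /F I0 pow_zero => -[|->|->].
    - by have := iF 1%N; rewrite /F I0 pow_zero.
    - exact: alpha_setT.
    - exact: alpha_zero.
  by apply: (@bounded_ratio_cvg _ _ (v_number gr (F 1%N))) => n /FE ->.
have [a Ia a0] := ideal_eq0 iI I0.
have [K hK] := ratliff iI Ia (introN eqP a0).
have [ys [hys IE]] := hom_fin_gen hgr hR hI.
have hF n : hom gr (F n) by apply: (hom_saturation hgr (hom_pow hgr n hI) hL); exact: iF.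
apply: (@v_cvg Reals _ _ hgr hR _ fF hF ys K _ _ _ s0 hs) => [y /hys[hy Iy]|n x Kn hx].
  split => //; exists 1%N => // l hl; rewrite mulrC.
  exact: (idealMl _ (pow_ideal _ _) (mem_pow1 Iy)).
(* As [I] has finitely many generators, one exponent t serves for all; then x L^t lies in (I^(n+1) :
   I), hence in I^n. *)
have [t t1 ht] : exists2 t, (1 <= t)%N & forall y, y \in ys ->
    colon (ideal_pow I n.+1) (ideal_pow L t) (y.1 * x).
  elim: ys hx {hys IE} => [|y ys IH] hx; first by exists 1%N.
  have [|t t1 ht] := IH; first by move=> z zs; apply: hx; rewrite inE zs orbT.
  have [t' t'1 ht'] := hx y (mem_head _ _).
  exists (maxn t t') => [|z]; first by rewrite leq_max t1.
  rewrite inE => /orP[/eqP -> l hl|/ht h l hl].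
    by apply: ht'; exact: pow_anti (leq_maxr t t') _ hl.
  by apply: h; exact: pow_anti (leq_maxl t t') _ hl.
exists t => // l hl; apply: (hK n Kn) => b; rewrite {1}IE => Ib.
have iC := colon_elt_ideal (x * l) (pow_ideal I n.+1).
rewrite mulrC; suff : colon_elt (ideal_pow I n.+1) (x * l) b by [].
move: b Ib; apply: gen_min => // _ /= /mapP[y ys_y ->].
by rewrite /colon_elt /= mulrA; exact: ht.
Qed.

End Saturation.

(** * Polynomial rings *)

Section MPoly.
Variables (K : fieldType) (m : nat).
Local Notation B := (mpoly m K).
Implicit Types (p q r : B) (u v : multinom m) (S : set (multinom m)).

(** The constants form a noetherian ring, every nonzero one being invertible, and adjoining the
    variables one by one preserves this. *)
Lemma noetherian_mpoly : noetherian_ring B.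
Proof.
apply: noeth_noetherian; pose A := range (@mpolyC m K).
have hA : sring A.
  split; first by exists 1; rewrite ?mpolyC1.
    by move=> _ _ [a _ <-] [b _ <-]; exists (a - b); rewrite ?mpolyCB.
  by move=> _ _ [a _ <-] [b _ <-]; exists (a * b); rewrite ?mpolyCM.
have nA : noeth A A.
  move=> U [U0 UD UM] UA; have [[x Ux x0]|h] := pselect (exists2 x, U x & x <> 0).
    have [c _ cx] := UA x Ux; have c0 : c != 0.
      by apply/eqP => c0; apply: x0; rewrite -cx c0 mpolyC0.
    exists [:: 1]; split => [g|y Uy].
      rewrite inE => /eqP ->; rewrite -(mpolyC1 m K) -(mulVf c0) mpolyCM cx.
      by apply: UM => //; exists c^-1.
    by exists y, 0; split => //; [exact: UA | rewrite mulr1 addr0].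
  exists [::]; split => // y Uy /=; apply: contrapT => y0; apply: h.
  by exists y.
pose xs := [seq mpolyX K (mnm1 i) | i <- enum 'I_m].
suff <- : adjs A xs = setT by exact: noeth_adjs.
have [h1 hB hM] := adjs_sring xs hA; apply/seteqP; split => // p _.
have hs := adjs_sring xs hA.
rewrite [p]mpolyE; apply: big_ind; [exact: sring0 | by move=> x y; exact: sringD |].
move=> u _; rewrite -mul_mpolyC; apply: (hM); first by apply: adjs_sub; exists (mcoeff u p).
rewrite mpolyXE_id; apply: big_ind; [exact: h1 | exact: hM | move=> i _].
have : adjs A xs (mpolyX K (mnm1 i)).
  by apply: adjs_gen => //; apply: map_f; exact: mem_enum.
elim: (u i) => [|k IH] hx; first by [].
by rewrite exprS; apply: (hM) => //; exact: IH.
Qed.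

Section Measure.
Variable mf : measure m.

(** Arbitrary additive weights are allowed: besides the total degree, each edge of the graph gets a
    grading of its own. *)
Definition mgrading (d : nat) : set B := [set q | q \is ishomog1 d mf].

Lemma grading_mgrading : grading mgrading.
Proof.
split.
- split; first exact: dhomog1.
  + by move=> d; exact: dhomog0.
  + by move=> d x y; rewrite /mgrading /= => hx hy; apply: rpredB.
  + by move=> d e x y; rewrite /mgrading /=; exact: dhomogM.
- move=> x; exists (mmeasure mf x), (fun d => pihomog mf d x); split.
    by move=> d; exact: pihomogP.
  exact: pihomog_partitionE.
- move=> N c hc c0 d dN; have := congr1 (pihomog mf d) c0.
  rewrite pihomog0 linear_sum /= (bigD1 (Ordinal dN)) //= pihomog_dE; last exact: hc.
  rewrite big1 ?addr0 // => i id; apply: (pihomog_ne0 _ (hc i)).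
  by apply: contra_neq id => id; apply: val_inj.
Qed.

Lemma mcoeff_hp u q : mcoeff u q = mcoeff u (hp mgrading q)`_(mf u).
Proof.
have hg i : mf u != i -> mcoeff u (hp mgrading q)`_i = 0.
  by move=> ui; apply: dhomog_nemf_coeff (hp_gr grading_mgrading q i) ui.
rewrite {1}[q](hp_sum grading_mgrading) raddf_sum /=.
have [us|su] := ltnP (mf u) (size (hp mgrading q)).
  rewrite (bigD1 (Ordinal us)) //= big1 ?addr0 // => i iu; apply: hg.
  by apply: contra_neq iu => iu; apply: val_inj.
rewrite [in RHS]nth_default // mcoeff0 big1 // => i _; apply: hg.
by rewrite neq_ltn (leq_trans (ltn_ord i) su) orbT.
Qed.

Lemma order_geE n q : order_ge mgrading n q <-> forall u, u \in msupp q -> (n <= mf u)%N.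
Proof.
split=> [hq u|hq d dn].
  by apply: contraTT; rewrite -ltnNge => /hq h; rewrite mcoeff_msupp mcoeff_hp h mcoeff0 eqxx.
apply/mpolyP => u; rewrite mcoeff0.
have [ud|ud] := eqVneq (mf u) d; last first.
  exact: dhomog_nemf_coeff (hp_gr grading_mgrading q d) ud.
rewrite -ud -mcoeff_hp; apply/eqP; rewrite -[_ == 0]negbK -mcoeff_msupp.
by apply/negP => /hq; rewrite leqNgt ud dn.
Qed.

End Measure.

Definition mon_set S : set B := [set q | forall u, u \in msupp q -> S u].

Definition upclosed S := forall u v, S u -> S (mnm_add v u).

Lemma mon_setX S u : mon_set S (mpolyX K u) <-> S u.
Proof.
rewrite /mon_set /=; split; first by apply; rewrite msuppX inE.
by move=> Su v; rewrite msuppX inE => /eqP ->.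
Qed.

Lemma mon_ideal S : upclosed S -> ideal (mon_set S).
Proof.
move=> hS; apply: idealW => [u|p q hp hq u|p q hq u].
- by rewrite msupp0.
- by move/msuppD_le; rewrite mem_cat => /orP[/hp|/hq].
- by move/msuppM_le => /allpairsP[[v w] /= [_ /hq Sw ->]]; exact: hS.
Qed.

Lemma mon_min S I : ideal I -> (forall u, S u -> I (mpolyX K u)) -> mon_set S `<=` I.
Proof.
move=> iI hI q hq; rewrite [q]mpolyE big_seq; apply: ideal_sum => // u uq.
by rewrite -mul_mpolyC; apply: idealMl => //; apply: hI; exact: hq.
Qed.

Lemma mon_gen S : upclosed S -> mon_set S = ideal_gen [set mpolyX K u | u in S].
Proof.
move=> hS; apply/seteqP; split.
  apply: mon_min; first exact: ideal_genP.
  by move=> u Su; apply: gen_sub; exists u.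
by apply: gen_min; [exact: mon_ideal | move=> _ [u Su <-]; exact/mon_setX].
Qed.

Lemma mon_hom S : upclosed S -> hom (@std_grading K m) (mon_set S).
Proof.
move=> hS; rewrite mon_gen //; apply: (hom_gen (grading_mgrading mdeg)) => _ [u _ <-].
exists (mdeg u); suff : mpolyX K u \is ishomog1 (mdeg u) mdeg by [].
by rewrite dhomogX.
Qed.

Lemma mpolyX_split u v : (forall i, (v i <= u i)%N) ->
  mpolyX K u = mpolyX K (mnm_sub u v) * mpolyX K v.
Proof.
move=> vu; rewrite -mpolyXD; congr mpolyX; apply/mnmP => i.
by rewrite mnmDE mnmBE subnK.
Qed.

End MPoly.

(** For an edge, x_i and x_j get degree 1 and the other variables degree 0; the order for this
    grading is the valuation attached to the prime (x_i, x_j). *)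
Definition edge_weight (m : nat) (i j : 'I_m) (u : multinom m) : nat := (u i + u j)%N.

Lemma edge_weight0 (m : nat) (i j : 'I_m) : edge_weight i j mnm0 = 0%N.
Proof. by rewrite /edge_weight !mnm0E. Qed.

Lemma edge_weightD (m : nat) (i j : 'I_m) :
  {morph edge_weight i j : u v / mnm_add u v >-> (u + v)%N}.
Proof. by move=> u v; rewrite /edge_weight !mnmDE addnACA. Qed.

HB.instance Definition _ (m : nat) (i j : 'I_m) :=
  isMeasure.Build m (edge_weight i j) (edge_weight0 i j) (edge_weightD i j).

(** * Cover ideals *)

Section Covers.
Variables (m : nat) (e : rel 'I_m).
Hypotheses (esym : ssrbool.symmetric e) (eirr : irreflexive e).
Implicit Types (u v : multinom m).

(** The exponents of the monomials in the n-th symbolic power of the cover ideal. *)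
Definition covers (n : nat) : set (multinom m) :=
  [set u | forall i j, e i j -> (n <= u i + u j)%N].

(** A vertex where [u] vanishes forces large values at its neighbours, so 2 can be taken off there;
    at the other vertices of the support 1 is taken. *)
Definition cover_part u : multinom m :=
  Multinom [tuple if u i == 0%N then 0%N
                  else if [exists j, e i j && (u j == 0%N)] then 2%N else 1%N | i < m].

Lemma cover_partE u i : cover_part u i = if u i == 0%N then 0%N
  else if [exists j, e i j && (u j == 0%N)] then 2%N else 1%N.
Proof. exact: mnmE. Qed.

(* The splitting of covers of Herzog, Hibi and Trung *)
Lemma covers_split u k : covers k.+2 u ->
  [/\ forall i, (cover_part u i <= u i)%N, covers 2 (cover_part u)
    & covers k (mnm_sub u (cover_part u))].
Proof.
move=> hu.
have nbr i j : e i j -> u j = 0%N -> (k.+2 <= u i)%N.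
  by move=> /hu + uj; rewrite uj addn0.
split=> [i|i j eij|i j eij].
- rewrite cover_partE; case: eqP => // /eqP ui; case: existsP => [[j /andP[eij /eqP uj]]|_].
    by apply: leq_trans (nbr i j eij uj).
  by rewrite lt0n.
- rewrite !cover_partE; have eji : e j i by rewrite esym.
  case: eqP => [ui|_].
    have uj := nbr j i eji ui.
    rewrite gtn_eqF; last by apply: leq_trans uj.
    by case: existsP => // -[]; exists i; rewrite eji ui.
  case: eqP => [uj|_]; last by do 2!case: existsP.
  by case: existsP => // -[]; exists j; rewrite eij uj.
(* More than 2 is removed from an edge only if an endpoint has value 2. That endpoint has a
   neighbour where [u] vanishes, so [u] is at least k + 2 there and k remains. *)
- rewrite !mnmBE !cover_partE; have := hu i j eij.
  case: eqP => [ui|ui]; case: eqP => [uj|uj]; try lia.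
  + case: existsP => [[l /andP[ejl /eqP ul]]|_]; last by lia.
    by have := nbr j l ejl ul; lia.
  + case: existsP => [[l /andP[eil /eqP ul]]|_]; last by lia.
    by have := nbr i l eil ul; lia.
  + case: existsP => [[l /andP[eil /eqP ul]]|_].
      by have := nbr i l eil ul; lia.
    case: existsP => [[l /andP[ejl /eqP ul]]|_]; last by lia.
    by have := nbr j l ejl ul; lia.
Qed.

Lemma covers_up n : upclosed (covers n).
Proof.
by move=> u v hu i j eij; rewrite !mnmDE; have := hu i j eij; lia.
Qed.

Variable K : fieldType.
Local Notation B := (mpoly m K).
Let J : set B := @cover_ideal K m e.
Let C n : set B := mon_set (covers n).
Let P (i j : 'I_m) : set B :=
  ideal_gen [set mpolyX K (mnm1 i); mpolyX K (mnm1 j)].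
Let G (i j : 'I_m) := @mgrading K m (edge_weight i j).

Lemma edge_gradingP i j : grading (G i j).
Proof. exact: grading_mgrading. Qed.

Lemma order_edgeE i j n q : order_ge (G i j) n q <->
  forall u, u \in msupp q -> (n <= u i + u j)%N.
Proof. exact: order_geE. Qed.

Lemma edge_primeE i j : P i j = order_ge (G i j) 1.
Proof.
apply/seteqP; split.
  apply: gen_min; first exact: order_ge_ideal (edge_gradingP i j) _.
  move=> _ /= [->|->]; apply/order_edgeE => u; rewrite msuppX inE => /eqP ->.
    by rewrite !mnm1E eqxx.
  by rewrite !mnm1E eqxx addnC.
move=> q /order_edgeE hq.
apply: (@mon_min K m [set u | (1 <= u i + u j)%N] (P i j)) hq.
  exact: ideal_genP.
move=> u /=; rewrite addn_gt0 => hu.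
have [l uX ul] : exists2 l, P i j (mpolyX K (mnm1 l)) & (0 < u l)%N.
  by case/orP: hu => hu; [exists i | exists j] => //; apply: gen_sub; [left | right].
rewrite (mpolyX_split _ (v := mnm1 l)).
  exact: (idealMl _ (ideal_genP _)).
by move=> l'; rewrite mnm1E; case: eqP => [<-|].
Qed.

(** Membership means that the component of edge degree 0 vanishes, and taking this component is
    multiplicative with values in a domain. *)
Lemma edge_prime i j : prime_ideal (P i j).
Proof.
have hg := edge_gradingP i j; split; first exact: ideal_genP.
  rewrite edge_primeE => /(_ 0%N (ltnSn 0)); rewrite (hp1 hg) coefC /= => /eqP.
  by rewrite oner_eq0.
move=> x y; rewrite edge_primeE => /(_ 0%N (ltnSn 0)).
rewrite (hpM hg) coef0M => /eqP; rewrite mulf_eq0 => /orP[/eqP h|/eqP h]; [left|right];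
  by move=> d; rewrite ltnS leqn0 => /eqP ->.
Qed.

Lemma cover_mem_edge n i j : e i j -> C n `<=` order_ge (G i j) n.
Proof. by move=> eij q hq; apply/order_edgeE => u /hq; exact. Qed.

Lemma mem_C n q : (forall i j, e i j -> order_ge (G i j) n q) -> C n q.
Proof. by move=> hq u uq i j eij; have /order_edgeE := hq i j eij; exact. Qed.

Lemma cover_idealE : J = C 1.
Proof.
apply/seteqP; split => q hq.
  by apply: mem_C => i j eij; rewrite -edge_primeE; exact: (hq (i, j)).
by move=> [i j] /= eij; rewrite -/(P i j) edge_primeE; exact: cover_mem_edge.
Qed.

(** The product of the variables off an edge lies in the primes of all other edges, so it is a
    witness for the prime of this one. For i = j it is the product of all variables but x_i. *)
Definition off_edge (i j : 'I_m) : multinom m :=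
  Multinom [tuple ((l != i) && (l != j) : nat) | l < m].

Lemma off_edgeE i j l : off_edge i j l = ((l != i) && (l != j) : nat).
Proof. exact: mnmE. Qed.

Lemma edge_ass i j : e i j -> P i j = colon_elt J (mpolyX K (off_edge i j)).
Proof.
move=> eij; rewrite cover_idealE; apply/seteqP; split => q.
  rewrite edge_primeE => /order_edgeE hq; rewrite /colon_elt /= => u.
  rewrite (perm_mem (msuppMX _ _)) => /mapP[v /hq + ->].
  move=> hv k l ekl; rewrite !mnmDE !off_edgeE.
  have kl : k != l by apply: contraTneq ekl => ->; rewrite eirr.
  have [//|kij] := boolP ((k != i) && (k != j)).
  have [|lij] := boolP ((l != i) && (l != j)); first by lia.
  move: kij lij kl; rewrite !negb_and !negbK => /orP[]/eqP -> /orP[]/eqP ->;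
    by rewrite ?eqxx //; lia.
rewrite /colon_elt /= edge_primeE => hq; apply/order_edgeE => u uq.
have : mnm_add (off_edge i j) u \in msupp (q * mpolyX K (off_edge i j)).
  by rewrite (perm_mem (msuppMX _ _)) map_f.
move=> /hq /(_ i j eij); rewrite !mnmDE !off_edgeE !eqxx andbF /=.
by [].
Qed.

(** As [J] is a finite intersection of edge primes P, an associated prime is one of the ideals (P :
    x), each of which is P or the unit ideal. *)
Lemma ass_cover p : Ass J p <-> exists i j, e i j /\ p = P i j.
Proof.
split=> [[pp [x pE]]|[i [j [eij ->]]]]; last first.
  by split; [exact: edge_prime | exists (mpolyX K (off_edge i j)); exact: edge_ass].
have iP i j : ideal (P i j) by exact: ideal_genP.
have [||r hr|[i j] + pij] := prime_inter
    (r := [seq ij <- enum {: 'I_m * 'I_m} | e ij.1 ij.2])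
    (A := fun ij => colon_elt (P ij.1 ij.2) x) pp.
- by move=> ij _; exact: (colon_elt_ideal _ (iP _ _)).
- move=> [i j]; rewrite mem_filter /= => /andP[eij _]; rewrite pE /colon_elt => r hr.
  exact: (hr (i, j)).
- rewrite pE => -[i j] /= eij; apply: (hr (i, j)).
  by rewrite mem_filter /= eij mem_enum.
rewrite mem_filter /= => /andP[eij _]; exists i, j; split => //.
have [ip p1 _] := pp; have [_ _ PM] := edge_prime i j.
have nPx : ~ P i j x by move=> h; apply: p1; rewrite pij /colon_elt /= mul1r.
rewrite pij; apply/seteqP; split => r; rewrite /colon_elt /=.
  by move=> /PM[].
by move=> hr; exact: (idealMr _ (iP i j)).
Qed.

Lemma pow_cover_sub n i j : e i j -> ideal_pow J n `<=` order_ge (G i j) n.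
Proof.
move=> eij; have hg := edge_gradingP i j; elim: n => [|n IH]; first by move=> x _.
apply: mul_min; first exact: order_ge_ideal.
move=> x y Jx /IH hy; rewrite -add1n; apply: order_geM => //.
by apply: cover_mem_edge => //; rewrite -cover_idealE.
Qed.

Lemma cover_local n i j : e i j ->
  local_contraction (ideal_pow J n) (P i j) = order_ge (G i j) n.
Proof.
move=> eij; have hg := edge_gradingP i j; apply/seteqP; split => r.
  move=> [a [s [/(pow_cover_sub eij) ha ns sra]]] d.
  (* Lying outside the edge prime means having a nonzero component of edge degree 0; with it the
     components of [r] of degree below [n] vanish inductively. *)
  have s0 : (hp (G i j) s)`_0 != 0.
    apply/eqP => s0; apply: ns; rewrite edge_primeE => k.
    by rewrite ltnS leqn0 => /eqP ->.
  elim/ltn_ind: d => d IH dn; have := ha d dn.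
  rewrite -sra (hpM hg) coefM big_ord_recl /= subn0 big1 ?addr0 => [/eqP|k _].
    by rewrite mulf_eq0 (negbTE s0) => /eqP.
  by rewrite IH ?mulr0 //; rewrite /bump /=; have := ltn_ord k; lia.
(* The multiplier is the n-th power of the product of the variables off the edge: each copy, paired
   with a factor x_i or x_j of the monomial, gives an element of [J]. *)
move=> /order_edgeE hr; pose t := mpolyX K (off_edge i j) ^+ n.
exists (t * r), t; split => //.
  have iC := colon_elt_ideal t (pow_ideal J n).
  suff : colon_elt (ideal_pow J n) t r by rewrite /colon_elt /= mulrC.
  apply: (@mon_min K m [set u | (n <= u i + u j)%N]) hr => // u /= hu; rewrite /colon_elt /=.
  have Jl l : P i j (mpolyX K (mnm1 l)) -> J (mpolyX K (mnm1 l) * mpolyX K (off_edge i j)).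
    by rewrite (edge_ass eij).
  have Ji := Jl i (gen_sub (or_introl erefl)); have Jj := Jl j (gen_sub (or_intror erefl)).
  (* The n factors consist of as many x_i as [u] offers, at most n, completed by x_j. *)
  pose a := minn n (u i); pose b := (n - a)%N.
  have ij : i != j by apply: contraTneq eij => ->; rewrite eirr.
  have -> : mpolyX K u * t = mpolyX K (mnm_sub u (mnm_add (mnm_muln (mnm1 i) a) (mnm_muln (mnm1 j) b)))
      * ((mpolyX K (mnm1 i) * mpolyX K (off_edge i j)) ^+ a *
         (mpolyX K (mnm1 j) * mpolyX K (off_edge i j)) ^+ b).
    rewrite (mpolyX_split _ (u := u) (v := mnm_add (mnm_muln (mnm1 i) a) (mnm_muln (mnm1 j) b))).
      rewrite mpolyXD -!mpolyXn !exprMn /t (_ : n = a + b)%N ?exprD; first by ring.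
      by rewrite /b subnKC // geq_minl.
    move=> l; rewrite mnmDE !mulmnE !mnm1E.
    move: hu; have [<-|il] := eqVneq i l.
      by rewrite eq_sym (negbTE ij) /a; lia.
    by have [<-|jl] := eqVneq j l; rewrite /b /a; lia.
  apply: (idealMl _ (pow_ideal _ _)).
  rewrite (_ : n = a + b)%N; last by rewrite /b subnKC // geq_minl.
  by apply: mem_powD; exact: mem_pow_exp.
rewrite /t edge_primeE => /order_edgeE; rewrite mpolyXn => /(_ _); rewrite msuppX.
move=> /(_ _ (mem_head _ _)); rewrite !mulmnE !off_edgeE !eqxx andbF.
by rewrite mul0n.
Qed.

Lemma symbolic_coverE n : symbolic_power J n = C n.
Proof.
apply/seteqP; split => q hq.
  apply: mem_C => i j eij; rewrite -(cover_local _ eij); apply: hq.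
  by apply/ass_cover; exists i, j.
move=> p /ass_cover[i [j [eij ->]]]; rewrite cover_local //.
exact: cover_mem_edge.
Qed.

Lemma covers_ideal n : ideal (C n). Proof. exact: mon_ideal (@covers_up n). Qed.

Lemma covers_filtration : filtration C.
Proof.
split=> [n||r s|r s rs].
- exact: covers_ideal.
- by apply/seteqP; split.
- apply: mul_min; first exact: covers_ideal.
  move=> x y hx hy w /msuppM_le /allpairsP[[u v] /= [/hx hu /hy hv ->]] i j eij.
  by rewrite !mnmDE; have := hu i j eij; have := hv i j eij; lia.
- by move=> q hq u /hq hu i j eij; apply: leq_trans (hu i j eij).
Qed.

Lemma covers_mul k : C k.+2 `<=` ideal_mul (C 2) (C k).
Proof.
apply: mon_min; first exact: mul_ideal.
move=> u /covers_split[hle h2 hk]; rewrite (mpolyX_split _ hle) mulrC.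
by apply: mem_mul; exact/mon_setX.
Qed.

(** Splitting off 2-covers repeatedly makes index 2 a Veronese index for every graph; this is where
    the 2 in the limit comes from. *)
Lemma covers_pow n : C (2 * n)%N = ideal_pow (C 2) n.
Proof.
apply/seteqP; split; last exact: filtration_pow covers_filtration.
elim: n => [//|n IH]; rewrite mulnS.
apply: (subset_trans (@covers_mul _)); exact: mul_mono.
Qed.

(* The product of the variables other than x_j has order one along each edge
   through j. *)
Lemma covers_colon n q :
  (forall j, C n.+1 (mpolyX K (off_edge j j) * q)) -> C n q.
Proof.
move=> hq u uq i j eij.
have ij : i != j by apply: contraTneq eij => ->; rewrite eirr.
have : mnm_add (off_edge j j) u \in msupp (mpolyX K (off_edge j j) * q).
  by rewrite mulrC (perm_mem (msuppMX _ _)) map_f.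
move=> /(hq j) /(_ i j eij); rewrite !mnmDE !off_edgeE eqxx ij andbF /=.
by lia.
Qed.

Lemma off_vertex_cover j : C 1 (mpolyX K (off_edge j j)).
Proof.
apply/mon_setX => k l ekl; rewrite !off_edgeE !andbb.
have kl : k != l by apply: contraTneq ekl => ->; rewrite eirr.
by have [kj|//] := eqVneq k j; rewrite -kj eq_sym kl.
Qed.

Theorem v_cover_cvg (Reals : realType) :
  let F := symbolic_power J in
  (forall p, stable_Ass F p ->
     cvgn (fun n => (local_v (@std_grading K m) p (F n))%:R / n%:R : Reals)) /\
  (fun n => (v_number (@std_grading K m) (F n))%:R / n%:R : Reals) @ \oo -->
    ((alpha (@std_grading K m) (F 2%N))%:R / 2 : Reals).
Proof.
have -> : symbolic_power J = C by apply/funext => n; exact: symbolic_coverE.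
pose ys := [seq (mpolyX K (off_edge j j), mdeg (off_edge j j)) | j <- enum 'I_m].
move=> F; rewrite /F => {F}.
have h := @v_cvg Reals _ (@std_grading K m) (grading_mgrading K mdeg) (@noetherian_mpoly K m)
  C covers_filtration.
apply: (h _ ys 0%N) => //.
- by move=> n; apply: mon_hom; exact: covers_up.
- move=> _ /mapP[j _ ->]; split; last exact: off_vertex_cover.
  suff : mpolyX K (off_edge j j) \is ishomog1 (mdeg (off_edge j j)) mdeg by [].
  by rewrite dhomogX.
- move=> n q _ hq; apply: covers_colon => j.
  apply: (hq (mpolyX K (off_edge j j), mdeg (off_edge j j))).
  by apply/mapP; exists j => //; exact: mem_enum.
- by move=> n _; exact: covers_pow.
Qed.

End Covers.

Theorem theorem1p3 (Reals : realType) (R : idomainType) (gr : nat -> set R)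
    (hgr : grading gr) (hR : noetherian_ring R) :
  (* (1) *)
  (forall (I : set R) (l : nat) (a : 'I_l -> R) (d : 'I_l -> nat),
     (forall i, gr (d i) (a i)) -> I = ideal_gen (range a) -> I <> [set 0] ->
     let F := fun n => integral_closure (ideal_pow I n) in
     fg_module_over (rees (ideal_pow I)) (rees F) ->
     (forall p, stable_Ass F p ->
        exists i, eventually_linear (fun n => local_v gr p (F n)) (d i)) /\
     (exists i, eventually_linear (fun n => v_number gr (F n)) (d i))) /\
  (* (2)(a) *)
  (forall I L : set R,
     homogeneous_ideal gr I -> homogeneous_ideal gr L ->
     let F := fun n => saturation (ideal_pow I n) L in
     noetherian_filtration F ->
     (forall p, stable_Ass F p ->
        quasi_linear (fun n => local_v gr p (F n))) /\
     quasi_linear (fun n => v_number gr (F n))) /\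
  (* (2)(b)(i) *)
  (forall (K : fieldType) (m : nat) (I L : set (mpoly m K)),
     homogeneous_ideal (@std_grading K m) I ->
     homogeneous_ideal (@std_grading K m) L ->
     let F := fun n => saturation (ideal_pow I n) L in
     noetherian_filtration F ->
     monomial_ideal I -> equigenerated (@std_grading K m) I ->
     (forall p, stable_Ass F p ->
        cvgn (fun n =>
          (local_v (@std_grading K m) p (F n))%:R / n%:R : Reals)) /\
     (fun n => (v_number (@std_grading K m) (F n))%:R / n%:R : Reals) @ \oo -->
       ((alpha (@std_grading K m) (F (svd F)))%:R / (svd F)%:R : Reals)) /\
  (* (2)(b)(ii) *)
  (forall I L : set R,
     homogeneous_ideal gr I -> homogeneous_ideal gr L ->
     let F := fun n => saturation (ideal_pow I n) L in
     noetherian_filtration F ->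
     equigenerated gr I -> local_infinite_residue (gr 0%N) ->
     (forall p, stable_Ass F p ->
        cvgn (fun n => (local_v gr p (F n))%:R / n%:R : Reals)) /\
     (fun n => (v_number gr (F n))%:R / n%:R : Reals) @ \oo -->
       ((alpha gr (F (svd F)))%:R / (svd F)%:R : Reals)) /\
  (* (2)(c) *)
  (forall (K : fieldType) (m : nat) (e : rel 'I_m),
     ssrbool.symmetric e -> irreflexive e ->
     let J := @cover_ideal K m e in
     let F := symbolic_power J in
     (forall p, stable_Ass F p ->
        cvgn (fun n =>
          (local_v (@std_grading K m) p (F n))%:R / n%:R : Reals)) /\
     (fun n => (v_number (@std_grading K m) (F n))%:R / n%:R : Reals) @ \oo -->
       ((alpha (@std_grading K m) (F 2%N))%:R / 2 : Reals)).
Proof.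
split; first exact: (v_integral_closure hgr hR).
split.
  move=> I L hI hL F nF; have [[iF _ _ _] _] := nF.
  apply: (v_quasi_linear hgr hR nF.1 _ nF) => n.
  have hI' := (hom_homogeneous hgr I).1 hI; have hL' := (hom_homogeneous hgr L).1 hL.
  by apply: (hom_saturation hgr (hom_pow hgr n hI') hL'); exact: iF.
split.
  move=> K m I L hI hL F nF _ _.
  exact: (v_saturation_cvg (grading_mgrading K mdeg) (@noetherian_mpoly K m) Reals hI hL nF).
split; first by move=> I L hI hL F nF _ _; exact: (v_saturation_cvg hgr hR Reals hI hL nF).
by move=> K m e esym eirr; exact: v_cover_cvg.
Qed.
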